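(* For every integer $n \ge 6$, $ex_{_\mathcal{P}}(n,\Theta_6)\leq \frac{18(n-2)}{7}$. Moreover, equality holds when $n=9$, that is, $ex_{_\mathcal{P}}(9,\Theta_6)=18$.
   Context: All graphs are finite and simple. For a family $\mathcal{F}$ of graphs, a graph is $\mathcal{F}$-free if it contains no graph in $\mathcal{F}$ as a (not necessarily induced) subgraph. The planar Turán number $ex_{_\mathcal{P}}(n,\mathcal{F})$ is the maximum number of edges in an $\mathcal{F}$-free planar graph on $n$ vertices. A Theta graph is a graph on at least $4$ vertices obtained from a cycle by adding one additional edge joining two non-consecutive vertices of the cycle. For an integer $k\ge 4$, $\Theta_k$ denotes the family of all non-isomorphic Theta graphs on $k$ vertices; thus $\Theta_6$ is the family of all graphs obtained from the $6$-cycle by adding one chord. *)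

(* Defs.v *)
From HB Require Import structures.
From mathcomp Require Import all_boot all_order all_algebra.
From mathcomp Require Import all_classical all_reals all_analysis.
Import Order.TTheory GRing.Theory Num.Theory.
Import numFieldNormedType.Exports.
Set Implicit Arguments.
Unset Strict Implicit.
Unset Printing Implicit Defensive.

Local Open Scope ring_scope.

Definition sgraph (T : finType) :=
  {E : {set {set T}} | [forall e in E, #|e| == 2%N]}.

Definition edges (T : finType) (G : sgraph T) : {set {set T}} := val G.

(* Not necessarily induced: H may miss edges of G between vertices of its
   image. *)
Definition contains (T S : finType) (G : sgraph T) (H : sgraph S) : Prop :=
  exists f : S -> T,
    injective f /\ forall e, e \in edges H -> f @: e \in edges G.

Definition graph_family := forall T : finType, sgraph T -> Prop.

Definition family_free (F : graph_family) (T : finType) (G : sgraph T) : Prop :=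
  forall (S : finType) (H : sgraph S), F S H -> ~ contains G H.

Definition consecutive (T : eqType) (c : seq T) (x y : T) : bool :=
  (y == next c x) || (x == next c y).

(* The cycle is given as the list c of all vertices in cyclic order. *)
Definition is_theta (T : finType) (G : sgraph T) : Prop :=
  (4 <= #|T|)%N /\
  exists (c : seq T) (x y : T),
    [/\ uniq c,
        forall v, v \in c,
        x != y,
        ~~ consecutive c x y
      & edges G = [set x; y]%SET |: [set [set v; next c v]%SET | v : T]].

(* This family is closed under isomorphism; keeping one representative of each
   isomorphism class instead gives the same family-free graphs. *)
Definition Theta (k : nat) : graph_family :=
  fun T G => #|T| = k /\ is_theta G.

Definition is_arc (R : realType) (g : R -> R * R) : Prop :=
  {within `[0, 1], continuous g}%classic /\ {in `[0, 1] &, injective g}.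

(* Edge e is drawn as the image of [0, 1] under arc e; values of arc on sets
   that are not edges are irrelevant. *)
Definition plane_drawing (R : realType) (T : finType) (G : sgraph T)
    (pos : T -> R * R) (arc : {set T} -> R -> R * R) : Prop :=
  [/\ injective pos,
      forall e, e \in edges G ->
        is_arc (arc e) /\
        [set arc e 0; arc e 1]%classic = (pos @` [set` e])%classic,
      forall e v (t : R), e \in edges G -> 0 < t < 1 -> arc e t <> pos v
    & forall e e' (s t : R), e \in edges G -> e' \in edges G -> e != e' ->
        0 < s < 1 -> 0 <= t <= 1 -> arc e s <> arc e' t].

Definition planar (R : realType) (T : finType) (G : sgraph T) : Prop :=
  exists (pos : T -> R * R) (arc : {set T} -> R -> R * R),
    plane_drawing G pos arc.

(* Every graph on n vertices is isomorphic to one on 'I_n, so the maximum is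
   taken over the finite type sgraph 'I_n. The value is 0 when no planar graph
   on n vertices is F-free; this does not happen when every member of F has an
   edge. *)
Definition ex_planar (R : realType) (n : nat) (F : graph_family) : nat :=
  \max_(G : sgraph 'I_n | `[< planar R G /\ family_free F G >]) #|edges G|.

(* Main.v *)
(** Cut every arc of a plane drawing into thirds and trace the
    pieces on a fine square grid: this exhibits the graph as a minor of a grid.
    The unit squares of a grid generate its cycle space and every edge lies on
    two of them; this property is inherited by minors.  Hence the cycle space of
    the graph is generated by a family of "faces" such that every edge lies on
    two faces or on none, and counting dimensions gives at least e - n + 2 faces.
    No Jordan curve theorem is involved.

    With f = e - n + 2, the claim 7 e <= 18 (n - 2) reads 18 f <= 11 e.  Give a face
    with k edges the charge 11 k - 36, so that the total is 22 e - 36 f: triangles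
    lack 3, all other faces have a surplus, which they send across their edges to
    triangular faces.  A class of triangular faces linked through shared edges has at
    most five vertices, since otherwise six of its vertices span a Theta graph; a count
    leaves K4, five vertices with eight edges and K5 minus an edge as the only classes
    that need more than 2 per boundary edge, and around these the small faces are
    excluded or send all their charge into the class.  Families with at most 9 edges
    only satisfy 18 f <= 11 e + 9, but splitting a family into two zero-sum parts
    gains 18.

    Two copies of K5 minus an edge sharing a vertex have 18 edges and no 6-cycle. *)

From mathcomp Require Import all_boot.
From mathcomp Require Import zify.
Set Implicit Arguments. Unset Strict Implicit. Unset Printing Implicit Defensive.

(** * Even edge sets *)

(** Arcs with a common end come arbitrarily close to each other, so no grid separates whole arcs.
    Thirds remove this obstacle: a middle third is at positive distance from all vertices and all
    other arcs, and the outer thirds are absorbed into the branch sets of their ends.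

    Faces are mere even edge sets. This suffices, since a nonempty even set of at most five edges is
    a cycle, and of larger faces only the size is used.

    A class whose boundary is empty or is a single 4-face may receive too little charge. The class,
    together with that face if there is one, sums to zero; so the discharging is done for families
    without proper zero-sum subfamilies, where such a class exhausts the family and covers at most
    nine edges.

    Dimensions are not defined: a space of dimension d enters through its 2 ^ d elements.

    K5 has too few vertices to contain a Theta graph, so the bound of nine edges on five vertices
    must come from planarity, applied once more to an induced subgraph. *)

Ltac rewrite_neqs := repeat match goal with
  | H : is_true (?x != ?y) |- context[?x == ?y] => rewrite (negbTE H)
  | H : is_true (?x != ?y) |- context[?y == ?x] => rewrite (eq_sym y x) (negbTE H)
  end.

Lemma odd_card (X : finType) (A : {set X}) : odd #|A| = \big[addb/false]_x (x \in A).
Proof.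
rewrite -sum1_card (big_morph odd oddD (erefl _)) big_mkcond /=.
by apply: eq_bigr => x _; case: (x \in A).
Qed.

Section EvenSets.
Variable T : finType.
Implicit Types (u v w x y : T) (e : {set T}) (z c : {set {set T}}).

Definition ed x y : {set T} := [set x; y].

Lemma edC x y : ed x y = ed y x. Proof. exact: setUC. Qed.

Lemma in_ed v x y : (v \in ed x y) = (v == x) || (v == y).
Proof. by rewrite !inE. Qed.

Lemma ed_eq x y u v : (ed x y == ed u v) = (x == u) && (y == v) || (x == v) && (y == u).
Proof.
apply/eqP/idP => [E|]; last by case/orP => /andP [/eqP -> /eqP ->] //; rewrite edC.
have Hx : x \in ed u v by rewrite -E in_ed eqxx.
have Hy : y \in ed u v by rewrite -E in_ed eqxx orbT.
have Hu : u \in ed x y by rewrite E in_ed eqxx.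
have Hv : v \in ed x y by rewrite E in_ed eqxx orbT.
move: Hx Hy Hu Hv; rewrite !in_ed ![u == _]eq_sym ![v == _]eq_sym.
by case: (x == u); case: (x == v); case: (y == u); case: (y == v).
Qed.

Lemma card_ed x y : #|ed x y| = (x != y).+1.
Proof. by rewrite cards2. Qed.

Definition degz z v := #|[set e in z | v \in e]|.
Definition even_set z := [forall v, ~~ odd (degz z v)].
Definition two_unif z := [forall e in z, #|e| == 2].

Lemma even_setP z : reflect (forall v, odd (degz z v) = false) (even_set z).
Proof. by apply: (iffP forallP) => H v; [apply/negbTE|rewrite H]. Qed.

Lemma two_unifP z : reflect (forall e, e \in z -> #|e| = 2) (two_unif z).
Proof. by apply: (iffP forall_inP) => H e /H => [/eqP|->]. Qed.

Lemma two_unifS z1 z2 : z1 \subset z2 -> two_unif z2 -> two_unif z1.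
Proof. by move=> /subsetP s /two_unifP H; apply/two_unifP => e /s /H. Qed.

Lemma two_unif_ed z u v : two_unif z -> ed u v \in z -> u != v.
Proof. by move=> /two_unifP H /H; rewrite card_ed; case: (u != v). Qed.

Lemma degzU1 z e v : e \notin z -> degz (e |: z) v = (v \in e) + degz z v.
Proof.
move=> ez; rewrite /degz; case ve: (v \in e).
  rewrite (_ : [set _ in _ | _] = e |: [set f in z | v \in f]).
    by rewrite cardsU1 inE (negPf ez).
  by apply/setP => f; rewrite !inE; case: eqP => // ->; rewrite ve.
congr #|pred_of_set _|; apply/setP => f; rewrite !inE; case: eqP => // ->.
by rewrite ve (negPf ez).
Qed.

Lemma degz0 v : degz set0 v = 0.
Proof. by apply/eqP; rewrite cards_eq0; apply/eqP/setP => e; rewrite !inE. Qed.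

Lemma odd_ed v x y : x != y -> (v \in ed x y) = (v == x) (+) (v == y).
Proof.
move=> xy; rewrite in_ed; case: (v =P x) => [->|_] /=; last by [].
by rewrite (negPf xy).
Qed.

Lemma degzD z c v : c \subset z -> degz (z :\: c) v = degz z v - degz c v.
Proof.
move=> cz; rewrite /degz.
rewrite (_ : [set e in z :\: c | _] = [set e in z | v \in e] :\: [set e in c | v \in e]).
  rewrite cardsD (setIidPr _) //; apply/subsetP => e; rewrite !inE => /andP [/(subsetP cz) -> ->//].
by apply/setP => e; rewrite !inE; case: (v \in e); rewrite ?andbF ?andbT.
Qed.

Lemma even_setD z c : c \subset z -> even_set z -> even_set c -> even_set (z :\: c).
Proof.
move=> cz /even_setP ez /even_setP ec; apply/even_setP => v.
rewrite degzD // oddB ?ez ?ec //; apply: subset_leq_card; apply/subsetP => e.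
by rewrite !inE => /andP [/(subsetP cz) -> ->].
Qed.

(** A positive even degree is at least two, so a walk that enters v can leave it by another edge. *)
Lemma even_next z u v : two_unif z -> even_set z -> ed u v \in z ->
  exists w, [/\ w != u, w != v & ed v w \in z].
Proof.
move=> z2 ez uv.
have vuv : ed u v \in [set e in z | v \in e] by rewrite inE uv in_ed eqxx orbT.
have : 0 < #|[set e in z | v \in e] :\ ed u v|.
  move/even_setP/(_ v): ez; rewrite /degz (cardsD1 (ed u v)) vuv /=.
  by case: #|_|.
case/card_gt0P => e; rewrite !inE => /and3P [ne ze ve].
have /eqP/cards2P [a [b [ab E]]] := (two_unifP _ z2) _ ze.
have [w [wv Ew]] : exists w, w != v /\ e = ed v w.
  move: ve; rewrite E !inE => /orP [] /eqP ->; [exists b|exists a]; first by rewrite eq_sym.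
  by split=> //; exact: setUC.
exists w; split=> //; last by rewrite -Ew.
by apply: contraNneq ne => wu; rewrite Ew wu edC.
Qed.

Lemma even_card_ge3 z : two_unif z -> even_set z -> z != set0 -> 3 <= #|z|.
Proof.
move=> z2 ez /set0Pn [e ze].
have /eqP/cards2P [u [v [uv E]]] := (two_unifP _ z2) _ ze.
rewrite -/(ed u v) in E; subst e.
have [w [wu wv vw]] := even_next z2 ez ze.
have [x [xv xw wx]] := even_next z2 ez vw.
have <- : #|[set ed u v; ed v w; ed w x]| = 3.
  rewrite -setUA cardsU1 cardsU1 cards1 !inE !ed_eq; rewrite_neqs.
  by rewrite /= ?andbF ?orbF ?orbT ?andbT; rewrite_neqs.
by apply/subset_leq_card/subsetP => f; rewrite !inE => /orP[/orP[]|] /eqP ->.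
Qed.

(** The complement of an even subset is even, hence empty or of at least three edges. This keeps
    3-cycles out of even sets with four or five edges, and 4-cycles out of those with five or
    six. *)
Lemma even_sub_card z c : two_unif z -> even_set z -> c \subset z -> even_set c ->
  z = c \/ #|c| + 3 <= #|z|.
Proof.
move=> z2 ez cz ec; case: (eqVneq (z :\: c) set0) => [/eqP|ne].
  by rewrite setD_eq0 => zc; left; apply/eqP; rewrite eqEsubset zc cz.
right; have := even_card_ge3 (two_unifS (subsetDl z c) z2) (even_setD cz ez ec) ne.
rewrite cardsD (setIidPr cz); have := subset_leq_card cz; lia.
Qed.

End EvenSets.

Ltac solve_uniq := rewrite /= ?inE ?negb_or ?ed_eq /=; rewrite_neqs;
  rewrite /= ?eqxx ?andbT ?andbF ?orbF ?orbT //.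

(** * Even sets with three, four or five edges *)

Section Cycles.
Variable T : finType.
Implicit Types (u v w x y : T) (e : {set T}) (z c : {set {set T}}).

Definition cyc3 u v w : {set {set T}} := ed u v |: (ed v w |: [set ed w u]).
Definition cyc4 u v w x : {set {set T}} := ed u v |: (ed v w |: (ed w x |: [set ed x u])).
Definition cyc5 u v w x y : {set {set T}} :=
  ed u v |: (ed v w |: (ed w x |: (ed x y |: [set ed y u]))).

Lemma degz1 e v : degz [set e] v = (v \in e).
Proof. by rewrite -[[set e]]setU0 degzU1 ?inE // degz0 addn0. Qed.

Lemma uniq3P u v w : uniq [:: u; v; w] -> [/\ u != v, u != w & v != w].
Proof. by rewrite /= !inE !negb_or => /and3P [/andP [-> ->] -> _]. Qed.

Lemma cyc3_even u v w : uniq [:: u; v; w] -> even_set (cyc3 u v w).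
Proof.
case/uniq3P=> uv uw vw; apply/even_setP => a.
rewrite /cyc3 !degzU1 ?degz1; try by solve_uniq.
rewrite !oddD !oddb !odd_ed //; last by rewrite eq_sym.
by case: (a == u); case: (a == v); case: (a == w).
Qed.

Lemma card_cyc3 u v w : uniq [:: u; v; w] -> #|cyc3 u v w| = 3.
Proof. by case/uniq3P=> uv uw vw; rewrite /cyc3 !cardsU1 cards1; solve_uniq. Qed.

Lemma uniq4P u v w x : uniq [:: u; v; w; x] ->
  [/\ u != v, u != w & u != x] /\ [/\ v != w, v != x & w != x].
Proof. by rewrite /= !inE !negb_or -!andbA => /and5P [-> -> -> -> /and3P [-> -> _]]. Qed.

Lemma cyc4_even u v w x : uniq [:: u; v; w; x] -> even_set (cyc4 u v w x).
Proof.
case/uniq4P=> [[uv uw ux] [vw vx wx]]; apply/even_setP => a.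
rewrite /cyc4 !degzU1 ?degz1; try by solve_uniq.
rewrite !oddD !oddb !odd_ed //; last by rewrite eq_sym.
by case: (a == u); case: (a == v); case: (a == w); case: (a == x).
Qed.

Lemma card_cyc4 u v w x : uniq [:: u; v; w; x] -> #|cyc4 u v w x| = 4.
Proof.
by case/uniq4P=> [[uv uw ux] [vw vx wx]]; rewrite /cyc4 !cardsU1 cards1; solve_uniq.
Qed.

Lemma uniq5P u v w x y : uniq [:: u; v; w; x; y] ->
  [/\ u != v, u != w, u != x & u != y] /\ [/\ v != w, v != x & v != y]
   /\ [/\ w != x, w != y & x != y].
Proof.
by rewrite /= !inE !negb_or -!andbA => /and5P [-> -> -> -> /and5P[-> -> -> -> /and3P [-> -> _]]].
Qed.

Lemma card_cyc5 u v w x y : uniq [:: u; v; w; x; y] -> #|cyc5 u v w x y| = 5.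
Proof.
case/uniq5P=> [[uv uw ux uy] [[vw vx vy] [wx wy xy]]].
by rewrite /cyc5 !cardsU1 cards1; solve_uniq.
Qed.

Lemma no_cyc3 z u v w : two_unif z -> even_set z -> 3 < #|z| < 6 ->
  uniq [:: u; v; w] -> ed u v \in z -> ed v w \in z -> ed w u \in z -> False.
Proof.
move=> z2 ez hz un uv vw wu.
have s : cyc3 u v w \subset z by rewrite /cyc3 !subUset !sub1set uv vw wu.
case: (even_sub_card z2 ez s (cyc3_even un)) => [E|]; last by rewrite card_cyc3 //; lia.
by move: hz; rewrite E card_cyc3.
Qed.

Lemma no_cyc4 z u v w x : two_unif z -> even_set z -> 4 < #|z| < 7 ->
  uniq [:: u; v; w; x] ->
  ed u v \in z -> ed v w \in z -> ed w x \in z -> ed x u \in z -> False.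
Proof.
move=> z2 ez hz un uv vw wx xu.
have s : cyc4 u v w x \subset z by rewrite /cyc4 !subUset !sub1set uv vw wx xu.
case: (even_sub_card z2 ez s (cyc4_even un)) => [E|]; last by rewrite card_cyc4 //; lia.
by move: hz; rewrite E card_cyc4.
Qed.

Lemma even3P z u v : two_unif z -> even_set z -> #|z| = 3 -> ed u v \in z ->
  exists w, uniq [:: u; v; w] /\ z = cyc3 u v w.
Proof.
move=> z2 ez cz uv; have nuv := two_unif_ed z2 uv.
have [w [wu wv vw]] := even_next z2 ez uv.
have [x [xv xw wx]] := even_next z2 ez vw.
have s : [set ed u v; ed v w; ed w x] \subset z by rewrite !subUset !sub1set uv vw wx.
have c3 : #|[set ed u v; ed v w; ed w x]| = 3.
  rewrite -setUA cardsU1 cardsU1 cards1; solve_uniq.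
have Ez : [set ed u v; ed v w; ed w x] = z by apply/eqP; rewrite eqEcard s cz c3.
have [y [yw yx xy]] := even_next z2 ez wx.
have xu : x = u.
  move: xy; rewrite -Ez !inE !ed_eq; rewrite_neqs; rewrite /= ?andbF ?orbF ?orbT.
  by case/andP => /eqP.
subst x; exists w; split; first by solve_uniq.
by rewrite -Ez /cyc3 setUA.
Qed.

Lemma even4P z u v : two_unif z -> even_set z -> #|z| = 4 -> ed u v \in z ->
  exists w x, uniq [:: u; v; w; x] /\ z = cyc4 u v w x.
Proof.
move=> z2 ez cz uv; have nuv := two_unif_ed z2 uv.
have c36 : 3 < #|z| < 6 by rewrite cz.
have [w [wu wv vw]] := even_next z2 ez uv.
have [x [xv xw wx]] := even_next z2 ez vw.
have xu : x != u.
  apply/eqP => E; subst x; apply: (@no_cyc3 z u v w) => //; by solve_uniq.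
have [y [yw yx xy]] := even_next z2 ez wx.
have yv : y != v.
  apply/eqP => E; subst y; apply: (@no_cyc3 z v w x) => //; by solve_uniq.
have yu : y = u.
  apply/eqP/negPn/negP => yu.
  have [t [tx ty yt]] := even_next z2 ez xy.
  have s : ed u v |: (ed v w |: (ed w x |: (ed x y |: [set ed y t]))) \subset z.
    by rewrite !subUset !sub1set uv vw wx xy yt.
  have := subset_leq_card s; rewrite cz !cardsU1 cards1.
  solve_uniq.
subst y; exists w, x; split; first by solve_uniq.
apply/eqP; rewrite eq_sym eqEcard cz card_cyc4; last by solve_uniq.
by rewrite /cyc4 !subUset !sub1set uv vw wx xy.
Qed.

(** The walk given by [even_next] cannot return early, because [no_cyc3] and [no_cyc4] forbid
    shorter cycles, and it must return after five edges because there is no sixth. *)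
Lemma even5P z u v : two_unif z -> even_set z -> #|z| = 5 -> ed u v \in z ->
  exists w x y, uniq [:: u; v; w; x; y] /\ z = cyc5 u v w x y.
Proof.
move=> z2 ez cz uv; have nuv := two_unif_ed z2 uv.
have c36 : 3 < #|z| < 6 by rewrite cz.
have c47 : 4 < #|z| < 7 by rewrite cz.
have [w [wu wv vw]] := even_next z2 ez uv.
have [x [xv xw wx]] := even_next z2 ez vw.
have xu : x != u.
  apply/eqP => E; subst x; apply: (@no_cyc3 z u v w) => //; by solve_uniq.
have [y [yw yx xy]] := even_next z2 ez wx.
have yv : y != v.
  apply/eqP => E; subst y; apply: (@no_cyc3 z v w x) => //; by solve_uniq.
have yu : y != u.
  apply/eqP => E; subst y; apply: (@no_cyc4 z u v w x) => //; by solve_uniq.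
have [t [tx ty yt]] := even_next z2 ez xy.
have tw : t != w.
  apply/eqP => E; subst t; apply: (@no_cyc3 z w x y) => //; by solve_uniq.
have tv : t != v.
  apply/eqP => E; subst t; apply: (@no_cyc4 z v w x y) => //; by solve_uniq.
have tu : t = u.
  apply/eqP/negPn/negP => tu.
  have [s [sy st ts]] := even_next z2 ez yt.
  have sz : ed u v |: (ed v w |: (ed w x |: (ed x y |: (ed y t |: [set ed t s])))) \subset z.
    by rewrite !subUset !sub1set uv vw wx xy yt ts.
  have := subset_leq_card sz; rewrite cz !cardsU1 cards1.
  solve_uniq.
subst t; exists w, x, y; split; first by solve_uniq.
apply/eqP; rewrite eq_sym eqEcard cz card_cyc5; last by solve_uniq.
by rewrite /cyc5 !subUset !sub1set uv vw wx xy yt.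
Qed.

End Cycles.

Lemma cyc3C (T : finType) (u v w : T) : cyc3 u v w = cyc3 v u w.
Proof.
apply/setP => e; rewrite /cyc3 !inE (edC v u) (edC u w) (edC w v).
by congr orb; rewrite orbC.
Qed.

Lemma cyc3R (T : finType) (u v w : T) : cyc3 u v w = cyc3 v w u.
Proof.
apply/setP => e; rewrite /cyc3 !inE.
by case: (e == _); case: (e == _); case: (e == _).
Qed.

Lemma ed_sub (T : finType) (u v : T) (S : {set T}) :
  (ed u v \subset S) = (u \in S) && (v \in S).
Proof. by rewrite subUset !sub1set. Qed.

(* Up to symmetry, the chords of the 6-cycle are ac and ad. *)
Definition no_theta6 (T : finType) (E : {set {set T}}) :=
  forall a b c d e f : T, uniq [:: a; b; c; d; e; f] ->
    ed a b \in E -> ed b c \in E -> ed c d \in E -> ed d e \in E -> ed e f \in E ->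
    ed f a \in E -> ed a c \notin E /\ ed a d \notin E.

(** * Classes of triangular faces *)

Section Cluster.
Variables (T I : finType) (E : {set {set T}}) (B : I -> {set {set T}}).
Hypothesis E2 : two_unif E.
Hypothesis noT : no_theta6 E.
Hypothesis BE : forall i, B i \subset E.
Hypothesis Bev : forall i, even_set (B i).
Hypothesis B2 : forall i e, e \in B i -> #|[set j | e \in B j]| = 2.

Lemma BinE i e : e \in B i -> e \in E. Proof. exact: (subsetP (BE i)). Qed.

Lemma B2u i : two_unif (B i). Proof. exact: two_unifS (BE i) E2. Qed.

Lemma covered_twice e i j k : i != j -> e \in B i -> e \in B j -> e \in B k -> k = i \/ k = j.
Proof.
move=> ij ei ej ek; case: (eqVneq k i) => [|ki]; first by left.
case: (eqVneq k j) => [|kj]; first by right.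
have s : [set i; j; k] \subset [set j | e \in B j].
  by apply/subsetP => l; rewrite !inE => /orP[/orP[]|] /eqP ->.
have := subset_leq_card s; rewrite (B2 ei) -setUA !cardsU1 cards1 !inE negb_or.
by rewrite_neqs.
Qed.

Lemma other_face i e : e \in B i -> exists2 j, j != i & e \in B j.
Proof.
move=> ei; have : 0 < #|[set j | e \in B j] :\ i|.
  by have := B2 ei; rewrite (cardsD1 i) inE ei add1n => -[->].
by case/card_gt0P => j; rewrite !inE => /andP []; exists j.
Qed.

Definition tri i := #|B i| == 3.

Lemma triP i u v : tri i -> ed u v \in B i -> exists w, uniq [:: u; v; w] /\ B i = cyc3 u v w.
Proof. by move=> /eqP c3; apply: even3P => //; apply: B2u. Qed.

(* K is a class of triangular faces under the relation of sharing an edge. *)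
Variable K : {set I}.
Hypothesis Ktri : forall j, j \in K -> tri j.
Hypothesis Kclosed : forall i j e, j \in K -> tri i -> e \in B i -> e \in B j -> i \in K.
Hypothesis Kconn : forall X : {set I}, X \subset K -> X != set0 -> X != K ->
  exists i j e, [/\ i \in X, j \in K, j \notin X, e \in B i & e \in B j].

Definition inside (S : {set T}) := [set j in K | [forall e in B j, e \subset S]].

Lemma insideP (S : {set T}) j :
  reflect (j \in K /\ forall e, e \in B j -> e \subset S) (j \in inside S).
Proof. by rewrite inE; apply: (iffP andP) => -[-> /forall_inP]. Qed.

Lemma inside_cyc3 (S : {set T}) i u v w : i \in K -> B i = cyc3 u v w ->
  u \in S -> v \in S -> w \in S -> i \in inside S.
Proof.
move=> iK Ei uS vS wS; apply/insideP; split=> // e; rewrite Ei /cyc3 !inE.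
by case/or3P => /eqP ->; rewrite ed_sub ?uS ?vS ?wS.
Qed.

Lemma in_cyc3 i (u v w : T) : B i = cyc3 u v w ->
  [/\ ed u v \in B i, ed v w \in B i & ed u w \in B i].
Proof. by move=> ->; rewrite /cyc3 (edC w u) !inE !eqxx /= ?orbT. Qed.

(** A face of the class across an edge pq within S has one further vertex x, and x lies outside S,
    as the face would otherwise be inside already. So each growth step adds a single vertex. *)
Lemma grow (S : {set T}) : inside S != set0 -> inside S != K ->
  exists i j p q x, [/\ i \in inside S, j \in K & j \notin inside S] /\
   [/\ ed p q \in B i, B j = cyc3 p q x, uniq [:: p; q; x] & [/\ p \in S, q \in S & x \notin S]].
Proof.
move=> n0 nK; have sK : inside S \subset K by apply/subsetP => j /insideP [].
have [i [j [e [iX jK jX ei ej]]]] := Kconn sK n0 nK.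
have /eqP/cards2P [p [q [pq Ee]]] := (two_unifP _ E2) _ (BinE ei).
rewrite -/(ed p q) in Ee; subst e.
have [x [un Ej]] := triP (Ktri jK) ej.
have [_ /(_ _ ei)] := insideP _ _ iX; rewrite ed_sub => /andP [pS qS].
exists i, j, p, q, x; do 2!split=> //; split=> //.
by apply: contra jX; apply: inside_cyc3 Ej pS qS.
Qed.

Lemma ham p q z y1 y2 y3 : uniq [:: p; y1; y2; y3; q; z] ->
  ed p y1 \in E -> ed y1 y2 \in E -> ed y2 y3 \in E -> ed y3 q \in E ->
  ed q z \in E -> ed p z \in E -> ed p q \in E -> False.
Proof.
move=> un a b c d e f g.
have un' : uniq [:: q; z; p; y1; y2; y3].
  by move: un; rewrite -(rot_uniq 4).
by have [] := noT un' e; rewrite ?(edC z p) ?(edC q p) // g.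
Qed.

Definition cluster_edges := \bigcup_(j in K) B j.

Lemma cluster_edges_sub e : e \in cluster_edges -> e \in E.
Proof. by case/bigcupP => j _; apply: BinE. Qed.

Lemma mem_cluster_edges j e : j \in K -> e \in B j -> e \in cluster_edges.
Proof. by move=> jK ej; apply/bigcupP; exists j. Qed.

(** Three triangles glued along edges on five vertices have seven edges. The bound is recorded so
    that a class with six edges is known to have at most four vertices. *)
Definition small_cluster :=
  exists2 S : {set T}, #|S| <= 4 \/ (#|S| = 5 /\ 7 <= #|cluster_edges|) & inside S = K.

Ltac ee := solve [assumption | rewrite edC; assumption].
Ltac hamt p q z x y w :=
  first [ by apply: (@ham p q z x y w); [by solve_uniq| ee..]
        | by apply: (@ham p q z x w y); [by solve_uniq| ee..]
        | by apply: (@ham p q z y x w); [by solve_uniq| ee..]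
        | by apply: (@ham p q z y w x); [by solve_uniq| ee..]
        | by apply: (@ham p q z w x y); [by solve_uniq| ee..]
        | by apply: (@ham p q z w y x); [by solve_uniq| ee..]].

(* A face of the class that leaves the five vertices does so across an edge pq
   other than bc and ab, which lie on two faces already; a Hamiltonian path of the
   five vertices from p to q then closes to a 6-cycle with chord pq. *)
Lemma grow5A a b c d x i1 i2 i3 : uniq [:: a; b; c; d; x] ->
  i1 \in K -> i2 \in K -> i3 \in K ->
  B i1 = cyc3 a b c -> B i2 = cyc3 b c d -> B i3 = cyc3 a b x -> small_cluster.
Proof.
move=> un k1 k2 k3 f1 f2 f3.
have [[ab ac ad ax] [[bc bdry bx] [cd cx dx]]] := uniq5P un.
pose S := [set z in [:: a; b; c; d; x]].
have S5 : #|S| = 5 by rewrite cardsE; exact/card_uniqP.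
have [ab1 bc1 ac1] := in_cyc3 f1; have [bc2 cd2 bd2] := in_cyc3 f2.
have [ab3 bx3 ax3] := in_cyc3 f3.
have n1 : i1 \in inside S by apply: (inside_cyc3 k1 f1); rewrite !inE eqxx ?orbT.
have n2 : i2 \in inside S by apply: (inside_cyc3 k2 f2); rewrite !inE eqxx ?orbT.
have n3 : i3 \in inside S by apply: (inside_cyc3 k3 f3); rewrite !inE eqxx ?orbT.
have i12 : i1 != i2.
  by apply/eqP => E12; move: cd2; rewrite -E12 f1 /cyc3; solve_uniq.
have i13 : i1 != i3.
  by apply/eqP => E13; move: ax3; rewrite -E13 f1 /cyc3; solve_uniq.
exists S.
  right; split=> //.
  have s : ed a b |: (ed b c |: (ed a c |: (ed b d |: (ed c d |: (ed a x |: [set ed b x])))))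
      \subset cluster_edges.
    by rewrite !subUset !sub1set (mem_cluster_edges k1 ab1) (mem_cluster_edges k1 bc1)
       (mem_cluster_edges k1 ac1) (mem_cluster_edges k2 bd2)
       (mem_cluster_edges k2 cd2) (mem_cluster_edges k3 ax3) (mem_cluster_edges k3 bx3).
  by apply: leq_trans (subset_leq_card s); rewrite !cardsU1 cards1; solve_uniq.
apply/eqP/negPn/negP => nK.
have n0 : inside S != set0 by apply/set0Pn; exists i1.
have [i [j [p [q [z [[iS jK jS] [pqi fj unj [pS qS zS]]]]]]]] := grow n0 nK.
have [pq qz pz] := in_cyc3 fj.
have jn k : k \in inside S -> j != k by apply: contraTneq => <-.
have jbc : ed b c \in B j -> False.
  by move=> h; case: (covered_twice i12 bc1 bc2 h) => Ej; subst j; rewrite ?n1 ?n2 in jS.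
have jab : ed a b \in B j -> False.
  by move=> h; case: (covered_twice i13 ab1 ab3 h) => Ej; subst j; rewrite ?n1 ?n3 in jS.
have := BinE pq; have := BinE qz; have := BinE pz.
move: (BinE ab1) (BinE bc1) (BinE ac1) (BinE cd2) (BinE bd2) (BinE bx3) (BinE ax3).
move=> Eab Ebc Eac Ecd Ebd Ebx Eax Epz Eqz Epq.
have [npq _ _] := uniq3P unj.
move: pS qS zS; rewrite !inE !negb_or => pS qS /and5P [za zb zc zd zx].
move: pS => /or4P [|||/orP[]] /eqP ?; move: qS => /or4P [|||/orP[]] /eqP ?; subst p q;
 try (by rewrite eqxx in npq);
 try (by apply: jab; first [exact: pq| rewrite edC]);
 try (by apply: jbc; first [exact: pq| rewrite edC]).
- by hamt a c z b d x.
- by hamt a d z b c x.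
- by hamt a x z b c d.
- by hamt b d z a c x.
- by hamt b x z a c d.
- by hamt c a z b d x.
- by hamt c d z a b x.
- by hamt c x z a b d.
- by hamt d a z b c x.
- by hamt d b z a c x.
- by hamt d c z a b x.
- by hamt d x z a b c.
- by hamt x a z b c d.
- by hamt x b z a c d.
- by hamt x c z a b d.
- by hamt x d z a b c.
Qed.

(* Here the first four vertices span a K4 with inner vertex b, and ad is saturated. *)
Lemma grow5B a b c d x i0 i1 i2 i3 : uniq [:: a; b; c; d; x] ->
  i0 \in K -> i1 \in K -> i2 \in K -> i3 \in K -> B i0 = cyc3 a b d ->
  B i1 = cyc3 a b c -> B i2 = cyc3 b c d -> B i3 = cyc3 a d x -> small_cluster.
Proof.
move=> un k0 k1 k2 k3 f0 f1 f2 f3.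
have [[ab ac ad ax] [[bc bdry bx] [cd cx dx]]] := uniq5P un.
pose S := [set z in [:: a; b; c; d; x]].
have S5 : #|S| = 5 by rewrite cardsE; exact/card_uniqP.
have [ab1 bc1 ac1] := in_cyc3 f1; have [bc2 cd2 bd2] := in_cyc3 f2.
have [ad3 dx3 ax3] := in_cyc3 f3; have [_ _ ad0] := in_cyc3 f0.
have n1 : i1 \in inside S by apply: (inside_cyc3 k1 f1); rewrite !inE eqxx ?orbT.
have n0 : i0 \in inside S by apply: (inside_cyc3 k0 f0); rewrite !inE eqxx ?orbT.
have n3 : i3 \in inside S by apply: (inside_cyc3 k3 f3); rewrite !inE eqxx ?orbT.
have i03 : i0 != i3.
  by apply/eqP => E13; move: ax3; rewrite -E13 f0 /cyc3; solve_uniq.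
exists S.
  right; split=> //.
  have s : ed a b |: (ed b c |: (ed a c |: (ed b d |: (ed c d |: (ed a x |: [set ed d x])))))
      \subset cluster_edges.
    by rewrite !subUset !sub1set (mem_cluster_edges k1 ab1) (mem_cluster_edges k1 bc1)
       (mem_cluster_edges k1 ac1) (mem_cluster_edges k2 bd2)
       (mem_cluster_edges k2 cd2) (mem_cluster_edges k3 ax3) (mem_cluster_edges k3 dx3).
  by apply: leq_trans (subset_leq_card s); rewrite !cardsU1 cards1; solve_uniq.
apply/eqP/negPn/negP => nK.
have ne : inside S != set0 by apply/set0Pn; exists i1.
have [i [j [p [q [z [[iS jK jS] [pqi fj unj [pS qS zS]]]]]]]] := grow ne nK.
have [pq qz pz] := in_cyc3 fj.
have jad : ed a d \in B j -> False.
  by move=> h; case: (covered_twice i03 ad0 ad3 h) => Ej; subst j; rewrite ?n0 ?n3 in jS.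
have := BinE pq; have := BinE qz; have := BinE pz.
move: (BinE ab1) (BinE bc1) (BinE ac1) (BinE cd2) (BinE bd2) (BinE dx3) (BinE ax3) (BinE ad3).
move=> Eab Ebc Eac Ecd Ebd Edx Eax Ead Epz Eqz Epq.
have [npq _ _] := uniq3P unj.
move: pS qS zS; rewrite !inE !negb_or => pS qS /and5P [za zb zc zd zx].
move: pS => /or4P [|||/orP[]] /eqP ?; move: qS => /or4P [|||/orP[]] /eqP ?; subst p q;
 try (by rewrite eqxx in npq);
 try (by apply: jad; first [exact: pq| rewrite edC]).
- by hamt a b z c d x.
- by hamt a c z b d x.
- by hamt a x z b c d.
- by hamt b a z c d x.
- by hamt b c z a d x.
- by hamt b d z a c x.
- by hamt b x z a c d.
- by hamt c a z b d x.
- by hamt c b z a d x.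
- by hamt c d z a b x.
- by hamt c x z a b d.
- by hamt d b z a c x.
- by hamt d c z a b x.
- by hamt d x z a b c.
- by hamt x a z b c d.
- by hamt x b z a c d.
- by hamt x c z a b d.
- by hamt x d z a b c.
Qed.

End Cluster.

(** * Sums of faces modulo two *)

Section Sums.
Variables (T I : finType) (B : I -> {set {set T}}).
Implicit Types (J : {set I}) (e : {set T}).

(** Addition over the field with two elements. For a class of triangular faces this is its
    boundary. *)
Definition ssum J : {set {set T}} := [set e | odd #|[set j in J | e \in B j]|].

Lemma odd_cover J e : odd #|[set j in J | e \in B j]| = \big[addb/false]_(j in J) (e \in B j).
Proof.
rewrite odd_card [RHS]big_mkcond /=; apply: eq_bigr => j _; rewrite inE.
by case: (j \in J).
Qed.

Lemma in_ssum J e : (e \in ssum J) = \big[addb/false]_(j in J) (e \in B j).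
Proof. by rewrite inE odd_cover. Qed.

Lemma even_ssum J : (forall j, j \in J -> even_set (B j)) -> even_set (ssum J).
Proof.
move=> ev; apply/even_setP => v; rewrite /degz odd_card.
under eq_bigr => e _ do rewrite inE in_ssum big_distrl /=.
rewrite exchange_big big1 // => j jJ.
transitivity (odd (degz (B j) v)); last by move/even_setP: (ev j jJ).
by rewrite /degz odd_card; apply: eq_bigr => e _; rewrite inE.
Qed.

End Sums.

Lemma card_count (X : finType) (A : {set X}) (s : seq X) :
  uniq s -> {subset A <= s} -> #|A| = count [in A] s.
Proof.
move=> us As; rewrite -size_filter -(card_uniqP _) ?filter_uniq //.
by apply: eq_card => x; rewrite mem_filter; case: (boolP (x \in A)) => // /As ->.
Qed.

(** * Edge counts on four or five vertices *)

Section PairCount.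
Variable T : finType.
Implicit Types (S : {set T}) (X : {set {set T}}).

Lemma ed_in_pairs S X f : two_unif X -> (forall e, e \in X -> e \subset S) -> f \in X ->
  exists u v, [/\ f = ed u v, u != v, u \in S & v \in S].
Proof.
move=> X2 XS fX; have /eqP/cards2P [u [v [uv Ef]]] := (two_unifP _ X2) _ fX.
by have := XS _ fX; rewrite Ef -/(ed u v) ed_sub => /andP [uS vS]; exists u, v.
Qed.

(** Turns an edge count into a sum of booleans, so that claims about dense graphs on few vertices
    become finite checks. *)
Lemma pairs4 X a b c d : uniq [:: a; b; c; d] -> two_unif X ->
  (forall e, e \in X -> e \subset [set z in [:: a; b; c; d]]) ->
  #|X| = (ed a b \in X) + (ed a c \in X) + (ed a d \in X) + (ed b c \in X) + (ed b d \in X)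
       + (ed c d \in X).
Proof.
move=> un X2 XS; have [[ab ac ad] [bc bdry cd]] := uniq4P un.
rewrite (card_count (s := [:: ed a b; ed a c; ed a d; ed b c; ed b d; ed c d])).
- by rewrite /= !addnA addn0.
- by solve_uniq.
move=> f /(ed_in_pairs X2 XS) [u [v [-> uv]]]; rewrite !inE.
by move=> /or4P [] /eqP Eu /or4P [] /eqP Ev; subst u v;
  first [by rewrite eqxx in uv | rewrite !ed_eq !eqxx ?orbT].
Qed.

Lemma pairs5 X a b c d e : uniq [:: a; b; c; d; e] -> two_unif X ->
  (forall f, f \in X -> f \subset [set z in [:: a; b; c; d; e]]) ->
  #|X| = (ed a b \in X) + (ed a c \in X) + (ed a d \in X) + (ed a e \in X) + (ed b c \in X)
   + (ed b d \in X) + (ed b e \in X) + (ed c d \in X) + (ed c e \in X) + (ed d e \in X).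
Proof.
move=> un X2 XS; have [[ab ac ad ae] [[bc bdry be] [cd ce de]]] := uniq5P un.
rewrite (card_count (s := [:: ed a b; ed a c; ed a d; ed a e; ed b c; ed b d; ed b e;
   ed c d; ed c e; ed d e])).
- by rewrite /= !addnA addn0.
- by solve_uniq.
move=> f /(ed_in_pairs X2 XS) [u [v [-> uv]]]; rewrite !inE.
by move=> /or4P [|||/orP[]] /eqP Eu /or4P [|||/orP[]] /eqP Ev; subst u v;
  first [by rewrite eqxx in uv | rewrite !ed_eq !eqxx ?orbT].
Qed.

Lemma set_of4 S u w : #|S| = 4 -> u \in S -> w \in S -> u != w ->
  exists p q, uniq [:: u; w; p; q] /\ S = [set z in [:: u; w; p; q]].
Proof.
move=> S4 uS wS uw; have : #|S :\ u :\ w| = 2.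
  by move: S4; rewrite (cardsD1 u) uS (cardsD1 w (S :\ u)) !inE eq_sym uw wS; case.
move/eqP/cards2P => [p [q [pq ES]]]; exists p, q.
have : p \in S :\ u :\ w by rewrite ES !inE eqxx.
have : q \in S :\ u :\ w by rewrite ES !inE eqxx orbT.
rewrite !inE => /and3P [qw qu qS] /and3P [pw pu pS]; split; first by solve_uniq.
apply/setP => z; move/setP/(_ z): ES; rewrite !inE.
case: (eqVneq z w) => [->|_] /=; first by rewrite wS orbT.
by case: (eqVneq z u) => [->|_] //=; rewrite uS.
Qed.

Lemma set_of5 S u w : #|S| = 5 -> u \in S -> w \in S -> u != w ->
  exists p q r, uniq [:: u; w; p; q; r] /\ S = [set z in [:: u; w; p; q; r]].
Proof.
move=> S5 uS wS uw; have : 0 < #|S :\ u :\ w|.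
  by move: S5; rewrite (cardsD1 u) uS (cardsD1 w (S :\ u)) !inE eq_sym uw wS; lia.
case/card_gt0P => r; rewrite !inE => /and3P [rw ru rS].
have S4 : #|S :\ r| = 4 by move: S5; rewrite (cardsD1 r) rS; case.
have [||p [q [un E]]] := @set_of4 (S :\ r) u w S4 _ _ uw; try by rewrite !inE ?uS ?wS; rewrite_neqs.
exists p, q, r; split.
  have : r \notin [set z in [:: u; w; p; q]] by rewrite -E !inE eqxx.
  rewrite !inE !negb_or => /and4P [h1 h2 h3 h4].
  by have [[? ? ?] [? ? ?]] := uniq4P un; solve_uniq.
apply/setP => z; move/setP/(_ z): E; rewrite !inE.
case: (eqVneq z r) => [->|_] /=; first by rewrite rS !orbT.
by move=> ->; rewrite orbF.
Qed.

End PairCount.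

Section Cluster.
Variables (T I : finType) (E : {set {set T}}) (B : I -> {set {set T}}).
Hypothesis E2 : two_unif E.
Hypothesis noT : no_theta6 E.
Hypothesis noK5 : forall S : {set T}, #|S| = 5 -> #|[set e in E | e \subset S]| <= 9.
Hypothesis BE : forall i, B i \subset E.
Hypothesis Bev : forall i, even_set (B i).
Hypothesis B2 : forall i e, e \in B i -> #|[set j | e \in B j]| = 2.

Variable K : {set I}.
Hypothesis Kn0 : K != set0.
Hypothesis Ktri : forall j, j \in K -> tri B j.
Hypothesis Kclosed : forall i j e, j \in K -> tri B i -> e \in B i -> e \in B j -> i \in K.
Hypothesis Kconn : forall X : {set I}, X \subset K -> X != set0 -> X != K ->
  exists i j e, [/\ i \in X, j \in K, j \notin X, e \in B i & e \in B j].

Ltac ff H := rewrite H; first [reflexivity | exact: cyc3C | exact: cyc3R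
  | exact: esym (cyc3R _ _ _) | by rewrite cyc3R cyc3C | by rewrite cyc3C cyc3R].

(** Two triangles abc and bcd share the saturated edge bc. A face that brings a fifth vertex x lies
    across ab, ac, bd or cd, which are symmetric forms of [grow5A], or across ad, which leads to
    [grow5B]. *)
Lemma cluster_small : small_cluster B K.
Proof.
have [i iK] := set0Pn _ Kn0.
have [u [v [w [un Bi]]]] : exists u v w, uniq [:: u; v; w] /\ B i = cyc3 u v w.
  have : B i != set0 by rewrite -card_gt0 (eqP (Ktri iK)).
  case/set0Pn => e ei; have /eqP/cards2P [u [v [uv Ee]]] := (two_unifP _ E2) _ (BinE BE ei).
  rewrite -/(ed u v) in Ee; subst e.
  by have [w [un Bi]] := triP E2 BE Bev (Ktri iK) ei; exists u, v, w.
pose S3 := [set z in [:: u; v; w]].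
have S3c : #|S3| = 3 by rewrite cardsE; exact/card_uniqP.
have iS : i \in inside B K S3 by apply: (inside_cyc3 iK Bi); rewrite !inE eqxx ?orbT.
case: (eqVneq (inside B K S3) K) => [|nK]; first by exists S3; [left; rewrite S3c|].
have n0 : inside B K S3 != set0 by apply/set0Pn; exists i.
have [i1 [i2 [b [c [d [[i1S k2 i2S] [bc1 f2 unj [bS cS dS]]]]]]]] :=
  grow E2 BE Bev Ktri Kconn n0 nK.
have [k1 s1] := insideP _ _ _ _ i1S.
have [a [una f1']] := triP E2 BE Bev (Ktri k1) bc1.
have aS : a \in S3.
  by have [_ h _] := in_cyc3 f1'; have := s1 _ h; rewrite ed_sub => /andP [].
have f1 : B i1 = cyc3 a b c by rewrite f1' cyc3R cyc3R.
have un4 : uniq [:: a; b; c; d].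
  have ad : a != d by apply: contraNneq dS => <-.
  by have [bc ba ca] := uniq3P una; have [_ bdry cd] := uniq3P unj; solve_uniq.
have [[ab ac ad] [bc bdry cd]] := uniq4P un4.
pose S4 := [set z in [:: a; b; c; d]].
have S4c : #|S4| = 4 by rewrite cardsE; exact/card_uniqP.
have n1 : i1 \in inside B K S4 by apply: (inside_cyc3 k1 f1); rewrite !inE eqxx ?orbT.
have n2 : i2 \in inside B K S4 by apply: (inside_cyc3 k2 f2); rewrite !inE eqxx ?orbT.
case: (eqVneq (inside B K S4) K) => [|{}nK]; first by exists S4; [left; rewrite S4c|].
have {}n0 : inside B K S4 != set0 by apply/set0Pn; exists i1.
have [i0 [j [p [q [x [[i0S jK jS] [pq0 fj unx [pS qS xS]]]]]]]] := grow E2 BE Bev Ktri Kconn n0 nK.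
have [k0 s0] := insideP _ _ _ _ i0S.
have i12 : i1 != i2.
  have [_ cd2 _] := in_cyc3 f2.
  by apply/eqP => E12; move: cd2; rewrite -E12 f1 /cyc3; solve_uniq.
have [ab1 bc1' ac1] := in_cyc3 f1; have [bc2 cd2 bd2] := in_cyc3 f2.
have jbc : ed b c \in B j -> False.
  by move=> h; case: (covered_twice B2 i12 bc1 bc2 h) => Ej; subst j; rewrite ?n1 ?n2 in jS.
have [pq qx px] := in_cyc3 fj.
have xS' := xS; move: xS'; rewrite !inE !negb_or => /and4P [xa xb xc xd].
have [npq _ _] := uniq3P unx.
have gA := grow5A E2 noT BE Bev B2 Ktri Kconn.
have gB := grow5B E2 noT BE Bev B2 Ktri Kconn.
(* The face inside that contains ad has b or c as its third vertex, so a, b, c, d carry three faces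
   of a K4; exchanging b and c reduces to the first case. *)
have jad : (p = a /\ q = d) \/ (p = d /\ q = a) -> small_cluster B K.
  move=> h; have [adp fjx] : ed a d \in B i0 /\ B j = cyc3 a d x.
    by case: h => -[? ?]; subst p q; split=> //; rewrite 1?edC // fj cyc3C.
  have [y [uny f0]] := triP E2 BE Bev (Ktri k0) adp.
  have [_ /s0] := in_cyc3 f0; rewrite ed_sub => /andP [_ yS] _.
  have [_ ay dy] := uniq3P uny.
  move: yS; rewrite !inE; rewrite_neqs => /=; rewrite orbF.
  case/orP => /eqP ?; subst y.
    by apply: (gB a b c d x i0 i1 i2 j) => //; solve [by solve_uniq | ff f0].
  by apply: (gB a c b d x i0 i1 i2 j) => //; solve [by solve_uniq | ff f0 | ff f1 | ff f2].
move: pS qS; rewrite !inE => /or4P [] /eqP ? /or4P [] /eqP ?; subst p q;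
 try (by rewrite eqxx in npq); try (by apply: jad; auto);
 try (by case: jbc; first [exact: pq| rewrite edC]).
- by apply: (gA a b c d x i1 i2 j) => //; solve [by solve_uniq].
- by apply: (gA a c b d x i1 i2 j) => //; solve [by solve_uniq | ff f1 | ff f2].
- by apply: (gA a b c d x i1 i2 j) => //; solve [by solve_uniq | ff fj].
- by apply: (gA d b c a x i2 i1 j) => //; solve [by solve_uniq | ff f2 | ff f1 | ff fj].
- by apply: (gA a c b d x i1 i2 j) => //; solve [by solve_uniq | ff f1 | ff f2 | ff fj].
- by apply: (gA d c b a x i2 i1 j) => //; solve [by solve_uniq | ff f2 | ff f1 | ff fj].
- by apply: (gA d b c a x i2 i1 j) => //; solve [by solve_uniq | ff f2 | ff f1 ].
- by apply: (gA d c b a x i2 i1 j) => //; solve [by solve_uniq | ff f2 | ff f1 ].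
Qed.

End Cluster.

(** * Short paths in dense graphs *)

Lemma bool_path3 (uw up uq ur wp wq wr pq pr qr : bool) :
  8 <= uw + up + uq + ur + wp + wq + wr + pq + pr + qr ->
  [|| [&& up, pq & wq], [&& uq, pq & wp], [&& up, pr & wr], [&& ur, pr & wp],
      [&& uq, qr & wr] | [&& ur, qr & wq]].
Proof. by case: uw up uq ur wp wq wr pq pr qr => [] [] [] [] [] [] [] [] [] []. Qed.

(** The booleans are the edges on five vertices u, w, p, q, r. The last conjunct is a chord from the
    first vertex of the path, needed where the ends u and w may be non-adjacent. *)
Lemma bool_path3c (uw up uq ur wp wq wr pq pr qr : bool) :
  9 <= uw + up + uq + ur + wp + wq + wr + pq + pr + qr ->
  [|| [&& up, pq, wq & uq], [&& uq, pq, wp & up], [&& up, pr, wr & ur], [&& ur, pr, wp & up],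
      [&& uq, qr, wr & ur] | [&& ur, qr, wq & uq]].
Proof. by case: uw up uq ur wp wq wr pq pr qr => [] [] [] [] [] [] [] [] [] []. Qed.

Lemma bool_path2 (uw up uq ur wp wq wr pq pr qr : bool) :
  9 <= uw + up + uq + ur + wp + wq + wr + pq + pr + qr ->
  [|| up && wp, uq && wq | ur && wr].
Proof. by case: uw up uq ur wp wq wr pq pr qr => [] [] [] [] [] [] [] [] [] []. Qed.

Lemma bool_path4 (uw up uq ur wp wq wr pq pr qr : bool) :
  9 <= uw + up + uq + ur + wp + wq + wr + pq + pr + qr ->
  [|| [&& up, pq, qr, wr & uq], [&& up, pr, qr, wq & ur], [&& uq, pq, pr, wr & up],
      [&& uq, qr, pr, wp & ur], [&& ur, pr, pq, wq & up] | [&& ur, qr, pq, wp & uq]].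
Proof. by case: uw up uq ur wp wq wr pq pr qr => [] [] [] [] [] [] [] [] [] []. Qed.

Section Dense.
Variables (T : finType).
Implicit Types (S : {set T}) (X : {set {set T}}).

Lemma path3 S X u w : two_unif X -> (forall e, e \in X -> e \subset S) ->
  (#|S| = 4 /\ #|X| = 6) \/ (#|S| = 5 /\ 8 <= #|X|) -> u \in S -> w \in S -> u != w ->
  exists p q, [/\ p \in S, q \in S, uniq [:: u; p; q; w] &
    [/\ ed u p \in X, ed p q \in X & ed q w \in X]].
Proof.
move=> X2 XS h uS wS uw; case: h => [[S4 X6]|[S5 X8]].
  have [p [q [un ES]]] := set_of4 S4 uS wS uw.
  have [[_ up uq] [wp wq pq]] := uniq4P un.
  rewrite ES in XS; have := pairs4 un X2 XS; rewrite X6 => EX.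
  have : [&& ed u p \in X, ed p q \in X & ed w q \in X].
    by move: EX; do 6 (case: (_ \in X)).
  case/and3P => Xup Xpq Xwq.
  exists p, q; rewrite ES !inE !eqxx ?orbT; split=> //; first by solve_uniq.
  by rewrite (edC q w).
have [p [q [r [un ES]]]] := set_of5 S5 uS wS uw.
have [[_ up uq ur] [[wp wq wr] [pq pr qr]]] := uniq5P un.
rewrite ES in XS; have EX := pairs5 un X2 XS; rewrite EX in X8.
have := bool_path3 X8.
case/or4P => [|||/or3P[]] /and3P [a b c];
  [exists p, q|exists q, p|exists p, r|exists r, p|exists q, r|exists r, q];
  rewrite ES !inE !eqxx ?orbT; split=> //; try (by solve_uniq); split=> //;
  by rewrite // edC.
Qed.

Lemma path3c S X u w : two_unif X -> (forall e, e \in X -> e \subset S) ->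
  #|S| = 5 /\ 9 <= #|X| -> u \in S -> w \in S -> u != w ->
  exists p q, [/\ p \in S, q \in S, uniq [:: u; p; q; w] &
    [/\ ed u p \in X, ed p q \in X, ed q w \in X & ed u q \in X]].
Proof.
move=> X2 XS [S5 X8] uS wS uw.
have [p [q [r [un ES]]]] := set_of5 S5 uS wS uw.
have [[_ up uq ur] [[wp wq wr] [pq pr qr]]] := uniq5P un.
rewrite ES in XS; have EX := pairs5 un X2 XS; rewrite EX in X8.
have := bool_path3c X8.
case/or4P => [|||/or3P[]] /and4P [a b c d];
  [exists p, q|exists q, p|exists p, r|exists r, p|exists q, r|exists r, q];
  rewrite ES !inE !eqxx ?orbT; split=> //; try (by solve_uniq); split=> //;
  by rewrite // edC.
Qed.

Lemma path2 S X u w : two_unif X -> (forall e, e \in X -> e \subset S) ->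
  #|S| = 5 /\ 9 <= #|X| -> u \in S -> w \in S -> u != w ->
  exists p, [/\ p \in S, uniq [:: u; p; w], ed u p \in X & ed p w \in X].
Proof.
move=> X2 XS [S5 X8] uS wS uw.
have [p [q [r [un ES]]]] := set_of5 S5 uS wS uw.
have [[_ up uq ur] [[wp wq wr] [pq pr qr]]] := uniq5P un.
rewrite ES in XS; have EX := pairs5 un X2 XS; rewrite EX in X8.
have := bool_path2 X8.
case/or3P => /andP [a b]; [exists p|exists q|exists r];
  rewrite ES !inE !eqxx ?orbT; split=> //; try (by solve_uniq); by rewrite // edC.
Qed.

Lemma path4 S X u w : two_unif X -> (forall e, e \in X -> e \subset S) ->
  #|S| = 5 /\ 9 <= #|X| -> u \in S -> w \in S -> u != w ->
  exists p q r, [/\ p \in S, q \in S, r \in S, uniq [:: u; p; q; r; w] &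
    [/\ ed u p \in X, ed p q \in X, ed q r \in X & ed r w \in X /\ ed u q \in X]].
Proof.
move=> X2 XS [S5 X8] uS wS uw.
have [p [q [r [un ES]]]] := set_of5 S5 uS wS uw.
have [[_ up uq ur] [[wp wq wr] [pq pr qr]]] := uniq5P un.
rewrite ES in XS; have EX := pairs5 un X2 XS; rewrite EX in X8.
have := bool_path4 X8.
case/or4P => [|||/or3P[]] /and5P [a b c d f];
  [exists p, q, r|exists p, r, q|exists q, p, r|exists q, r, p|exists r, p, q|exists r, q, p];
  rewrite ES !inE !eqxx ?orbT; split=> //; try (by solve_uniq); split=> //;
  try (by rewrite // edC); by split=> //; rewrite // edC.
Qed.

(** A Hamiltonian path of S from u to w closes through y to a 6-cycle. Nine edges are enough to find
    such a path together with a chord at u. *)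
Lemma two_adj S E u w y : two_unif E -> no_theta6 E ->
  #|S| = 5 -> 9 <= #|[set e in E | e \subset S]| ->
  u \in S -> w \in S -> u != w -> y \notin S -> ed u y \in E -> ed y w \in E -> False.
Proof.
move=> E2 noT S5 E9 uS wS uw yS uy yw.
have s : [set e in E | e \subset S] \subset E by apply/subsetP => e; rewrite inE => /andP [].
have [|p [q [r [pS qS rS un [up pq qr [rw uq]]]]]] :=
  path4 (two_unifS s E2) _ (conj S5 E9) uS wS uw.
  by move=> e; rewrite inE => /andP [].
move: up pq qr rw uq => /(subsetP s) up /(subsetP s) pq /(subsetP s) qr
  /(subsetP s) rw /(subsetP s) uq.
have notin_neq z : z \in S -> y != z by apply: contraTneq => <-.
have un6 : uniq [:: u; p; q; r; w; y].
  have [[? ? ? ?] [[? ? ?] [? ? ?]]] := uniq5P un.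
  have := notin_neq _ uS; have := notin_neq _ pS; have := notin_neq _ qS;
  have := notin_neq _ rS; have := notin_neq _ wS.
  by move=> ? ? ? ? ?; solve_uniq.
have [] := noT _ _ _ _ _ _ un6 up pq qr rw; rewrite 1?edC //.
by rewrite edC uq.
Qed.

End Dense.

(** The symmetric difference of distinct even sets is even and nonempty, so it has at least three
    edges. Hence distinct small faces share few edges. *)
Lemma even_symd (T : finType) (z c : {set {set T}}) :
  two_unif z -> even_set z -> two_unif c -> even_set c ->
  z != c -> 3 + 2 * #|z :&: c| <= #|z| + #|c|.
Proof.
move=> z2 ez c2 ec zc; pose b (i : bool) := if i then z else c.
have Es : ssum b setT = (z :|: c) :\: (z :&: c).
  apply/setP => e; rewrite in_ssum big_mkcond -big_enum /= (perm_big [:: true; false]).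
    by rewrite !big_cons big_nil !inE /=; case: (_ \in z); case: (_ \in c).
  by apply: uniq_perm; rewrite ?enum_uniq // => -[]; rewrite mem_enum.
have ne : ssum b setT != set0.
  apply: contra zc; rewrite Es setD_eq0 => h; rewrite eqEsubset.
  apply/andP; split; apply/subsetP => e ez'; have := subsetP h e; rewrite !inE ez' ?orbT //=.
    by move/(_ isT).
  by move/(_ isT); rewrite andbT.
have : 3 <= #|ssum b setT|.
  apply: even_card_ge3 ne; last by apply: even_ssum => -[].
  by apply/two_unifP => e; rewrite Es !inE => /andP [_ /orP [/(two_unifP _ z2)|/(two_unifP _ c2)]].
rewrite Es cardsDS; last by apply/subsetP => e; rewrite !inE => /andP [->].
rewrite cardsU; have := subset_leq_card (subsetIl z c); have := subset_leq_card (subsetIr z c); lia.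
Qed.

(** * Faces around a class of triangles *)

Section Local.
Variables (T I : finType) (E : {set {set T}}) (B : I -> {set {set T}}).
Hypothesis E2 : two_unif E.
Hypothesis noT : no_theta6 E.
Hypothesis noK5 : forall S : {set T}, #|S| = 5 -> #|[set e in E | e \subset S]| <= 9.
Hypothesis BE : forall i, B i \subset E.
Hypothesis Bev : forall i, even_set (B i).
Hypothesis B2 : forall i e, e \in B i -> #|[set j | e \in B j]| = 2.

Variable K : {set I}.
Hypothesis Ktri : forall j, j \in K -> tri B j.
Hypothesis Kclosed : forall i j e, j \in K -> tri B i -> e \in B i -> e \in B j -> i \in K.

(** For a face that is not a triangle, these are the edges across which it sends charge. *)
Definition tau F := #|[set e in B F | [exists j, tri B j && (e \in B j)]]|.

Let EK := cluster_edges B K.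
Let dK := ssum B K.

Lemma EK_two_unif : two_unif EK.
Proof. by apply: two_unifS E2; apply/bigcupsP => j _; apply: BE. Qed.

Lemma EK_subS (S : {set T}) : inside B K S = K -> forall e, e \in EK -> e \subset S.
Proof. by move=> iS e /bigcupP [j]; rewrite -iS => /insideP [_ h] /h. Qed.

Lemma dK_EK e : e \in dK -> e \in EK.
Proof.
rewrite inE => o; have : 0 < #|[set j in K | e \in B j]| by case: #|_| o.
by case/card_gt0P => j; rewrite inE => /andP [jK ej]; apply: mem_cluster_edges ej.
Qed.

Lemma cover_EK e : e \in EK -> #|[set j in K | e \in B j]| = 2 - (e \in dK).
Proof.
move=> /bigcupP [j jK ej].
have le : #|[set j in K | e \in B j]| <= 2.
  by rewrite -(B2 ej); apply/subset_leq_card/subsetP => k; rewrite !inE => /andP [].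
have : 0 < #|[set j in K | e \in B j]| by apply/card_gt0P; exists j; rewrite inE jK.
rewrite /dK inE; case: #|_| le => [|[|[|]]] //.
Qed.

(** Double counting: an edge of the class lies on two of its triangles, or on one if it belongs to
    the boundary. *)
Lemma count_dK : 3 * #|K| + #|dK| = 2 * #|EK|.
Proof.
have -> : 3 * #|K| = \sum_(j in K) \sum_e (e \in B j : nat).
  rewrite mulnC -sum_nat_const; apply: eq_bigr => j /Ktri /eqP <-.
  by rewrite -sum1_card big_mkcond; apply: eq_bigr => e _; case: (_ \in _).
rewrite exchange_big /= mulnC -sum_nat_const -sum1_card.
rewrite [X in _ + X]big_mkcond [RHS]big_mkcond -big_split.
apply: eq_bigr => e _; rewrite /=.
have -> : \sum_(j in K) (e \in B j) = #|[set j in K | e \in B j]|.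
  rewrite -sum1_card big_mkcond [RHS]big_mkcond; apply: eq_bigr => j _.
  by rewrite inE; case: (j \in K); case: (_ \in _).
case: (boolP (e \in EK)) => eK; first by rewrite cover_EK //; case: (e \in dK).
rewrite (negPf (contra (@dK_EK e) eK)) addn0; apply/eqP; rewrite cards_eq0 -subset0.
by apply/subsetP => j; rewrite inE => /andP [jK ej]; case/negP: eK; apply: mem_cluster_edges ej.
Qed.

Lemma dK_even : even_set dK. Proof. by apply: even_ssum => j _; apply: Bev. Qed.

Lemma dK_two_unif : two_unif dK.
Proof. by apply: two_unifS EK_two_unif; apply/subsetP => e /dK_EK. Qed.

(** One of the two faces at e is F, so only one can belong to the class. *)
Lemma outer F e : F \notin K -> e \in B F -> (e \in dK) = (e \in EK).
Proof.
move=> FK eF; apply/idP/idP => [/dK_EK //|eK].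
have := cover_EK eK; case: (e \in dK) => //= c2.
have : #|F |: [set j in K | e \in B j]| <= #|[set j | e \in B j]|.
  by apply/subset_leq_card/subsetP => j; rewrite !inE => /orP [/eqP ->|/andP []].
by rewrite (B2 eF) cardsU1 c2 inE (negPf FK).
Qed.

Lemma dK_outer e : e \in dK -> exists F, [/\ F \notin K, ~~ tri B F & e \in B F].
Proof.
move=> ed; have := cover_EK (dK_EK ed); rewrite ed /= => /eqP/cards1P [j Ej].
have : j \in [set j in K | e \in B j] by rewrite Ej inE.
rewrite inE => /andP [jK ej]; have [F Fj eF] := other_face B2 ej.
have FK : F \notin K.
  apply: contra Fj => FK; have : F \in [set j in K | e \in B j] by rewrite inE FK.
  by rewrite Ej inE.
by exists F; split=> //; apply: contra FK => tF; apply: Kclosed jK tF eF ej.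
Qed.

Variable S : {set T}.
Hypothesis KS : inside B K S = K.

Let ES := [set e in E | e \subset S].

Lemma EK_ES : EK \subset ES.
Proof. by apply/subsetP => e eK; rewrite inE (cluster_edges_sub BE eK) (EK_subS KS eK). Qed.

(* The class is a K4, or has five vertices and at least eight edges. *)
Definition shapeA := (#|S| = 4 /\ #|EK| = 6) \/ (#|S| = 5 /\ 8 <= #|EK|).

(** A K4 leaves no pair of its vertices free. So a further edge within S occurs only on five
    vertices, where it is at least the ninth; a second one would be the tenth. *)
Lemma extra1 e : shapeA -> e \in E -> e \subset S -> e \notin EK -> #|S| = 5 /\ 9 <= #|ES|.
Proof.
move=> h eE eS eK.
have c : #|EK|.+1 <= #|ES|.
  have <- : #|e |: EK| = #|EK|.+1 by rewrite cardsU1 eK.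
  by apply: subset_leq_card; rewrite subUset sub1set inE eE eS EK_ES.
case: h => [[S4 K6]|[-> K8]]; last by split=> //; lia.
exfalso; have /set0Pn [u uS] : S != set0 by rewrite -card_gt0 S4.
have : 0 < #|S :\ u| by move: S4; rewrite (cardsD1 u) uS; lia.
case/card_gt0P => w; rewrite !inE => /andP [wu wS].
rewrite eq_sym in wu.
have [p [q [un ES']]] := set_of4 S4 uS wS wu.
have ES2 : two_unif ES by apply: two_unifS E2; apply/subsetP => f; rewrite inE => /andP [].
have sub f : f \in ES -> f \subset [set z in [:: u; w; p; q]].
  by rewrite -ES' inE => /andP [].
move: c; rewrite K6 (pairs4 un ES2 sub); by do 6 (case: (_ \in _)).
Qed.

Lemma extra2 e f : shapeA -> e != f -> e \in E -> e \subset S -> e \notin EK ->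
  f \in E -> f \subset S -> f \notin EK -> False.
Proof.
move=> h ef eE eS eK fE fS fK.
have [S5 _] := extra1 h eE eS eK.
have c : #|EK| + 2 <= #|ES|.
  have <- : #|e |: (f |: EK)| = #|EK| + 2 by rewrite !cardsU1 !inE negb_or ef eK fK /=; lia.
  by apply: subset_leq_card; rewrite !subUset !sub1set !inE eE eS fE fS EK_ES.
have := noK5 S5; rewrite -/ES; case: h => [[S4 _]|[_ K8]]; [by rewrite S4 in S5|lia].
Qed.

Lemma two_neighbours u w y : #|S| = 5 /\ 9 <= #|ES| -> u \in S -> w \in S -> u != w -> y \notin S ->
  ed u y \in E -> ed y w \in E -> False.
Proof. by case=> S5 E9; apply: two_adj. Qed.

Lemma notin_neq (y z : T) : y \notin S -> z \in S -> y != z.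
Proof. by move=> yS; apply: contraTneq => <-. Qed.

(** The paths u p q v inside S and v y x u outside close to a 6-cycle in which uv joins opposite
    vertices. *)
Lemma outside2 u v y x : shapeA -> u \in S -> v \in S -> u != v -> y \notin S -> x \notin S ->
  x != y -> ed u v \in E -> ed v y \in E -> ed y x \in E -> ed x u \in E -> False.
Proof.
move=> h uS vS uv yS xS xy Euv Evy Eyx Exu.
have [p [q [pS qS un [up pq qv]]]] := path3 EK_two_unif (EK_subS KS) h uS vS uv.
have [[? ? ?] [? ? ?]] := uniq4P un.
have := notin_neq xS uS; have := notin_neq xS vS; have := notin_neq xS pS; have := notin_neq xS qS.
have := notin_neq yS uS; have := notin_neq yS vS; have := notin_neq yS pS; have := notin_neq yS qS.
move=> ? ? ? ? ? ? ? ?.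
have un6 : uniq [:: u; p; q; v; y; x] by solve_uniq.
have [_] := noT un6 (cluster_edges_sub BE up) (cluster_edges_sub BE pq) (cluster_edges_sub BE qv)
  Evy Eyx Exu.
by rewrite Euv.
Qed.

(* A 4-face that meets the class in two consecutive edges sends its whole surplus
   into it, because no triangular face lies across its two other edges. *)
Lemma not_tri F s s' y j : shapeA -> F \notin K -> s \in S -> s' \in S -> s != s' -> y \notin S ->
  ed s y \in B F -> ed y s' \in B F -> tri B j -> ed s y \in B j -> False.
Proof.
move=> h FK sS s'S ss' yS sy ys' tj syj.
have jK : j \notin K.
  by apply/negP => jK; have := EK_subS KS (mem_cluster_edges jK syj);
    rewrite ed_sub (negPf yS) andbF.
have [z [un Bj]] := triP E2 BE Bev tj syj.
have [nsy nsz nyz] := uniq3P un.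
have [_ yz sz] := in_cyc3 Bj.
have [Esy Eys'] := (BinE BE sy, BinE BE ys').
have [zS|zS] := boolP (z \in S).
  have szK : ed s z \notin EK.
    by apply: contra jK => /bigcupP [k kK ek]; apply: Kclosed kK tj sz ek.
  have szS : ed s z \subset S by rewrite ed_sub sS.
  exact: (two_neighbours (extra1 h (BinE BE sz) szS szK) sS s'S ss' yS).
(* With z outside S, the 6-cycle y z s p q s' has the chord sy. *)
have [p [q [pS qS un4 [sp pq qs']]]] := path3 EK_two_unif (EK_subS KS) h sS s'S ss'.
have [[? ? ?] [? ? ?]] := uniq4P un4.
have := notin_neq zS sS; have := notin_neq zS s'S; have := notin_neq zS pS; have := notin_neq zS qS.
have := notin_neq yS sS; have := notin_neq yS s'S; have := notin_neq yS pS; have := notin_neq yS qS.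
move=> ? ? ? ? ? ? ? ?.
have un6 : uniq [:: y; z; s; p; q; s'] by solve_uniq.
have Ezs : ed z s \in E by rewrite edC (BinE BE sz).
have Es'y : ed s' y \in E by rewrite edC.
have [] := noT un6 (BinE BE yz) Ezs (cluster_edges_sub BE sp) (cluster_edges_sub BE pq)
  (cluster_edges_sub BE qs') Es'y.
by rewrite edC Esy.
Qed.

Lemma card_dKF_lt F : F \notin K -> B F != dK -> #|B F| = 4 -> #|dK| <= 4 -> #|dK :&: B F| <= 2.
Proof.
move=> FK ne c4 d4; rewrite setIC.
have := even_symd (B2u E2 BE F) (Bev F) dK_two_unif dK_even ne; rewrite c4; lia.
Qed.

Lemma tau_good F u v y x : shapeA -> F \notin K -> B F = cyc4 u v y x -> uniq [:: u; v; y; x] ->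
  u \in S -> v \in S -> y \in S -> x \notin S -> tau F <= 2.
Proof.
move=> h FK BF un uS vS yS xS.
have [[uv uy ux] [vy vx yx]] := uniq4P un.
have [e1 e2] : ed y x \in B F /\ ed x u \in B F by rewrite BF /cyc4 !inE !eqxx !orbT.
have <- : #|[set ed u v; ed v y]| = 2 by rewrite cards2; solve_uniq.
apply/subset_leq_card/subsetP => e; rewrite inE => /andP [eF /existsP [j /andP [tj ej]]].
rewrite !inE; move: eF; rewrite BF /cyc4 !inE.
case/or4P => [->//|->|/eqP ?|/eqP ?]; rewrite ?orbT //; subst e.
  by exfalso; apply: (not_tri h FK yS uS _ xS e1 e2 tj ej); rewrite eq_sym.
exfalso; rewrite edC in ej; rewrite edC in e1; rewrite edC in e2.
by apply: (not_tri h FK uS yS _ xS e2 e1 tj ej).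
Qed.

(** A 4-face other than the boundary shares at most two edges with it. Two opposite common edges
    would leave two further edges within S, and so would two consecutive ones if the fourth vertex
    lay in S; hence the fourth vertex is outside and [tau_good] applies. *)
Lemma face4 F e : shapeA -> #|dK| <= 4 -> F \notin K -> #|B F| = 4 -> e \in dK -> e \in B F ->
  B F = dK \/ tau F <= 2 /\ 2 <= #|dK :&: B F|.
Proof.
move=> h d4 FK c4 eK eF.
have /eqP/cards2P [u [v [uv Ee]]] := (two_unifP _ E2) _ (BinE BE eF).
rewrite -/(ed u v) in Ee; subst e.
case: (eqVneq (B F) dK) => [|ne]; [by left|right].
have c2 := card_dKF_lt FK ne c4 d4.
have [y [x [un BF]]] := even4P (B2u E2 BE F) (Bev F) c4 eF.
have [[_ uy ux] [vy vx yx]] := uniq4P un.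
have [uS vS] : u \in S /\ v \in S.
  by have := EK_subS KS (dK_EK eK); rewrite ed_sub => /andP.
have [f1 f2 f3] : [/\ ed v y \in B F, ed y x \in B F & ed x u \in B F].
  by rewrite BF /cyc4 !inE !eqxx !orbT.
have cnt : #|dK :&: B F| = 1 + (ed v y \in EK) + (ed y x \in EK) + (ed x u \in EK).
  rewrite (card_count (s := [:: ed u v; ed v y; ed y x; ed x u])).
  - rewrite /= !in_setI eK eF f1 f2 f3 !andbT.
    by rewrite !(outer FK) // !addnA addn0.
  - by solve_uniq.
  by move=> f; rewrite in_setI BF /cyc4 !inE => /andP [_].
have g1 := BinE BE f1; have g2 := BinE BE f2; have g3 := BinE BE f3.
have Sof a b : ed a b \in EK -> a \in S /\ b \in S.
  by move=> /(EK_subS KS); rewrite ed_sub => /andP.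
rewrite cnt in c2 *.
case p1: (ed v y \in EK) c2 => /=.
  have [_ yS] := Sof _ _ p1.
  case p2: (ed y x \in EK); case p3: (ed x u \in EK) => //= _.
  have xS : x \notin S.
    apply/negP => xS; apply: (@extra2 (ed y x) (ed x u)) => //;
      rewrite ?ed_sub ?xS ?yS ?uS ?p2 ?p3 //.
    by solve_uniq.
  by split=> //; apply: tau_good BF un _ _ _ xS.
case p3: (ed x u \in EK) => /=.
  have [xS _] := Sof _ _ p3.
  case p2: (ed y x \in EK) => //= _.
  have yS : y \notin S.
    apply/negP => yS; apply: (@extra2 (ed v y) (ed y x)) => //;
      rewrite ?ed_sub ?xS ?yS ?vS ?p1 ?p2 //.
    by solve_uniq.
  split=> //; apply: (@tau_good F x u v y) => //; last by solve_uniq.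
  rewrite BF; apply/setP => f; rewrite /cyc4 !inE.
  by case: (f == _); case: (f == _); case: (f == _); case: (f == _).
case p2: (ed y x \in EK) => /= _.
  have [yS xS] := Sof _ _ p2.
  exfalso; apply: (@extra2 (ed v y) (ed x u)) => //; rewrite ?ed_sub ?xS ?yS ?vS ?uS ?p1 ?p3 //.
  by solve_uniq.
(* Here uv is the only common edge. If x and y are in S, there are two extra edges; if just one is,
   an extra edge makes nine and the outside vertex has two neighbours in S; if none is, [outside2]
   applies. *)
exfalso; have [xS|xS] := boolP (x \in S); have [yS|yS] := boolP (y \in S).
- apply: (@extra2 (ed v y) (ed x u)) => //; rewrite ?ed_sub ?xS ?yS ?vS ?uS ?p1 ?p3 //.
  by solve_uniq.
- apply: (@two_neighbours v x y) => //; apply: (@extra1 (ed x u)) => //.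
    by rewrite ed_sub xS uS.
  by rewrite p3.
- apply: (@two_neighbours u y x) => //; try (by rewrite edC).
  by apply: (@extra1 (ed v y)) => //; rewrite ?ed_sub ?vS ?yS ?p1.
- by apply: (@outside2 u v y x) => //; rewrite 1?eq_sym // (BinE BE eF).
Qed.

End Local.

(** * The inequality for one class *)

Section Local2.
Variables (T I : finType) (E : {set {set T}}) (B : I -> {set {set T}}).
Hypothesis E2 : two_unif E.
Hypothesis noT : no_theta6 E.
Hypothesis noK5 : forall S : {set T}, #|S| = 5 -> #|[set e in E | e \subset S]| <= 9.
Hypothesis BE : forall i, B i \subset E.
Hypothesis Bev : forall i, even_set (B i).
Hypothesis B2 : forall i e, e \in B i -> #|[set j | e \in B j]| = 2.

Section OneCluster.
Variable K : {set I}.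
Hypothesis Kn0 : K != set0.
Hypothesis Ktri : forall j, j \in K -> tri B j.
Hypothesis Kclosed : forall i j e, j \in K -> tri B i -> e \in B i -> e \in B j -> i \in K.
Hypothesis Kconn : forall X : {set I}, X \subset K -> X != set0 -> X != K ->
  exists i j e, [/\ i \in X, j \in K, j \notin X, e \in B i & e \in B j].

Let EK := cluster_edges B K.
Let dK := ssum B K.

Section Dense9.
Variable S : {set T}.
Hypothesis KS : inside B K S = K.
Hypothesis S5 : #|S| = 5.
Hypothesis K9 : 9 <= #|EK|.
Hypothesis d3 : #|dK| = 3.

Let ES := [set e in E | e \subset S].

(** Nine edges are the maximum on five vertices, so the class leaves no room for another edge within
    S. *)
Lemma ES_EK : ES = EK.
Proof.
apply/eqP; rewrite eq_sym eqEcard (EK_ES BE KS) /=.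
exact: leq_trans (noK5 S5) K9.
Qed.

Lemma in_EK9 u v : u \in S -> v \in S -> ed u v \in E -> ed u v \in EK.
Proof. by move=> uS vS uv; rewrite -ES_EK inE uv ed_sub uS. Qed.

Lemma ES9 : #|S| = 5 /\ 9 <= #|ES|. Proof. by rewrite ES_EK. Qed.

Lemma no_adj2 u w y : u \in S -> w \in S -> u != w -> y \notin S ->
  ed u y \in E -> ed y w \in E -> False.
Proof. exact: two_neighbours ES9. Qed.

(** The counterpart of [outside2] when u and v need not be adjacent: the chord starts at u and stays
    within the class. *)
Lemma outside2c u v y x : u \in S -> v \in S -> u != v -> y \notin S -> x \notin S ->
  x != y -> ed v y \in E -> ed y x \in E -> ed x u \in E -> False.
Proof.
move=> uS vS uv yS xS xy Evy Eyx Exu.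
have EKu := EK_two_unif E2 BE K.
have [p [q [pS qS un [up pq qv uq]]]] := path3c EKu (EK_subS KS) (conj S5 K9) uS vS uv.
have [[? ? ?] [? ? ?]] := uniq4P un.
have := notin_neq xS uS; have := notin_neq xS vS; have := notin_neq xS pS; have := notin_neq xS qS.
have := notin_neq yS uS; have := notin_neq yS vS; have := notin_neq yS pS; have := notin_neq yS qS.
move=> ? ? ? ? ? ? ? ?.
have un6 : uniq [:: u; p; q; v; y; x] by solve_uniq.
have [] := noT un6 (cluster_edges_sub BE up) (cluster_edges_sub BE pq) (cluster_edges_sub BE qv)
  Evy Eyx Exu.
by rewrite (cluster_edges_sub BE uq).
Qed.

(** A detour u p v within the class replaces uv in the 5-cycle and makes it a 6-cycle with chord
    uv. *)
Lemma outside3c u v w x y : u \in S -> v \in S -> uniq [:: u; v; w; x; y] ->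
  w \notin S -> x \notin S -> y \notin S ->
  ed u v \in E -> ed v w \in E -> ed w x \in E -> ed x y \in E -> ed y u \in E -> False.
Proof.
move=> uS vS un wS xS yS Euv Evw Ewx Exy Eyu.
have [[uv ? ? ?] [[? ? ?] [? ? ?]]] := uniq5P un.
have EKu := EK_two_unif E2 BE K.
have [p [pS unp up pv]] := path2 EKu (EK_subS KS) (conj S5 K9) uS vS uv.
have [? ? ?] := uniq3P unp.
have := notin_neq wS pS; have := notin_neq xS pS; have := notin_neq yS pS; move=> ? ? ?.
have un6 : uniq [:: u; p; v; w; x; y] by solve_uniq.
have [] := noT un6 (cluster_edges_sub BE up) (cluster_edges_sub BE pv) Evw Ewx Exy Eyu.
by rewrite Euv.
Qed.

(** K5 minus an edge lacks 15 and has three boundary edges, so each must bring 5, more than a 4- or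
    5-face gives. Such a face cannot have all vertices in S, since it would be contained in the
    three boundary edges; with a vertex outside it yields a 6-cycle with a chord. *)
Lemma face_ge6 F e : F \notin K -> ~~ tri B F -> e \in dK -> e \in B F -> 6 <= #|B F|.
Proof.
move=> FK nt eK eF.
have EKu := EK_two_unif E2 BE K.
have B2F := B2u E2 BE F.
have ge3 : 3 <= #|B F|.
  by apply: even_card_ge3 => //; apply/set0Pn; exists e.
have ne : B F != dK by apply: contraNneq nt; rewrite /tri => ->; rewrite d3.
have := even_symd B2F (Bev F) (dK_two_unif E2 BE K) (dK_even Bev K) ne.
rewrite -/dK d3 => cap.
have /eqP/cards2P [u [v [uv Ee]]] := (two_unifP _ E2) _ (BinE BE eF).
rewrite -/(ed u v) in Ee; subst e.
have [uS vS] : u \in S /\ v \in S.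
  by have := EK_subS KS (dK_EK eK); rewrite ed_sub => /andP.
have Euv := BinE BE eF.
have inK a b : a \in S -> b \in S -> ed a b \in B F -> ed a b \in dK.
  by move=> aS bS ab; rewrite (outer B2 FK ab); apply: in_EK9 => //; apply: BinE ab.
rewrite ltnNge; apply/negP => le5.
have /orP [/eqP c4|/eqP c5] : (#|B F| == 4) || (#|B F| == 5).
- by move: ge3 le5 nt; rewrite /tri; case: #|B F| => [|[|[|[|[|[|]]]]]].
- have [y [x [un BF]]] := even4P B2F (Bev F) c4 eF.
  have [[_ uy ux] [vy vx yx]] := uniq4P un.
  have [f1 f2 f3] : [/\ ed v y \in B F, ed y x \in B F & ed x u \in B F].
    by rewrite BF /cyc4 !inE !eqxx !orbT.
  have [g1 g2 g3] := And3 (BinE BE f1) (BinE BE f2) (BinE BE f3).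
  have [xS|xS] := boolP (x \in S); have [yS|yS] := boolP (y \in S).
  + have : B F \subset dK.
      apply/subsetP => f fF; have : f \in cyc4 u v y x by rewrite -BF.
      by rewrite !in_setU !in_set1 => /or4P [] /eqP ->; apply: inK.
    by move/subset_leq_card; rewrite c4 d3.
  + by apply: (@no_adj2 v x y) => //.
  + by apply: (@no_adj2 u y x) => //; rewrite edC.
  + by apply: (@outside2c u v y x) => //; rewrite eq_sym.
have [w [x [y [un BF]]]] := even5P B2F (Bev F) c5 eF.
have [[_ uw ux uy] [[vw vx vy] [wx wy xy]]] := uniq5P un.
have [f1 f2 f3 f4] : [/\ ed v w \in B F, ed w x \in B F, ed x y \in B F & ed y u \in B F].
  by rewrite BF /cyc5 !inE !eqxx !orbT.
have [g1 g2 g3 g4] := And4 (BinE BE f1) (BinE BE f2) (BinE BE f3) (BinE BE f4).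
have [yS|yS] := boolP (y \in S); have [xS|xS] := boolP (x \in S); have [wS|wS] := boolP (w \in S).
- have : B F \subset dK.
    apply/subsetP => f fF; have : f \in cyc5 u v w x y by rewrite -BF.
    by rewrite !in_setU !in_set1 => /or4P [|||/orP[]] /eqP ->; apply: inK.
  by move/subset_leq_card; rewrite c5 d3.
- by apply: (@no_adj2 v x w).
- by apply: (@no_adj2 w y x).
- by apply: (@outside2c v y x w) => //; rewrite edC.
- by apply: (@no_adj2 u x y) => //; rewrite edC.
- by apply: (@no_adj2 u x y) => //; rewrite edC.
- by apply: (@outside2c u w x y) => //; rewrite eq_sym.
- by apply: (@outside3c u v w x y).
Qed.

End Dense9.

(* The amount sent across each edge that borders a triangular face: it is at most
   (11 k - 36) / k for a k-face, except that a 4-face may concentrate its surplus 8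
   on two edges. *)
Definition wF F := if #|B F| == 4 then (if tau B F <= 2 then 4 else 2) else
  if #|B F| == 5 then 3 else 5.

(** The sum avoids choosing a face: an edge of a triangle lies on at most one face that is not a
    triangle. *)
Definition wt (e : {set T}) := \sum_(F | ~~ tri B F && (e \in B F)) wF F.

Hypothesis indec : forall X : {set I}, X != set0 -> ssum B X = set0 -> X = setT.

Lemma wt_ge F e : ~~ tri B F -> e \in B F -> wF F <= wt e.
Proof. by move=> nt eF; rewrite /wt (bigD1 F) /= ?nt ?eF // leq_addr. Qed.

Lemma wt_lb m : (forall F e, F \notin K -> ~~ tri B F -> e \in dK -> e \in B F -> m <= wF F) ->
  m * #|dK| <= \sum_(e in dK) wt e.
Proof.
move=> h; rewrite mulnC -sum_nat_const; apply: leq_sum => e ed.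
have [F [FK nt eF]] := dK_outer B2 Kclosed ed.
exact: leq_trans (h F e FK nt ed eF) (wt_ge nt eF).
Qed.

Lemma wF_ge2 F : 2 <= wF F.
Proof. by rewrite /wF; case: ifP => _; case: ifP. Qed.

Lemma EK_bin (S : {set T}) : inside B K S = K -> #|EK| <= 'C(#|S|, 2).
Proof.
move=> KS; have := EK_subS KS; rewrite -/EK => sub.
pose X := [set f : {set T} | f \subset S & #|f| == 2].
have : EK \subset X.
  apply/subsetP => f fE; rewrite inE sub //=.
  by rewrite (two_unifP _ (EK_two_unif E2 BE K) _ fE).
by move/subset_leq_card; rewrite /X (cards_draws S 2).
Qed.

Lemma cluster_ineq : #|\bigcup_i B i| <= 9 \/ 3 * #|K| <= \sum_(e in dK) wt e.
Proof.
have [S Sc KS] := cluster_small E2 noT BE Bev B2 Kn0 Ktri Kconn.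
have cnt := count_dK B2 Ktri; rewrite -/EK -/dK in cnt.
have EKle : #|EK| <= 6 \/ 7 <= #|EK| <= 9 /\ #|S| = 5.
  case: Sc => [S4|[S5 ge7]]; [left|right; split=> //].
    exact: leq_trans (EK_bin KS) (leq_bin2l 2 S4).
  by rewrite ge7 /=; apply: leq_trans (noK5 S5); apply/subset_leq_card/(EK_ES BE KS).
have Kpos : 0 < #|K| by rewrite card_gt0.
have d0or : #|dK| = 0 \/ 3 <= #|dK|.
  case: (eqVneq dK set0) => [->|ne]; [by left; rewrite cards0|right].
  by apply: even_card_ge3 ne; [apply: dK_two_unif E2 BE K|apply: dK_even].
case: d0or => [d0|d3].
  (* An empty boundary means that the class sums to zero, so it is the whole family. *)
  left; have KT : K = setT by apply: indec => //; apply/eqP; rewrite -cards_eq0 -/dK d0.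
  have -> : \bigcup_i B i = EK.
    by rewrite /EK /cluster_edges KT; apply: eq_bigl => i; rewrite inE.
  by move: EKle; lia.
have [h|h] := leqP (3 * #|K|) (2 * #|dK|).
  by right; apply: leq_trans h _; apply: wt_lb => F e _ _ _ _; apply: wF_ge2.
(* Given [cnt] and the bounds on [#|EK|], weight 2 per boundary edge falls short of [3 * #|K|] for
   these three triples only. *)
have cases : (#|K| = 3 /\ #|dK| = 3 /\ #|EK| = 6) \/ (#|K| = 4 /\ #|dK| = 4 /\ #|EK| = 8)
   \/ (#|K| = 5 /\ #|dK| = 3 /\ #|EK| = 9) by lia.
have [[kc [dc ec]]|sA] : (#|K| = 5 /\ #|dK| = 3 /\ #|EK| = 9) \/
  shapeA B K S /\ 4 * #|dK| <= 16 /\ #|K| = #|dK|.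
- case: cases => [[kc [dc ec]]|[[kc [dc ec]]|]]; [right|right|by left].
    split; last by lia.
    left; rewrite -/EK; split=> //; case: Sc; last by rewrite -/EK; lia.
    move=> S4; apply/eqP; rewrite eqn_leq S4 leqNgt; apply/negP => S3.
    have := EK_bin KS; rewrite ec.
    by move/leq_trans/(_ (leq_bin2l 2 (S3 : #|S| <= 3))).
  split; last by lia.
  by right; rewrite -/EK ec; split=> //; lia.
- right; rewrite kc; have S5 : #|S| = 5 by lia.
  apply: leq_trans (wt_lb (m := 5) _); first by rewrite dc.
  move=> F e FK nt ed eF; have K9 : 9 <= #|EK| by rewrite ec.
  have := face_ge6 KS S5 K9 dc FK nt ed eF; rewrite /wF.
  by case: eqP => [->//|_]; case: eqP => [->//|].
case: sA => sA [d16 kd].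
have d4 : #|dK| <= 4 by lia.
have [/existsP [F /andP [/and3P [FK nt /eqP c4] /existsP [e /andP [ed eF]]]]|nF] :=
  boolP [exists F, [&& F \notin K, ~~ tri B F & #|B F| == 4] &&
    [exists e, (e \in dK) && (e \in B F)]].
  have [BFd|[tF cF]] := face4 E2 noT noK5 BE Bev B2 Kclosed KS sA d4 FK c4 ed eF.
    (* A single 4-face fills the whole boundary, so adding it to the class gives a zero sum. *)
    left; have XT : F |: K = setT.
      apply: indec; first by apply/set0Pn; exists F; rewrite !inE eqxx.
      apply/setP => f; rewrite in_ssum big_setU1 //= -in_ssum -/dK BFd.
      by rewrite in_set0 addbb.
    have -> : \bigcup_i B i = EK.
      apply/eqP; rewrite eqEsubset; apply/andP; split; last first.
        by apply/bigcupsP => j _; apply: bigcup_sup.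
      apply/bigcupsP => j _; have : j \in F |: K by rewrite XT inE.
      rewrite !inE => /orP [/eqP ->|jK]; last by apply: bigcup_sup.
      by rewrite BFd; apply/subsetP => f; apply: dK_EK.
    by move: EKle; lia.
  (* At least two boundary edges carry 4 and the others at least 2. The total is at least
     [2 * #|dK| + 4], hence at least [3 * #|dK|] because [#|dK| <= 4]. *)
  right; have w4 : wF F = 4 by rewrite /wF c4 eqxx tF.
  rewrite (bigID (fun e => e \in B F)) /=.
  have b1 : 4 * #|dK :&: B F| <= \sum_(f in dK | f \in B F) wt f.
    rewrite mulnC -sum_nat_const; under [X in X <= _]eq_bigl => f do rewrite in_setI.
    by apply: leq_sum => f /andP [_ fF]; rewrite -w4; apply: wt_ge.
  have b2 : 2 * #|dK :\: B F| <= \sum_(f in dK | f \notin B F) wt f.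
    rewrite mulnC -sum_nat_const; under [X in X <= _]eq_bigl => f do rewrite in_setD andbC.
    apply: leq_sum => f /andP [fd _]; have [F' [_ nt' eF']] := dK_outer B2 Kclosed fd.
    exact: leq_trans (wF_ge2 F') (wt_ge nt' eF').
  rewrite -/dK in cF; have := cardsID (B F) dK; move: b1 b2 cF d4; rewrite kd.
  move: #|dK :&: _| #|dK :\: _| #|dK| (\sum_(f in dK | f \in B F) wt f)
    (\sum_(f in dK | f \notin B F) wt f).
  clear; lia.
(* Without 4-faces at the boundary every boundary edge carries at least 3, which is enough because
   [#|K| = #|dK|]. *)
right; rewrite kd; apply: wt_lb => F e FK nt ed eF; rewrite /wF.
have -> : (#|B F| == 4) = false.
  apply/negP => c4; case/existsP: nF; exists F; rewrite FK nt c4 /=.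
  by apply/existsP; exists e; rewrite ed.
by case: ifP.
Qed.

End OneCluster.
End Local2.

(** * Discharging over all classes *)

Section Discharge.
Variables (T I : finType) (E : {set {set T}}) (B : I -> {set {set T}}).
Hypothesis E2 : two_unif E.
Hypothesis noT : no_theta6 E.
Hypothesis noK5 : forall S : {set T}, #|S| = 5 -> #|[set e in E | e \subset S]| <= 9.
Hypothesis BE : forall i, B i \subset E.
Hypothesis Bev : forall i, even_set (B i).
Hypothesis Bne : forall i, B i != set0.
Hypothesis B2 : forall i e, e \in B i -> #|[set j | e \in B j]| = 2.
Hypothesis indec : forall X : {set I}, X != set0 -> ssum B X = set0 -> X = setT.

Lemma sum1_set (A : finType) (P : pred A) : \sum_(x | P x) 1 = #|[set x | P x]|.
Proof. by rewrite -sum1_card; apply: eq_bigl => x; rewrite inE. Qed.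

Lemma sum_face_size : \sum_i #|B i| = 2 * #|\bigcup_i B i|.
Proof.
under eq_bigr => i _ do rewrite -sum1_card big_mkcond.
rewrite exchange_big /= mulnC -sum_nat_const [RHS]big_mkcond; apply: eq_bigr => e _.
rewrite -big_mkcond /= sum1_set.
case: bigcupP => [[i _ ei]|ne]; first by rewrite (B2 ei).
apply/eqP; rewrite cards_eq0 -subset0; apply/subsetP => i; rewrite inE => ei.
by case: ne; exists i.
Qed.

Let tadj i j := [&& tri B i, tri B j & B i :&: B j != set0].

Lemma tadj_sym : symmetric tadj.
Proof. by move=> i j; rewrite /tadj setIC; case: (tri B i); case: (tri B j). Qed.

Lemma tadj_csym : connect_sym tadj. Proof. exact/sym_connect_sym/tadj_sym. Qed.

(** The classes are the components of [tadj], indexed by their roots so that a sum over triangles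
    can be partitioned. An index that is the root of no triangle gives the empty class. *)
Lemma root_ineq r : #|\bigcup_i B i| <= 9 \/
  3 * #|[set j | tri B j && (root tadj j == r)]| <=
  \sum_(j | tri B j && (root tadj j == r)) \sum_(e in B j) wt B e.
Proof.
set K := [set j | _]; case: (eqVneq K set0) => [->|Kn0].
  by right; rewrite cards0 muln0.
have Ktri j : j \in K -> tri B j by rewrite inE => /andP [].
have Kclosed i j e : j \in K -> tri B i -> e \in B i -> e \in B j -> i \in K.
  rewrite !inE => /andP [tj /eqP rj] ti ei ej; rewrite ti -rj (root_connect tadj_csym).
  by apply: connect1; rewrite /tadj ti tj; apply/set0Pn; exists e; rewrite inE ei.
have Kconn (X : {set I}) : X \subset K -> X != set0 -> X != K ->
  exists i j e, [/\ i \in X, j \in K, j \notin X, e \in B i & e \in B j].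
  move=> XK /set0Pn [x xX] nXK.
  have [/existsP [i /existsP [j /and4P [iX jK jX /set0Pn [e]]]]|no] :=
    boolP [exists i, exists j, [&& i \in X, j \in K, j \notin X & B i :&: B j != set0]].
    by rewrite inE => /andP [ei ej]; exists i, j, e.
  case/negP: nXK; rewrite eqEsubset XK; apply/subsetP => y yK.
  have xy : connect tadj x y.
    have := subsetP XK x xX; move: yK; rewrite !inE => /andP [_ /eqP ry] /andP [_ /eqP rx].
    by rewrite -(root_connect tadj_csym) rx ry.
  suff cl : closed tadj X by rewrite -(closed_connect cl xy).
  apply: (intro_closed tadj_csym) => i j ij iX; apply/negPn/negP => jX.
  case/and3P: (ij) => ti tj sh; case/negP: no; apply/existsP; exists i; apply/existsP; exists j.
  rewrite iX jX sh !andbT /=; have := subsetP XK i iX; rewrite !inE tj => /andP [_ /eqP <-].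
  by rewrite (root_connect tadj_csym) connect1 // tadj_sym.
have [h|h] := cluster_ineq E2 noT noK5 BE Bev B2 Kn0 Ktri Kclosed Kconn indec.
  by left.
right; apply: leq_trans h _.
under [X in _ <= X]eq_bigr => j _ do rewrite big_mkcond.
rewrite exchange_big /= big_mkcond /=; apply: leq_sum => e _.
case: ifP => // ed; have := dK_EK ed => /bigcupP [j jK ej].
by rewrite (bigD1 j) ?ej ?leq_addr //; move: jK; rewrite inE.
Qed.

(** Tight at 4-faces, where 8 = 4 * 2 = 2 * 4, and at 6-faces, where 30 = 5 * 6; a 5-face sends at
    most 15 out of 19. *)
Lemma wF_tau F : ~~ tri B F -> wF B F * tau B F + 36 <= 11 * #|B F|.
Proof.
move=> nt; have ge3 : 3 <= #|B F| by apply: even_card_ge3; [apply: B2u E2 BE F| |].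
have le : tau B F <= #|B F|.
  by apply/subset_leq_card/subsetP => e; rewrite inE => /andP [].
move: nt ge3 le; rewrite /tri /wF.
move: (tau B F) #|B F| => t k k3 ge3 le.
case: eqP => [k4|n4]; first by move: le; rewrite k4; case: (leqP t 2); lia.
by case: eqP => [k5|n5]; move: k3 le ge3; lia.
Qed.

(** After exchanging the sums, each edge of F contributes [wF B F] at most once: F is one of the two
    faces at that edge, so at most one of them is a triangle. *)
Lemma discharge_sum : \sum_(j | tri B j) \sum_(e in B j) wt B e
  <= \sum_(F | ~~ tri B F) wF B F * tau B F.
Proof.
have -> : \sum_(j | tri B j) \sum_(e in B j) wt B e =
  \sum_(F | ~~ tri B F) \sum_(e in B F) \sum_(j | tri B j && (e \in B j)) wF B F.
  under eq_bigr => j _ do rewrite big_mkcond.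
  rewrite exchange_big /=.
  under [RHS]eq_bigr => F _ do rewrite big_mkcond.
  rewrite [RHS]exchange_big /=; apply: eq_bigr => e _.
  rewrite -!big_mkcondr /= /wt exchange_big /=.
  exact: eq_bigr.
apply: leq_sum => F nt; rewrite mulnC /tau -sum1_card big_distrl /=.
rewrite [X in X <= _]big_mkcond [X in _ <= X]big_mkcond; apply: leq_sum => e _.
rewrite inE; case: (boolP (e \in B F)) => //= eF; rewrite mul1n.
case: existsP => [[j tj]|no]; last first.
  by rewrite big1 // => j tj; case: no; exists j.
rewrite (bigD1 j) //= big1 ?addn0 // => k /andP [/andP [tk ek] kj].
have /andP [ttj ej] := tj.
have Fj : F != j by apply: contraNneq nt => ->.
case: (covered_twice B2 Fj eF ej ek) => E'; subst k; first by rewrite tk in nt.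
by rewrite eqxx in kj.
Qed.

Theorem face_bound : #|\bigcup_i B i| <= 9 \/ 18 * #|I| <= 11 * #|\bigcup_i B i|.
Proof.
have [|gt9] := leqP #|\bigcup_i B i| 9; [by left|right].
have t1 : \sum_(j | tri B j) 3 <= \sum_(j | tri B j) \sum_(e in B j) wt B e.
  rewrite (partition_big (root tadj) predT) //= [X in _ <= X](partition_big (root tadj) predT) //=.
  apply: leq_sum => r _; have [|h] := root_ineq r; first by rewrite leqNgt gt9.
  by rewrite sum_nat_cond_const mulnC.
have t2 := leq_trans t1 discharge_sum.
have t3 : \sum_(F | ~~ tri B F) (wF B F * tau B F + 36) <= \sum_(F | ~~ tri B F) 11 * #|B F|.
  by apply: leq_sum => F nt; apply: wF_tau.
have t4 : \sum_(F | tri B F) 11 * #|B F| = \sum_(F | tri B F) 3 * 11.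
  by apply: eq_bigr => F /eqP ->.
have t5 : \sum_F 11 * #|B F| = \sum_(F | tri B F) 11 * #|B F| + \sum_(F | ~~ tri B F) 11 * #|B F|.
  by rewrite (bigID (tri B)).
have t6 : #|I| = \sum_(F | tri B F) 1 + \sum_(F | ~~ tri B F) 1.
  by rewrite -sum1_card (bigID (tri B)).
rewrite -big_distrr /= sum_face_size in t5.
rewrite big_split /= in t3.
rewrite !sum_nat_cond_const in t1 t2 t3 t4 t6.
(* Adding 33 for each triangle to t2 and t3 gives 36 times the number of faces on the left and 22
   times the number of covered edges on the right. *)
move: t2 t3 t4 t5 t6.
move: (\sum_(F | ~~ tri B F) wF B F * tau B F) (\sum_(F | ~~ tri B F) 11 * #|B F|)
  (\sum_(F | tri B F) 11 * #|B F|) #|_| #|_| #|_| #|I|; clear; lia.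
Qed.

End Discharge.

(** * Cycle spaces and the edge bound *)

Section CycleSpace.
Variable T : finType.
Implicit Types (E z : {set {set T}}) (S A : {set T}).

Definition symd (X : finType) (A C : {set X}) := [set x | (x \in A) (+) (x \in C)].

Lemma symdK (X : finType) (A C : {set X}) : symd A (symd A C) = C.
Proof. by apply/setP => x; rewrite !inE addKb. Qed.

Definition cycle_space E := [set z in powerset E | even_set z].

(** The boundary of z as a chain over the field with two elements. *)
Definition odd_verts z := [set v | odd (degz z v)].

Lemma odd_degz z v : odd (degz z v) = \big[addb/false]_e ((e \in z) && (v \in e)).
Proof. by rewrite /degz odd_card; apply: eq_bigr => e _; rewrite inE. Qed.

Lemma odd_verts_symd z1 z2 : odd_verts (symd z1 z2) = symd (odd_verts z1) (odd_verts z2).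
Proof.
apply/setP => v; rewrite !inE !odd_degz -big_split; apply: eq_bigr => e _ /=.
by rewrite inE; case: (_ \in z1); case: (_ \in z2); case: (v \in e).
Qed.

Lemma even_odd_verts z : even_set z = (odd_verts z == set0).
Proof.
apply/even_setP/eqP => [h|/setP h v]; first by apply/setP => v; rewrite !inE h.
by have := h v; rewrite !inE.
Qed.

Lemma card_odd_verts z : two_unif z -> odd #|odd_verts z| = false.
Proof.
move=> z2; rewrite odd_card.
under eq_bigr => v _ do rewrite inE odd_degz.
rewrite exchange_big big1 //= => e _; case: (boolP (e \in z)) => ez /=; last by rewrite big1.
by rewrite -odd_card (two_unifP _ z2 _ ez).
Qed.

(** Whether a fixed w belongs to an even subset is determined by the other elements. *)
Lemma card_even_subsets S : S != set0 ->
  #|[set A in powerset S | ~~ odd #|A|]| <= 2 ^ (#|S| - 1).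
Proof.
case/set0Pn => w wS.
have inj : {in [set A in powerset S | ~~ odd #|A|] &, injective (fun A => A :\ w)}.
  move=> A C; rewrite !inE => /andP [_ oA] /andP [_ oC] /= E.
  have wAC : (w \in A) = (w \in C).
    move: oA oC; rewrite (cardsD1 w A) (cardsD1 w C) E !oddD !oddb.
    by case: (w \in A); case: (w \in C); case: (odd _).
  apply/setP => x; move/setP/(_ x): E; rewrite !inE.
  by case: (eqVneq x w) => [->|_] /=.
rewrite -(card_in_imset inj).
have -> : #|S| - 1 = #|S :\ w| by rewrite (cardsD1 w S) wS add1n subn1.
rewrite -card_powerset; apply/subset_leq_card/subsetP => _ /imsetP [A + ->].
by rewrite !inE => /andP [AS _]; apply: setSD.
Qed.

(** Rank and nullity by counting: edge sets are sorted by their boundary, an even subset of S, and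
    those with a given boundary, if any, form a translate of the cycle space. In dimensions this
    reads at least |E| - |S| + 1. *)
Lemma cycle_space_lb E S : two_unif E -> (forall e, e \in E -> e \subset S) -> S != set0 ->
  2 ^ #|E| <= #|cycle_space E| * 2 ^ (#|S| - 1).
Proof.
move=> E2 ES S0; rewrite -card_powerset -sum1_card.
rewrite (partition_big odd_verts (mem [set A in powerset S | ~~ odd #|A|])) /=; last first.
  move=> z; rewrite !inE => zE; rewrite card_odd_verts ?andbT; last exact: two_unifS zE E2.
  apply/subsetP => v; rewrite inE => od; have : 0 < degz z v by case: degz od.
  by case/card_gt0P => e; rewrite inE => /andP [/(subsetP zE)/ES/subsetP s /s].
apply: leq_trans (_ : \sum_(A in [set A in powerset S | ~~ odd #|A|]) #|cycle_space E| <= _).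
  apply: leq_sum => A _; rewrite sum1_card.
  case: (set_0Vmem [set z in powerset E | odd_verts z == A]) => [E0|[z0]].
    rewrite (_ : #|_| = 0) //; apply: eq_card0 => z.
    transitivity (z \in [set z in powerset E | odd_verts z == A]); first by rewrite [RHS]inE.
    by rewrite E0 !inE.
  rewrite !inE => /andP [zE /eqP zA].
  have inj : injective (symd z0) by apply: can_inj (@symdK _ z0).
  rewrite -(card_imset _ inj); apply/subset_leq_card/subsetP => _ /imsetP [z + ->].
  move=> /andP [zE' /eqP zA']; rewrite powersetE in zE'; rewrite inE powersetE.
  rewrite even_odd_verts odd_verts_symd zA zA'; apply/andP; split.
    apply/subsetP => e; rewrite inE; case: (boolP (e \in z0)) => [/(subsetP zE) //|_].
    by rewrite addFb; apply: (subsetP zE').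
  by apply/eqP/setP => v; rewrite !inE addbb.
by rewrite sum_nat_const mulnC leq_mul2l card_even_subsets // orbT.
Qed.

End CycleSpace.

(** * Spans of zero-sum families *)

Section Span.
Variables (T I : finType) (B : I -> {set {set T}}).
Implicit Types (X Y J : {set I}).

Definition face_combs X := [set ssum B J | J in powerset X].
Definition covered X := \bigcup_(i in X) B i.

Lemma ssum_symd X Y : ssum B (symd X Y) = symd (ssum B X) (ssum B Y).
Proof.
apply/setP => e; rewrite [RHS]inE !in_ssum !(big_mkcond (fun i => i \in _)) -big_split.
by apply: eq_bigr => i _; rewrite inE; case: (i \in X); case: (i \in Y); case: (e \in B i).
Qed.

Lemma ssum_split X Y : Y \subset X -> ssum B X = symd (ssum B Y) (ssum B (X :\: Y)).
Proof.
move=> YX; rewrite -ssum_symd; congr ssum; apply/setP => i; rewrite !inE.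
by have := subsetP YX i; case: (i \in Y) => // /(_ isT) ->.
Qed.

Lemma symd0s (A : {set {set T}}) : symd set0 A = A.
Proof. by apply/setP => x; rewrite !inE. Qed.

(** A subfamily and its complement in X have the same sum, and one of the two avoids the fixed face
    x. *)
Lemma span_zero_sum X : X != set0 -> ssum B X = set0 -> #|face_combs X| <= 2 ^ (#|X| - 1).
Proof.
case/set0Pn => x xX sX.
have -> : #|X| - 1 = #|X :\ x| by rewrite (cardsD1 x X) xX add1n subn1.
rewrite -card_powerset; apply: leq_trans (leq_imset_card (ssum B) _).
apply/subset_leq_card/subsetP => _ /imsetP [J JX ->]; rewrite powersetE in JX.
have [xJ|xJ] := boolP (x \in J); apply/imsetP; last first.
  by exists J; rewrite // powersetE subsetD1 JX.
exists (X :\: J); first by rewrite powersetE subsetD1 subsetDl inE xJ.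
have := ssum_split JX; rewrite sX => /setP E; apply/setP => e; have := E e.
by rewrite in_set0 /symd in_set; case: (_ \in _); case: (_ \in _).
Qed.

Lemma span_split X Y : Y \subset X -> #|face_combs X| <= #|face_combs Y| * #|face_combs (X :\: Y)|.
Proof.
move=> YX; rewrite -cardsX.
apply: leq_trans (leq_imset_card (fun p => symd p.1 p.2) _).
apply/subset_leq_card/subsetP => _ /imsetP [J JX ->]; rewrite powersetE in JX.
apply/imsetP; exists (ssum B (J :&: Y), ssum B (J :\: Y)).
  rewrite inE /=; apply/andP; split; apply/imsetP.
    by exists (J :&: Y); rewrite // powersetE subsetIr.
  by exists (J :\: Y); rewrite // powersetE setSD.
by rewrite /= [LHS](ssum_split (subsetIl J Y)) setDIr setDv set0U.
Qed.

Hypothesis B2 : forall i e, e \in B i -> #|[set j | e \in B j]| = 2.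

(** The number is even, positive and at most two. Hence a zero-sum subfamily covers its edges twice
    by itself and shares none with the remaining faces. *)
Lemma zero_sum_cover X i e : ssum B X = set0 -> i \in X -> e \in B i ->
  #|[set j in X | e \in B j]| = 2.
Proof.
move=> sX iX ei.
have le : #|[set j in X | e \in B j]| <= 2.
  by rewrite -(B2 ei); apply/subset_leq_card/subsetP => k; rewrite !inE => /andP [].
have gt0 : 0 < #|[set j in X | e \in B j]| by apply/card_gt0P; exists i; rewrite inE iX.
have : e \notin ssum B X by rewrite sX inE.
by rewrite inE; case: #|_| le gt0 => [|[|[|]]].
Qed.

Lemma covered_split X Y : Y \subset X -> ssum B Y = set0 ->
  #|covered X| = #|covered Y| + #|covered (X :\: Y)|.
Proof.
move=> YX sY; rewrite /covered (big_setID Y) /= (setIidPr YX) cardsU.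
rewrite (_ : _ :&: _ = set0) ?cards0 ?subn0 //; apply/setP => e; rewrite !inE.
apply/negP => /andP [/bigcupP [i iY ei] /bigcupP [j]]; rewrite inE => /andP [jY _] ej.
have c2 := zero_sum_cover sY iY ei.
have : #|j |: [set k in Y | e \in B k]| <= #|[set k | e \in B k]|.
  by apply/subset_leq_card/subsetP => k; rewrite !inE => /orP [/eqP ->|/andP []].
by rewrite (B2 ei) cardsU1 c2 inE (negPf jY).
Qed.

Variable E : {set {set T}}.
Hypothesis E2 : two_unif E.
Hypothesis BE : forall i, B i \subset E.
Hypothesis Bev : forall i, even_set (B i).

Section Sub.
Variable X : {set I}.
Hypothesis sX : ssum B X = set0.
Hypothesis Xne : forall i, i \in X -> B i != set0.
(** [face_bound] speaks of a whole index type, so a subfamily is reindexed by a subtype. *)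
Let I' : finType := {i : I | i \in X}.
Let B' (i : I') := B (val i).

Lemma card_I' : #|I'| = #|X|. Proof. by rewrite card_sig; apply: eq_card. Qed.

Lemma card_sub (P : pred I) : #|[set i : I' | P (val i)]| = #|[set i in X | P i]|.
Proof.
rewrite -(card_imset _ val_inj); apply: eq_card => i; apply/imsetP/idP.
  by case=> j; rewrite !inE => Pj ->; rewrite Pj andbT; apply: (valP j).
by rewrite inE => /andP [iX Pi]; exists (exist _ i iX); rewrite ?inE.
Qed.

Lemma B2' i e : e \in B' i -> #|[set j | e \in B' j]| = 2.
Proof.
by move=> ei; rewrite (card_sub (fun j => e \in B j)) (zero_sum_cover sX (valP i) ei).
Qed.

Lemma cov' : \bigcup_i B' i = covered X.
Proof.
apply/setP => e; apply/bigcupP/bigcupP => [[i _ ei]|[i iX ei]].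
  by exists (val i); rewrite ?(valP i).
by exists (exist _ i iX).
Qed.

Lemma faces3 : 3 * #|X| <= 2 * #|covered X|.
Proof.
rewrite -cov' -(sum_face_size B2') -card_I' -sum1_card big_distrr /=; apply: leq_sum => i _.
rewrite muln1; apply: even_card_ge3; [exact: two_unifS (BE _) E2|exact: Bev|exact: Xne (valP i)].
Qed.

Lemma face_bound_sub : no_theta6 E ->
  (forall S : {set T}, #|S| = 5 -> #|[set e in E | e \subset S]| <= 9) ->
  (forall Y, Y \subset X -> Y != set0 -> ssum B Y = set0 -> Y = X) ->
  #|covered X| <= 9 \/ 18 * #|X| <= 11 * #|covered X|.
Proof.
move=> noT noK5 ind; rewrite -cov' -card_I'.
apply: (face_bound E2 noT noK5) => [i|i|i|i e|Y Y0 sY]; rewrite ?/B' ?BE ?Bev ?Xne ?(valP i) //.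
  exact: B2'.
have : [set val i | i in Y] = X.
  apply: ind.
  - by apply/subsetP => _ /imsetP [i _ ->]; apply: valP.
  - by case/set0Pn: Y0 => i iY; apply/set0Pn; exists (val i); apply/imsetP; exists i.
  apply/setP => e; move/setP/(_ e): sY; rewrite !in_ssum.
  by rewrite big_imset //= => ? ? _ _; apply: val_inj.
move=> EY; apply/setP => i; rewrite inE.
have : val i \in [set val i | i in Y] by rewrite EY (valP i).
by case/imsetP => j jY /val_inj ->.
Qed.

End Sub.

Hypothesis noT : no_theta6 E.
Hypothesis noK5 : forall S : {set T}, #|S| = 5 -> #|[set e in E | e \subset S]| <= 9.

(* The dimension d of the span of a zero-sum family, against its number c of edges:
   two zero-sum parts contribute 18 d + 9 <= 11 c each, hence 18 d + 18 <= 11 c. *)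
Lemma span_bound X : ssum B X = set0 -> (forall i, i \in X -> B i != set0) -> X != set0 ->
  exists d, [/\ #|face_combs X| <= 2 ^ d, 18 * d + 9 <= 11 * #|covered X| &
    18 * d + 18 <= 11 * #|covered X| \/ #|covered X| <= 9].
Proof.
have [n] := ubnP #|X|; elim: n X => // n IH X lt sX Xne X0.
have [/existsP [Y /and4P [YX Y0 /eqP sY nYX]]|no] :=
  boolP [exists Y : {set I}, [&& Y \subset X, Y != set0, ssum B Y == set0 & Y != X]].
  have D0 : X :\: Y != set0 by apply: contra nYX; rewrite setD_eq0 eqEsubset YX.
  have sD : ssum B (X :\: Y) = set0 by have := ssum_split YX; rewrite sX sY symd0s.
  have cX : #|Y| + #|X :\: Y| = #|X| by rewrite -(cardsID Y X) (setIidPr YX).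
  have [||d1 [s1 h1 _]] := IH Y _ sY _ Y0.
  - by move: D0 cX lt; rewrite -card_gt0; move: #|_| #|_| #|_| => a b c; lia.
  - by move=> i /(subsetP YX) /Xne.
  have [||d2 [s2 h2 _]] := IH (X :\: Y) _ sD _ D0.
  - by move: Y0 cX lt; rewrite -card_gt0; move: #|_| #|_| #|_| => a b c; lia.
  - by move=> i; rewrite inE => /andP [_ /Xne].
  exists (d1 + d2); rewrite (covered_split YX sY); split.
  - by apply: leq_trans (span_split YX) _; rewrite expnD leq_mul.
  - by move: h1 h2; move: #|_| #|_| => a b; lia.
  - by left; move: h1 h2; move: #|_| #|_| => a b; lia.
have ind Y : Y \subset X -> Y != set0 -> ssum B Y = set0 -> Y = X.
  move=> YX Y0 sY; apply/eqP/negPn/negP => nYX; case/negP: no; apply/existsP; exists Y.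
  by rewrite YX Y0 sY eqxx nYX.
(* The relation among the faces of X lowers the dimension to |X| - 1. If c <= 9, then 18 |X| <= 12 c
   gives 18 (|X| - 1) + 9 <= 12 c - 9 <= 11 c. *)
exists (#|X| - 1); have := face_bound_sub sX Xne noT noK5 ind; have := faces3 sX Xne.
have := span_zero_sum X0 sX; move: X0; rewrite -card_gt0.
move: #|face_combs X| #|X| #|covered X| => s x c x0 -> f3 fb.
by split=> //; move: x0 f3 fb; clear; lia.
Qed.

End Span.

(* Mac Lane's planarity criterion, with the outer face included so that covered
   edges lie on exactly two faces; bridges lie on none. *)
Definition two_basis (T I : finType) (E : {set {set T}}) (B : I -> {set {set T}}) :=
  [/\ forall i, B i \subset E, forall i, even_set (B i),
      forall i e, e \in B i -> #|[set j | e \in B j]| = 2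
    & forall z : {set {set T}}, z \subset E -> even_set z -> exists J, z = ssum B J].

(** * The edge bound from a face basis *)

Section EdgeBound.
Variables (T : finType) (E : {set {set T}}).
Hypothesis E2 : two_unif E.

Lemma basis_space (I : finType) (B : I -> {set {set T}}) (S : {set T}) : two_basis E B ->
  (forall e, e \in E -> e \subset S) -> S != set0 ->
  exists X, [/\ ssum B X = set0, forall i, i \in X -> B i != set0,
     2 ^ #|E| <= #|face_combs B X| * 2 ^ (#|S| - 1) & covered B X \subset E].
Proof.
case=> BE Bev B2 Bsp ES S0; exists [set i | B i != set0]; split.
- apply/setP => e; rewrite inE in_set0.
  have -> : [set j in [set i | B i != set0] | e \in B j] = [set j | e \in B j].
    apply/setP => j; rewrite !inE andb_idl // => ej; apply/set0Pn; by exists e.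
  case: (set_0Vmem [set j | e \in B j]) => [->|[i]]; first by rewrite cards0.
  by rewrite inE => ei; rewrite (B2 _ _ ei).
- by move=> i; rewrite inE.
- apply: leq_trans (cycle_space_lb E2 ES S0) _; rewrite leq_mul2r; apply/orP; right.
  apply/subset_leq_card/subsetP => z; rewrite !inE => /andP [zE ez].
  have [J ->] := Bsp z zE ez; apply/imsetP; exists (J :&: [set i | B i != set0]).
    by rewrite powersetE subsetIr.
  apply/setP => e; rewrite !inE; congr (odd #|pred_of_set _|).
  apply/setP => j; rewrite !inE; case: (j \in J) => //=.
  by rewrite andb_idl // => ej; apply/set0Pn; exists e.
- by apply/bigcupsP => i _; apply: BE.
Qed.

Lemma edge_bound (I : finType) (B : I -> {set {set T}}) : two_basis E B -> no_theta6 E ->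
  (forall S : {set T}, #|S| = 5 -> #|[set e in E | e \subset S]| <= 9) ->
  6 <= #|T| -> 7 * #|E| + 36 <= 18 * #|T|.
Proof.
move=> tb noT noK5 n6; have [BE Bev B2 _] := tb.
have [||X [sX Xne dim cE]] := basis_space (S := setT) tb.
- by move=> e _; apply: subsetT.
- by rewrite -card_gt0 cardsT; apply: leq_trans n6.
rewrite cardsT in dim; have ce := subset_leq_card cE.
case: (eqVneq X set0) => [X0|X0].
  have s1 : #|face_combs B X| <= 1.
    rewrite X0 /face_combs powerset0; apply: leq_trans (leq_imset_card _ _) _; by rewrite cards1.
  have : 2 ^ #|E| <= 2 ^ (#|T| - 1).
    by apply: leq_trans dim _; rewrite -{2}[2 ^ (_ - 1)]mul1n leq_mul2r s1 orbT.
  by rewrite leq_exp2l //; move: n6; move: #|E| #|T| => e n; lia.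
have [d [sd hd hd']] := span_bound B2 E2 BE Bev noT noK5 sX Xne X0.
have : 2 ^ #|E| <= 2 ^ (d + (#|T| - 1)).
  by apply: leq_trans dim _; rewrite expnD leq_mul2r sd orbT.
(* If only the weaker bound is available, c <= 9 gives d <= 5 and e <= n + 4, and 7 (n + 4) + 36 <=
   18 n holds from n = 6 on. *)
rewrite leq_exp2l //; move: ce n6 hd hd'; move: #|E| #|T| #|covered B X| => e n c; clear; lia.
Qed.

(** Ten edges on five vertices force a cycle space of dimension at least 6, hence at least seven
    faces with 21 sides, while ten edges have only 20. *)
Lemma no_K5 (I : finType) (B : I -> {set {set T}}) (S : {set T}) : two_basis E B ->
  #|S| = 5 -> (forall e, e \in E -> e \subset S) -> #|E| <= 9.
Proof.
move=> tb S5 ES; rewrite leqNgt; apply/negP => gt9.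
have [BE Bev B2 _] := tb.
have [|X [sX Xne dim cE]] := basis_space tb ES; first by rewrite -card_gt0 S5.
have le10 : #|E| <= 10.
  rewrite (_ : 10 = 'C(#|S|, 2)) ?S5 // -S5 -cards_draws; apply/subset_leq_card/subsetP => e eE.
  by rewrite inE ES // (two_unifP _ E2).
have {le10 gt9} E10 : #|E| = 10 by apply/eqP; rewrite eqn_leq le10.
case: (eqVneq X set0) => [X0|X0].
  have s1 : #|face_combs B X| <= 1.
    rewrite X0 /face_combs powerset0; apply: leq_trans (leq_imset_card _ _) _; by rewrite cards1.
  by move: dim; rewrite E10 S5; case: #|face_combs B X| s1 => [|[|]].
have f3 := faces3 B2 E2 BE Bev sX Xne.
have ce := subset_leq_card cE; rewrite E10 in ce.
have : 2 ^ 10 <= 2 ^ (#|X| - 1 + 4).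
  rewrite -E10; apply: leq_trans dim _; rewrite S5 expnD leq_mul2r span_zero_sum ?orbT //.
rewrite leq_exp2l //; move: f3 ce; move: #|X| #|covered B X| => x c; clear; lia.
Qed.

End EdgeBound.

(** * Minors of the grid *)

Notation pt := (nat * nat)%type.
Notation gedge := (bool * (nat * nat))%type.

(* (false, p) is the grid edge from p to its right neighbour and (true, p) the edge
   from p to its upper neighbour.  A unit square is named by its lower left corner;
   sq1 and sq2 are the squares on both sides of an edge.  On the axes sq1 and sq2
   coincide, since the predecessor of 0 is 0. *)
Definition esrc (d : gedge) : pt := d.2.
Definition etgt (d : gedge) : pt := if d.1 then (d.2.1, d.2.2.+1) else (d.2.1.+1, d.2.2).
Definition sq1 (d : gedge) : pt := if d.1 then (d.2.1.-1, d.2.2) else (d.2.1, d.2.2.-1).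
Definition sq2 (d : gedge) : pt := d.2.

Definition gadj (p q : pt) := [exists b : bool, (etgt (b, p) == q) || (etgt (b, q) == p)].

Definition edge_of (p q : pt) : gedge :=
  if p.1 == q.1 then (true, (p.1, minn p.2 q.2)) else (false, (minn p.1 q.1, p.2)).

Lemma edge_of_ends p q : gadj p q ->
  (esrc (edge_of p q) = p /\ etgt (edge_of p q) = q) \/
  (esrc (edge_of p q) = q /\ etgt (edge_of p q) = p).
Proof.
case: p q => [p1 p2] [q1 q2] /existsP [b]; rewrite /etgt /esrc /edge_of /=.
case: b => /orP [] /eqP [<- <-]; rewrite ?eqxx /=.
- by left; rewrite (minn_idPl (leqnSn _)).
- by right; rewrite (minn_idPr (leqnSn _)).
- by left; rewrite (ltn_eqF (ltnSn _)) (minn_idPl (leqnSn _)).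
- by right; rewrite (gtn_eqF (ltnSn _)) (minn_idPr (leqnSn _)).
Qed.

(* The boundary of the chain c at the vertex (i + 1, j + 1). *)
Definition bdry (c : gedge -> bool) (i j : nat) :=
  c (false, (i.+1, j.+1)) (+) c (false, (i, j.+1)) (+)
  (c (true, (i.+1, j.+1)) (+) c (true, (i.+1, j))).

Lemma bdry_single d i j :
  bdry (fun d' => d == d') i j = ((i.+1, j.+1) == esrc d) (+) ((i.+1, j.+1) == etgt d).
Proof.
case: d => [[] [k l]]; rewrite /bdry /esrc /etgt /= !xpair_eqE /= ?eqSS;
rewrite ![_ == k]eq_sym ![_ == l]eq_sym; by rewrite ?addbF ?addFb.
Qed.

Lemma bdry_add c1 c2 i j : bdry (fun d => c1 d (+) c2 d) i j = bdry c1 i j (+) bdry c2 i j.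
Proof. by rewrite /bdry -!addbA; do !bool_congr. Qed.

Lemma bdry_sum (J : finType) (P : pred J) (c : J -> gedge -> bool) i j :
  bdry (fun d => \big[addb/false]_(k | P k) c k d) i j = \big[addb/false]_(k | P k) bdry (c k) i j.
Proof. by rewrite /bdry -!big_split. Qed.

Fixpoint walk_chain (p : pt) (s : seq pt) (d : gedge) : bool :=
  if s is q :: s' then (edge_of p q == d) (+) walk_chain q s' d else false.

Lemma bdry_walk_chain p s i j : path gadj p s ->
  bdry (walk_chain p s) i j = ((i.+1, j.+1) == p) (+) ((i.+1, j.+1) == last p s).
Proof.
elim: s p => [|q s IH] p /=; first by rewrite /bdry /= addbb.
case/andP => pq qs.
rewrite -/(walk_chain q s)
  (_ : bdry _ i j = bdry (fun d' => edge_of p q == d') i j (+) bdry (walk_chain q s) i j);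
  last first.
  by rewrite -bdry_add.
rewrite bdry_single IH //.
by case: (edge_of_ends pq) => -[-> ->]; case: (_ == p); case: (_ == q); case: (_ == last _ _).
Qed.

Lemma walk_chain_in (b : pred pt) p s d : path gadj p s -> all b (p :: s) -> walk_chain p s d ->
  b (esrc d) && b (etgt d).
Proof.
elim: s p => [|q s IH] p //= /andP [pq qs] /and3P [bp bq bs].
case: (eqVneq (edge_of p q) d) => [<- _|_ /= w]; last by apply: IH qs _ w; rewrite /= bq.
by case: (edge_of_ends pq) => -[-> ->]; rewrite bp bq.
Qed.

Section Potential.
Variable c : gedge -> bool.
Hypothesis c0 : forall d, d.2.1 = 0 -> c d = false.
Hypothesis cycle : forall i j, bdry c i j = false.

(* Cast a horizontal ray to the left of the square p. *)
Definition potential (p : pt) := \big[addb/false]_(k < p.1.+1) c (true, (k : nat, p.2)).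

(** A grid cycle is the sum of the squares of odd potential. Across a vertical edge the ray gains
    one term; across a horizontal edge the claim moves along the row, as the boundary vanishes at
    each vertex passed. *)
Lemma potential_sides d : (if d.1 then 0 < d.2.1 else 0 < d.2.2) ->
  potential (sq1 d) (+) potential (sq2 d) = c d.
Proof.
case: d => [[] [i j]] /=; rewrite /potential /=.
  by case: i => // i _; rewrite [X in _ (+) X]big_ord_recr /= addKb.
case: j => // j _ /=; elim: i => [|i IH].
  by rewrite !big_ord_recr !big_ord0 /= !c0.
rewrite big_ord_recr [X in _ (+) X]big_ord_recr /=.
have := cycle i j; rewrite /bdry; move: IH.
move: (\big[_/_]_(_ < _) _) (\big[_/_]_(_ < _) _) (c _) (c _) (c _) (c _).
by do 6 case.
Qed.

End Potential.

(* The coboundary of a vertex set is orthogonal to the boundary of a set of squares. *)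
Lemma boundary_pairing (al ch : pt -> bool) m :
  (forall i j, 0 < i < m /\ 0 < j < m \/ al (i, j) = false) ->
  \big[addb/false]_(b : bool) \big[addb/false]_(i < m) \big[addb/false]_(j < m)
    (let d := (b, (i : nat, j : nat)) in
     (al (esrc d) (+) al (etgt d)) && (ch (sq1 d) (+) ch (sq2 d))) = false.
Proof.
move=> al0; case: m al0 => [|m] al0; first by rewrite big1 // => b _; rewrite big_ord0.
have aj0 i : al (i, 0) = false by case: (al0 i 0) => // -[_].
have ai0 j : al (0, j) = false by case: (al0 0 j) => // -[].
have ajm i : al (i, m.+1) = false by case: (al0 i m.+1) => // -[_]; rewrite ltnn andbF.
have aim j : al (m.+1, j) = false by case: (al0 m.+1 j) => // -[]; rewrite ltnn andbF.
pose H i j := al (i, j) (+) al (i.+1, j).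
pose V i j := al (i, j) (+) al (i, j.+1).
(* Summation by parts: a shift of the index moves the difference from [ch] to [al], and the end
   terms vanish because [al] is zero on the frame. *)
have shH i : \big[addb/false]_(j < m.+1) (H i j && ch (i, j.-1)) =
             \big[addb/false]_(j < m.+1) (H i j.+1 && ch (i, j : nat)).
  by rewrite big_ord_recl [RHS]big_ord_recr /= /H !aj0 !ajm /= ?addbF.
have shV j : \big[addb/false]_(i < m.+1) (V i j && ch (i.-1, j)) =
             \big[addb/false]_(i < m.+1) (V i.+1 j && ch (i : nat, j)).
  by rewrite big_ord_recl [RHS]big_ord_recr /= /V !ai0 !aim /= ?addbF.
rewrite big_bool /=.
rewrite /esrc /etgt /sq1 /sq2 /=.
have eV : \big[addb/false]_(i < m.+1) \big[addb/false]_(j < m.+1)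
    (V i j && (ch (i.-1, j : nat) (+) ch (i : nat, j : nat))) =
  \big[addb/false]_(i < m.+1) \big[addb/false]_(j < m.+1)
    ((V i.+1 j (+) V i j) && ch (i : nat, j : nat)).
  rewrite exchange_big [RHS]exchange_big /=; apply: eq_bigr => j _.
  under eq_bigr => i _ do rewrite andb_addr.
  under [RHS]eq_bigr => i _ do rewrite andb_addl.
  by rewrite big_split [RHS]big_split /= shV.
have eH : \big[addb/false]_(i < m.+1) \big[addb/false]_(j < m.+1)
    (H i j && (ch (i : nat, j.-1) (+) ch (i : nat, j : nat))) =
  \big[addb/false]_(i < m.+1) \big[addb/false]_(j < m.+1)
    ((H i j.+1 (+) H i j) && ch (i : nat, j : nat)).
  apply: eq_bigr => i _.
  under eq_bigr => j _ do rewrite andb_addr.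
  under [RHS]eq_bigr => j _ do rewrite andb_addl.
  by rewrite big_split [RHS]big_split /= shH.
(* Both sums now carry the mixed second difference of [al], so they cancel. *)
rewrite -/(H _ _) in eH *; rewrite /V /H in eV eH; rewrite eV eH.
rewrite -big_split big1 // => i _; rewrite -big_split big1 // => j _ /=.
by case: (al (i : nat, j : nat)) (al (i.+1, j : nat)) (al (i : nat, j.+1)) (al (i.+1, j.+1))
  (ch (i : nat, j : nat)) => [] [] [] [] [].
Qed.

(* The graph is a minor of a grid: br v is the branch set of v, rooted at rho v. *)
Definition grid_model (T : finType) (E : {set {set T}}) (M : nat) (rho : T -> pt)
    (br : T -> pred pt) :=
  [/\ forall v p, br v p -> 0 < p.1 < M /\ 0 < p.2 < M,
      forall u v p, br u p -> br v p -> u = v,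
      forall v p, br v p ->
        exists s, [/\ path gadj (rho v) s, last (rho v) s = p & all (br v) (rho v :: s)]
    & forall e, e \in E -> exists u v p q, [/\ e = ed u v, gadj p q, br u p & br v q]].

(** * Faces of a grid minor *)

Section Minor.
Variables (T : finType) (E : {set {set T}}) (M : nat) (rho : T -> pt) (br : T -> pred pt).
Hypothesis E2 : two_unif E.
Hypothesis model : grid_model E M rho br.

Let box v p : br v p -> 0 < p.1 < M /\ 0 < p.2 < M. Proof. by case: model => h _ _ _; apply: h. Qed.
Let disj u v p : br u p -> br v p -> u = v. Proof. by case: model => _ h _ _; apply: h. Qed.
Let conn v p : br v p ->
  exists s, [/\ path gadj (rho v) s, last (rho v) s = p & all (br v) (rho v :: s)].
Proof. by case: model => _ _ h _; apply: h. Qed.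

Definition crosses (e : {set T}) (d : gedge) :=
  exists u v, [/\ e = ed u v, br u (esrc d) & br v (etgt d)].

Lemma crossing_exists : exists a : {set T} -> gedge, forall e, e \in E -> crosses e (a e).
Proof.
have [|a ha] := @fin_all_exists {set T} (fun _ => gedge) (fun e d => e \in E -> crosses e d).
  move=> e; case: (boolP (e \in E)) => [eE|_]; last by exists (true, (0, 0)).
  case: model => _ _ _ /(_ e eE) [u [v [p [q [-> pq bp bq]]]]].
  exists (edge_of p q) => _; case: (edge_of_ends pq) => -[Es Et].
    by exists u, v; rewrite Es Et.
  by exists v, u; rewrite Es Et edC.
by exists a.
Qed.

Section WithCrossings.
Variable a : {set T} -> gedge.
Hypothesis aE : forall e, e \in E -> crosses e (a e).

Lemma br_eq u v p : br u p -> br v p = (v == u).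
Proof. by move=> bu; apply/idP/eqP => [/(disj bu)|->]. Qed.

Lemma cross_mem e v : e \in E -> br v (esrc (a e)) (+) br v (etgt (a e)) = (v \in e).
Proof.
move=> eE; have [u [w [Ee bu bw]]] := aE eE.
have uw : u != w by apply: (@two_unif_ed _ E) => //; rewrite -Ee.
by rewrite (br_eq _ bu) (br_eq _ bw) Ee odd_ed.
Qed.

Lemma a_inj : {in E &, injective a}.
Proof.
move=> e e' eE e'E Ea; apply/setP => v.
by rewrite -(cross_mem v eE) -(cross_mem v e'E) Ea.
Qed.

Definition inner_edge d := [exists v, br v (esrc d) && br v (etgt d)].

Lemma inner_cross e d : e \in E -> inner_edge d -> a e != d.
Proof.
move=> eE /existsP [v /andP [b1 b2]]; apply/eqP => Ea; rewrite -Ea in b1 b2.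
have [u [w [Ee bu bw]]] := aE eE.
have : u != w by apply: (@two_unif_ed _ E) => //; rewrite -Ee.
by rewrite (disj bu b1) (disj bw b2) eqxx.
Qed.

(* Edges inside a branch set are contracted, the edges a e survive, and all others
   are deleted: the squares on both sides of a deleted edge are merged. *)
Definition kept d := inner_edge d || [exists e in E, a e == d].

Let Q : finType := ('I_M * 'I_M)%type.
Let corner (q : Q) : pt := (q.1 : nat, q.2 : nat).

(** Excludes edges along an axis, whose two squares coincide by truncated subtraction. *)
Definition proper (d : gedge) := if d.1 then 0 < d.2.1 else 0 < d.2.2.

Let dadj (q q' : Q) := [exists x : bool * Q, let d := (x.1, corner x.2) in
   [&& ~~ kept d, proper d, sq1 d == corner q & sq2 d == corner q']].
Let sadj q q' := dadj q q' || dadj q' q.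

Lemma corner_inj : injective corner.
Proof. by move=> [i j] [k l] [/val_inj -> /val_inj ->]. Qed.

Lemma sadj_csym : connect_sym sadj.
Proof. by apply: sym_connect_sym => q q'; rewrite /sadj orbC. Qed.

Definition region (q : Q) := [set q' | connect sadj q q'].
Definition regions := [set region q | q in Q].

Lemma mem_region phi q : phi \in regions -> (q \in phi) = (phi == region q).
Proof.
case/imsetP => q0 _ ->; rewrite inE; apply/idP/eqP => [c|E'].
  by apply/setP => q'; rewrite !inE (same_connect sadj_csym c).
have : q \in region q by rewrite inE connect0.
by rewrite -E' inE.
Qed.

Lemma region_in q : region q \in regions. Proof. by apply/imsetP; exists q. Qed.

Definition chi (phi : {set Q}) (p : pt) := [exists q in phi, corner q == p].

Lemma chi_corner phi q : chi phi (corner q) = (q \in phi).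
Proof.
apply/exists_inP/idP => [[q' q'p /eqP /corner_inj <-] //|qp]; by exists q.
Qed.

Definition inbox (p : pt) := (p.1 < M) && (p.2 < M).

Lemma inboxP p : inbox p -> exists q, corner q = p.
Proof.
by case: p => i j /andP [/= iM jM]; exists (Ordinal iM, Ordinal jM).
Qed.

Lemma sq1_inbox d : inbox d.2 -> inbox (sq1 d).
Proof.
case: d => [[] [i j]] /= /andP [/= h1 h2]; rewrite /inbox /sq1 /=; lia.
Qed.

Lemma chi_unkept phi d : phi \in regions -> inbox d.2 -> proper d -> ~~ kept d ->
  chi phi (sq1 d) = chi phi (sq2 d).
Proof.
move=> ph bx pd kd; have [q2 E2'] := inboxP bx; have [q1 E1] := inboxP (sq1_inbox bx).
rewrite /sq2 -E1 -E2' !chi_corner !mem_region //; congr (_ == _).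
have s : sadj q1 q2.
  apply/orP; left; apply/existsP; exists (d.1, q2); rewrite /= E2' -surjective_pairing kd pd E1.
  by rewrite /sq2 !eqxx.
by apply/setP => q; rewrite !inE (same_connect sadj_csym (connect1 s)).
Qed.

Lemma crossing_box e : e \in E -> inbox (a e).2 /\ proper (a e).
Proof.
case/aE => u [v [_ /box []]]; rewrite /esrc => /andP [h1 h2] /andP [h3 h4] _.
by rewrite /inbox h2 h4 /proper; case: ifP.
Qed.

(** The index type contains all sets of squares; those that are not regions give the empty face. An
    edge with the same region on both sides, such as a bridge, lies on no face. *)
Definition face (phi : {set Q}) : {set {set T}} :=
  if phi \in regions then [set e in E | chi phi (sq1 (a e)) (+) chi phi (sq2 (a e))] else set0.

Lemma crossing_sides e : e \in E -> exists q1 q2, corner q1 = sq1 (a e) /\ corner q2 = sq2 (a e).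
Proof.
move=> /crossing_box [bx _]; have [q2 E2'] := inboxP bx.
by have [q1 E1] := inboxP (sq1_inbox bx); exists q1, q2.
Qed.

Lemma face_cover phi e : e \in face phi -> #|[set psi | e \in face psi]| = 2.
Proof.
rewrite /face; case: ifP => [ph|_]; last by rewrite inE.
rewrite inE => /andP [eE]; have [q1 [q2 [E1 E2']]] := crossing_sides eE.
rewrite -E1 -E2' !chi_corner !mem_region // => h.
have ne : region q1 != region q2 by apply: contraL h => /eqP ->; rewrite addbb.
rewrite (_ : [set _ | _] = [set region q1; region q2]); first by rewrite cards2 ne.
apply/setP => psi; rewrite in_set in_set2 /face; case: ifP => ps.
  rewrite inE eE -E1 -E2' !chi_corner !mem_region //=.
  by case: eqP => [->|_] /=; rewrite ?(negPf ne) // addFb.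
rewrite in_set0; apply/esym/negP => /orP [] /eqP E'; by rewrite E' region_in in ps.
Qed.

(** Pairs the coboundary of the branch set of v with the boundary of the region. An edge inside a
    branch set drops out of the first factor and a deleted edge out of the second; the surviving
    edges count the degree of v in the face. *)
Lemma face_even phi : even_set (face phi).
Proof.
rewrite /face; case: ifP => ph; last by apply/even_setP => v; rewrite degz0.
apply/even_setP => v; rewrite odd_degz.
have al0 i j : 0 < i < M /\ 0 < j < M \/ br v (i, j) = false.
  by case: (boolP (br v (i, j))) => [/box|_]; [left|right].
have bp := boundary_pairing (chi phi) al0; rewrite !pair_big /= in bp.
apply: etrans bp; symmetry.
under eq_bigr => x _.
  rewrite (_ : _ && _ = \big[addb/false]_e
     ((e \in [set e in E | chi phi (sq1 (a e)) (+) chi phi (sq2 (a e))]) && (v \in e) &&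
      (a e == (x.1.1, (x.1.2 : nat, x.2 : nat))))); last first.
    case: x => [[b i] j] /=; set d := (b, _).
    have bx : inbox d.2 by rewrite /inbox /= !ltn_ord.
    have [/existsP [e0 /andP [e0E /eqP ae]]|no] := boolP [exists e in E, a e == d].
      rewrite (bigD1 e0) //= big1 ?addbF; last first.
        move=> e ne; rewrite inE; case: (boolP (e \in E)) => //= eE.
        apply/negP => /andP [_ /eqP ae'].
        by case/negP: ne; apply/eqP/a_inj; rewrite ?ae.
      by rewrite inE e0E -(cross_mem v e0E) ae eqxx andbT /= andbC.
    rewrite big1; last first.
      move=> e _; rewrite inE; case: (boolP (e \in E)) => //= eE; apply/negP => /andP [_ ae].
      by case/negP: no; apply/existsP; exists e; rewrite eE.
    apply/negP => /andP [A X].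
    have nin : ~~ inner_edge d.
      apply: contraL A => /existsP [w /andP [b1 b2]].
      by rewrite (br_eq _ b1) (br_eq _ b2) addbb.
    have nk : ~~ kept d by rewrite /kept negb_or nin no.
    suff pd : proper d by move: X; rewrite (chi_unkept ph bx pd nk) addbb.
    have : br v (esrc d) || br v (etgt d) by move: A; case: (br v _).
    rewrite /proper /d /esrc /etgt /=.
    by case: b {d bx no A X nin nk} => /= /orP [] /box [] /andP [? ?] /andP [].
  over.
rewrite exchange_big /=; apply: eq_bigr => e _.
case: (boolP (e \in E)) => eE; last by rewrite inE (negPf eE) /= big1.
have [/andP [/= h1 h2] _] := crossing_box eE.
rewrite (bigD1 ((a e).1, Ordinal h1, Ordinal h2)) //= big1 ?addbF.
  by rewrite -[(_, (_, _))]/((a e).1, ((a e).2.1, (a e).2.2)) -!surjective_pairing eqxx andbT.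
move=> [[b i] j] ne; apply/negP => /andP [_ /eqP ae]; case/negP: ne.
rewrite !xpair_eqE -!val_eqE /=.
by rewrite ae /= !eqxx.
Qed.

(** Lifts e to the grid: from the root of one end through its branch set to the crossing, then on to
    the root of the other end. As all lifts end at roots, the lifts of an even set add up to a
    cycle. *)
Lemma chain_exists e : e \in E -> exists c : gedge -> bool,
  [/\ forall i j, bdry c i j = \big[addb/false]_v ((v \in e) && ((i.+1, j.+1) == rho v)),
      forall d, c d -> kept d, forall d, d.2.1 = 0 -> c d = false
    & forall e', e' \in E -> c (a e') = (e' == e)].
Proof.
move=> eE; have [u [w [Ee bu bw]]] := aE eE.
have uw : u != w by apply: (@two_unif_ed _ E) => //; rewrite -Ee.
have [s1 [p1 l1 b1]] := conn bu; have [s2 [p2 l2 b2]] := conn bw.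
have w1 d : walk_chain (rho u) s1 d -> inner_edge d.
  by move=> h; apply/existsP; exists u; apply: walk_chain_in p1 b1 h.
have w2 d : walk_chain (rho w) s2 d -> inner_edge d.
  by move=> h; apply/existsP; exists w; apply: walk_chain_in p2 b2 h.
exists (fun d => walk_chain (rho u) s1 d (+) ((a e == d) (+) walk_chain (rho w) s2 d)); split.
- move=> i j; rewrite !bdry_add bdry_single !bdry_walk_chain // l1 l2.
  have wu : w != u by rewrite eq_sym.
  rewrite (bigD1 u) //= (bigD1 w) //= big1 ?addbF; last first.
    by move=> v /andP [vu vw]; rewrite Ee in_ed (negPf vu) (negPf vw).
  rewrite Ee !in_ed !eqxx orbT /=.
  by case: (_ == rho u); case: (_ == rho w); case: (_ == esrc _); case: (_ == etgt _).
- move=> d; rewrite /kept; case: (boolP (inner_edge d)) => //= ni.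
  rewrite (negPf (contra (@w1 d) ni)) (negPf (contra (@w2 d) ni)) addbF /= => ae.
  by apply/existsP; exists e; rewrite eE.
- move=> d d0; have ni : inner_edge d = false.
    by apply/negbTE/negP => /existsP [v /andP [/box []]]; rewrite /esrc d0.
  rewrite (negPf (contraFN (@w1 d) ni)) (negPf (contraFN (@w2 d) ni)) addbF /=.
  by apply/eqP => ae; have [] := box bu; rewrite /esrc ae d0.
- move=> e' e'E; have ni : ~~ inner_edge (a e').
    by apply/negP => h; have := inner_cross e'E h; rewrite eqxx.
  rewrite (negPf (contra (@w1 _) ni)) (negPf (contra (@w2 _) ni)) addbF /= eq_sym.
  by apply/eqP/eqP => [/a_inj ->|->].
Qed.

(** The lift of z is a cycle of kept edges, so its potential is constant on each region. The regions
    of odd potential are the required faces: at [a e] the potential jumps exactly when e belongs to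
    z. *)
Lemma face_span (z : {set {set T}}) : z \subset E -> even_set z -> exists J, z = ssum face J.
Proof.
move=> zE /even_setP ez.
have [|ch hch] := @fin_all_exists {set T} (fun _ => gedge -> bool) (fun e c => e \in E ->
  [/\ forall i j, bdry c i j = \big[addb/false]_v ((v \in e) && ((i.+1, j.+1) == rho v)),
      forall d, c d -> kept d, forall d, d.2.1 = 0 -> c d = false
    & forall e', e' \in E -> c (a e') = (e' == e)]).
  move=> e; case: (boolP (e \in E)) => [/chain_exists [c hc]|_]; first by exists c.
  by exists (fun _ => false).
pose c d := \big[addb/false]_(e in z) ch e d.
have c0 d : d.2.1 = 0 -> c d = false.
  by move=> d0; rewrite /c big1 // => e /(subsetP zE) /hch [_ _ -> //].
have cyc i j : bdry c i j = false.
  rewrite /c bdry_sum; under eq_bigr => e ze.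
    have [-> _ _ _] := hch e (subsetP zE _ ze); over.
  rewrite exchange_big big1 //= => v _.
  transitivity (odd (degz z v) && ((i.+1, j.+1) == rho v)); last by rewrite ez.
  rewrite odd_degz big_distrl big_mkcond; apply: eq_bigr => e _.
  by case: (e \in z) => //=; rewrite andbC.
have ck d : c d -> kept d.
  apply: contraTT => nk; apply/negPf; rewrite /c big1 // => e /(subsetP zE) /hch [_ h _ _].
  by apply/negP => /h; rewrite (negPf nk).
have ca e : e \in E -> c (a e) = (e \in z).
  move=> eE; rewrite /c; case: (boolP (e \in z)) => ze; last first.
    rewrite big1 // => e' e'z; have [_ _ _ ->] := hch e' (subsetP zE _ e'z) => //.
    by apply/eqP => E'; rewrite E' e'z in ze.
  rewrite (bigD1 e) //= big1 ?addbF.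
    by have [_ _ _ -> //] := hch e eE; rewrite eqxx.
  move=> e' /andP [e'z ne]; have [_ _ _ ->] := hch e' (subsetP zE _ e'z) => //.
  by rewrite eq_sym (negPf ne).
pose W := potential c.
have Wadj q q' : sadj q q' -> W (corner q) = W (corner q').
  suff h q1 q2 : dadj q1 q2 -> W (corner q1) = W (corner q2) by case/orP => /h.
  case/existsP => x /and4P [nk pd /eqP <- /eqP <-].
  have := potential_sides c0 cyc pd; rewrite (negPf (contra (@ck _) nk)).
  by rewrite -/W; case: (W _); case: (W _).
have Wconn q q' : connect sadj q q' -> W (corner q) = W (corner q').
  by case/connectP => s; elim: s q => [q _ -> //|q1 s IH q /= /andP [/Wadj -> ps]]; apply: IH.
pose J := [set phi in regions | [exists q in phi, W (corner q)]].
exists J; apply/setP => e; rewrite in_ssum.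
case: (boolP (e \in E)) => eE; last first.
  rewrite (negPf (contra (subsetP zE e) eE)) big1 // => phi _; rewrite /face.
  by case: ifP => _; rewrite inE // (negPf eE).
have [q1 [q2 [E1 E2']]] := crossing_sides eE; have [_ pd] := crossing_box eE.
rewrite -ca // -(potential_sides c0 cyc pd) -/W -E1 -E2'.
have sJ q : \big[addb/false]_(phi in J) (q \in phi) = W (corner q).
  transitivity (region q \in J).
    rewrite big_mkcond (bigD1 (region q)) //= big1 ?addbF.
      by case: ifP => //; rewrite mem_region ?region_in // eqxx.
    move=> phi ne; case: ifP => //; rewrite inE => /andP [ph _].
    by rewrite mem_region // (negPf ne).
  rewrite inE region_in /=; apply/exists_inP/idP => [[q']|Wq].
    by rewrite inE => /Wconn ->.
  by exists q; rewrite // inE connect0.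
rewrite -!sJ -big_split; apply: eq_bigr => phi; rewrite inE => /andP [ph _].
by rewrite /face ph inE eE /= -E1 -E2' !chi_corner.
Qed.

Lemma face_two_basis : two_basis E face.
Proof.
split; [|exact: face_even|exact: face_cover|exact: face_span].
move=> phi; rewrite /face; case: ifP => _; last exact: sub0set.
by apply/subsetP => e; rewrite inE => /andP [].
Qed.

End WithCrossings.

Lemma grid_two_basis : exists (I : finType) (B : I -> {set {set T}}), two_basis E B.
Proof.
by have [a aE] := crossing_exists; exists {set 'I_M * 'I_M}, (face a); apply: face_two_basis.
Qed.

End Minor.

Require Import Defs.
From mathcomp Require Import all_boot all_order all_algebra.
From mathcomp Require Import all_classical all_reals all_analysis.
From mathcomp Require Import ring lra.
Import Order.TTheory GRing.Theory Num.Theory.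
Import numFieldNormedType.Exports.

(** * From drawings to grid minors *)

Inductive reach (A : pt -> Prop) (p : pt) : pt -> Prop :=
| reach_refl : A p -> reach A p p
| reach_step q r : reach A p q -> gadj q r -> A r -> reach A p r.

Lemma gadj_sym p q : gadj p q -> gadj q p.
Proof. by case/existsP => b h; apply/existsP; exists b; rewrite orbC. Qed.

Lemma reach_in A p q : reach A p q -> A p /\ A q.
Proof. by elim=> [//|q' r _ [Ap _] _ Ar]. Qed.

Lemma reach_trans A p q r : reach A p q -> reach A q r -> reach A p r.
Proof. by move=> pq; elim=> // x y _ px xy Ay; apply: reach_step px xy Ay. Qed.

Lemma reach_sym A p q : reach A p q -> reach A q p.
Proof.
elim=> [|x y px xp xy Ay]; first exact: reach_refl.
have [_ Ax] := reach_in px.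
apply: reach_trans xp; apply: reach_step (gadj_sym xy) Ax; exact: reach_refl.
Qed.

Lemma reach_sub (A C : pt -> Prop) p q : (forall x, A x -> C x) -> reach A p q -> reach C p q.
Proof.
move=> AC; elim=> [/AC|x y _ px xy /AC]; [exact: reach_refl|exact: reach_step px xy].
Qed.

Lemma reach_path (A : pt -> Prop) p q : reach A p q ->
  exists s, [/\ path gadj p s, last p s = q & forall x, x \in p :: s -> reach A p x].
Proof.
elim=> [Ap|x y px [s [ps ls hs]] xy Ay].
  by exists [::]; split=> // x; rewrite inE => /eqP ->; apply: reach_refl.
exists (rcons s y); split; [by rewrite rcons_path ps ls xy|by rewrite last_rcons|].
move=> z; rewrite -rcons_cons mem_rcons inE => /orP [/eqP ->|/hs //].
exact: reach_step px xy Ay.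
Qed.

Definition near1 (p q : pt) :=
  [&& p.1 <= q.1.+1, q.1 <= p.1.+1, p.2 <= q.2.+1 & q.2 <= p.2.+1].

Lemma near1_refl p : near1 p p. Proof. by rewrite /near1 !leqnSn. Qed.

Lemma leqSP m n : m <= n.+1 -> n <= m.+1 -> [\/ m = n, m = n.+1 | n = m.+1].
Proof.
rewrite leq_eqVlt => /orP [/eqP ->|]; first by constructor 2.
rewrite ltnS => mn; rewrite leq_eqVlt => /orP [/eqP ->|]; first by constructor 3.
by rewrite ltnS => nm; constructor 1; apply/eqP; rewrite eqn_leq mn nm.
Qed.

(** A diagonal step is replaced by two grid steps around a corner, which lies in A because the whole
    3 by 3 block of p does. *)
Lemma near1_step (A : pt -> Prop) o p q : (forall x, near1 x p -> A x) -> near1 q p ->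
  reach A o p -> reach A o q.
Proof.
case: p q => [i j] [k l] hA /and4P [/= h1 h2 h3 h4] op.
have ok : reach A o (k, j).
  have Akj : A (k, j) by apply: hA; rewrite /near1 /= h1 h2 leqnSn.
  case: (leqSP h1 h2) => E; first by rewrite E.
    by apply: reach_step op _ Akj; apply/existsP; exists false; rewrite /etgt /= E eqxx.
  by apply: reach_step op _ Akj; apply/existsP; exists false; rewrite /etgt /= E eqxx orbT.
have Akl : A (k, l) by apply: hA; rewrite /near1 /= h1 h2 h3 h4.
case: (leqSP h3 h4) => E; first by rewrite E.
  by apply: reach_step ok _ Akl; apply/existsP; exists true; rewrite /etgt /= E eqxx.
by apply: reach_step ok _ Akl; apply/existsP; exists true; rewrite /etgt /= E eqxx orbT.
Qed.

Local Open Scope ring_scope.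

(** * Continuity and compactness of curves *)

Section Arcs.
Variable R : realType.
Implicit Types (s t : R) (g : R -> R * R).

(** Extends a curve on [0, 1] by constants, so that continuity and connectedness can be used on the
    whole line. *)
Definition clamp t : R := Num.max 0 (Num.min 1 t).

Lemma clamp_ge0 t : 0 <= clamp t. Proof. by rewrite /clamp le_max lexx. Qed.
Lemma clamp_le1 t : clamp t <= 1. Proof. by rewrite /clamp ge_max ler01 ge_min lexx. Qed.

Lemma clamp_id t : 0 <= t <= 1 -> clamp t = t.
Proof. by case/andP => t0 t1; rewrite /clamp min_r // max_r. Qed.

Lemma clamp_cont : continuous clamp.
Proof.
move=> t; apply: (@continuous_max _ _ (fun=> 0) (fun t => Num.min 1 t)); first exact: cvg_cst.
by apply: (@continuous_min _ _ (fun=> 1) id); [exact: cvg_cst|exact: cvg_id].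
Qed.

Lemma continuous_within_comp (f : R -> R * R) (h : R -> R) :
  {within `[0, 1], continuous f}%classic -> continuous h -> (forall t, 0 <= h t <= 1) ->
  continuous (f \o h).
Proof.
move=> /subspace_continuousP cf ch h01 t.
have ht : (`[0, 1]%classic : set R) (h t) by rewrite /= in_itv /= h01.
move=> U /(cf _ ht); rewrite /= !nbhs_simpl /= => fU.
have := ch t _ fU; rewrite /= !nbhs_simpl /=; apply: filterS => s; apply.
by rewrite /= in_itv /= h01.
Qed.

Lemma piece_bounded g : continuous g -> (forall t, g t = g (clamp t)) ->
  exists L : nat, forall t, `|g t| <= L%:R.
Proof.
move=> cg gc.
have [||c _ hc] := @compact_EVT_max R R (fun t => `|g t|) `[0, 1]%classic _
  (@segment_compact _ 0 1).
- by exists 0; rewrite /= in_itv /= lexx ler01.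
- apply: continuous_subspaceT => t; apply: cvg_norm; exact: cg.
exists (Num.truncn `|g c|).+1 => t; apply: le_trans (ltW (truncnS_gt _)).
by rewrite gc; apply: hc; rewrite inE /= in_itv /= clamp_ge0 clamp_le1.
Qed.

(** By compactness the distance of the two curves has a positive minimum. The constant 3 serves
    [tube_disjoint]: points whose 3 by 3 blocks meet are less than three grid units apart. *)
Lemma piece_separated g1 g2 : continuous g1 -> continuous g2 ->
  (forall t, g1 t = g1 (clamp t)) -> (forall t, g2 t = g2 (clamp t)) ->
  (forall s t, g1 s <> g2 t) ->
  exists N : nat, forall s t, 3 < N%:R * `|g1 s - g2 t|.
Proof.
move=> c1 c2 k1 k2 ne.
have [||[c d] _ hc] := @compact_EVT_min (R * R)%type R (fun p => `|g1 p.1 - g2 p.2|)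
   (`[0, 1] `*` `[0, 1])%classic _
   (compact_setX (@segment_compact _ 0 1) (@segment_compact _ 0 1)).
- by exists (0, 0); split; rewrite /= in_itv /= lexx ler01.
- apply: continuous_subspaceT => -[x y]; apply: cvg_norm; apply: cvgB.
    apply: (@continuous_comp _ _ _ fst g1); [exact: cvg_fst|exact: c1].
  apply: (@continuous_comp _ _ _ snd g2); [exact: cvg_snd|exact: c2].
have pos : 0 < `|g1 c - g2 d| by rewrite normr_gt0 subr_eq0; apply/eqP/ne.
exists (Num.truncn (3 / `|g1 c - g2 d|)).+1 => s t.
rewrite -ltr_pdivrMr; last by rewrite normr_gt0 subr_eq0; apply/eqP/ne.
apply: le_lt_trans (truncnS_gt _).
have le : `|g1 c - g2 d| <= `|g1 s - g2 t|.
  rewrite (k1 s) (k2 t); apply: (hc (clamp s, clamp t)); rewrite inE /=.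
  by split; rewrite /= in_itv /= clamp_ge0 clamp_le1.
by rewrite ler_pM2l // lef_pV2 // posrE ?pos // (lt_le_trans pos).
Qed.

(** Induction along the line: P is locally constant, so it holds on an open and closed set, and the
    line is connected. *)
Lemma real_clopen (P : R -> Prop) t0 : P t0 ->
  (forall t, exists2 e : R, 0 < e & forall s s', `|s - t| < e -> `|s' - t| < e -> P s -> P s') ->
  forall t, P t.
Proof.
move=> P0 loc.
have cT : connected [set: R]%classic by apply/connected_intervalP.
suff : [set t | P t]%classic = [set: R]%classic
  by move=> E t; have : [set: R]%classic t by []; rewrite -E.
apply: cT; first by exists t0.
- exists [set t | P t]%classic; last by rewrite setTI.
  rewrite openE => t /= Pt; have [e e0 he] := loc t.
  apply/nbhs_ballP; exists e => //= s; rewrite /ball /= distrC => st.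
  by apply: (he t s) => //; rewrite subrr normr0.
- exists [set t | P t]%classic; last by rewrite setTI.
  rewrite -[X in closed X]setCK; apply: open_closedC; rewrite openE => t /= nPt.
  have [e e0 he] := loc t; apply/nbhs_ballP; exists e => //= s; rewrite /ball /= distrC => st Ps.
  by apply: nPt; apply: (he s t) => //; rewrite subrr normr0.
Qed.

End Arcs.

Lemma scaled_ge3 (R : realType) (n y : R) : 1 <= n -> 0 <= y -> 3 <= n * (y + 3).
Proof. intros; nra. Qed.

Lemma scaled_lt (R : realType) (n y l : R) :
  1 <= n -> y <= 2 * l -> n * (y + 3) < n * (2 * l + 3) + 1.
Proof. intros; nra. Qed.

Lemma scaled_step (R : realType) (n x y d c l : R) : 1 <= n -> n * d < 1 -> x - y <= d ->
  n * (y + l + 3) < c + 1 -> n * (x + l + 3) < c + 1 + 1.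
Proof. intros; nra. Qed.

Lemma scaled_gap (R : realType) (n u v a b l : R) : 1 <= n -> a <= b + 1 + 1 ->
  n * (u + l + 3) < a + 1 -> b <= n * (v + l + 3) -> n * (u - v) < 3.
Proof. intros; nra. Qed.

(** * Tracing a curve on the grid *)

Section Grid.
Variables (R : realType) (N L : nat).
Hypothesis N1 : (0 < N)%N.
Implicit Types (x y : R) (g : R -> R * R).

(* For |x| <= L the shift keeps the coordinate at least 3, so that the grid points
   next to a traced point stay off the axes. *)
Definition coord x : nat := Num.truncn (N%:R * (x + L%:R + 3)).
Definition rho (P : R * R) : pt := (coord P.1, coord P.2).

Let N1' : 1 <= N%:R :> R. Proof. by rewrite ler1n. Qed.

Lemma coord_bound x : `|x| <= L%:R -> (3 <= coord x <= N * (2 * L + 3))%N.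
Proof.
rewrite ler_norml => /andP [x1 x2]; have L0 : 0 <= L%:R :> R by [].
have ge3 : 3 <= N%:R * (x + L%:R + 3) by apply: scaled_ge3 => //; lra.
apply/andP; split; first by rewrite truncn_ge_nat //; lra.
rewrite truncn_le_nat -(natr1 (N * (2 * L + 3))%N) natrM natrD natrM; apply: scaled_lt => //; lra.
Qed.

Lemma coord_near x y : N%:R * `|x - y| < 1 -> (coord x <= (coord y).+1)%N.
Proof.
move=> h; rewrite truncn_le_nat -(natr1 (coord y).+1) -(natr1 (coord y)).
apply: (scaled_step N1' h (ler_norm _)).
by have := truncnS_gt (N%:R * (y + L%:R + 3)); rewrite -/(coord y) -(natr1 (coord y)).
Qed.

Lemma coord_sep x y : `|x| <= L%:R -> `|y| <= L%:R -> (coord x <= (coord y).+2)%N ->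
  (coord y <= (coord x).+2)%N -> N%:R * `|x - y| < 3.
Proof.
have key u v : `|v| <= L%:R -> (coord u <= (coord v).+2)%N -> N%:R * (u - v) < 3.
  move=> hv; rewrite -(ler_nat R) -(natr1 (coord v).+1) -(natr1 (coord v)) => cuv.
  have h1 := truncnS_gt (N%:R * (u + L%:R + 3)); rewrite -/(coord u) -(natr1 (coord u)) in h1.
  apply: (scaled_gap N1' cuv h1); rewrite truncn_le; move: hv; rewrite ler_norml => /andP [x1 x2].
  by apply: le_trans (scaled_ge3 (y := v + L%:R) N1' _); lra.
move=> hx hy xy yx; have := key _ _ hy xy; have := key _ _ hx yx.
by case: (lerP 0 (x - y)) => s; rewrite ?(ger0_norm s) ?(ltr0_norm s) // opprB.
Qed.

Lemma normP (P : R * R) : `|P| = Num.max `|P.1| `|P.2|.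
Proof. by rewrite prod_normE. Qed.

Lemma norm1_le (P : R * R) : `|P.1| <= `|P|. Proof. by rewrite normP le_max lexx. Qed.
Lemma norm2_le (P : R * R) : `|P.2| <= `|P|. Proof. by rewrite normP le_max lexx orbT. Qed.

(** The 3 by 3 blocks allow consecutive traced points to be diagonal neighbours and still be joined
    by grid steps within the tube. *)
Definition tube g (q : pt) : Prop := exists t, near1 q (rho (g t)).

Lemma tube_box g q : (forall t, `|g t| <= L%:R) -> tube g q ->
  (0 < q.1 < N * (2 * L + 3) + 2 /\ 0 < q.2 < N * (2 * L + 3) + 2)%N.
Proof.
move=> gL [t /and4P [/= a1 a2 a3 a4]].
have /andP [b1 b2] := coord_bound (le_trans (norm1_le _) (gL t)).
have /andP [b3 b4] := coord_bound (le_trans (norm2_le _) (gL t)).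
split; apply/andP; split.
- by rewrite -ltnS; apply: leq_trans a2; apply: leq_trans b1.
- by rewrite addn2 ltnS; apply: leq_trans a1 _; rewrite ltnS.
- by rewrite -ltnS; apply: leq_trans a4; apply: leq_trans b3.
- by rewrite addn2 ltnS; apply: leq_trans a3 _; rewrite ltnS.
Qed.

Lemma tube_disjoint g1 g2 q : (forall t, `|g1 t| <= L%:R) -> (forall t, `|g2 t| <= L%:R) ->
  (forall s t, 3 < N%:R * `|g1 s - g2 t|) -> tube g1 q -> tube g2 q -> False.
Proof.
move=> L1 L2 sep [s /and4P [/= a1 a2 a3 a4]] [t /and4P [/= b1 b2 b3 b4]].
have := sep s t; apply/negP; rewrite -leNgt normP maxr_pMr // ge_max /=.
have c1 := coord_sep (le_trans (norm1_le _) (L1 s)) (le_trans (norm1_le _) (L2 t)).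
have c2 := coord_sep (le_trans (norm2_le _) (L1 s)) (le_trans (norm2_le _) (L2 t)).
apply/andP; split; apply: ltW.
  by apply: c1; [apply: leq_trans a2 _|apply: leq_trans b2 _].
by apply: c2; [apply: leq_trans a4 _|apply: leq_trans b4 _].
Qed.

Lemma tube_reach g q : continuous g -> (forall t, `|g t| <= L%:R) -> tube g q ->
  reach (tube g) (rho (g 0)) q.
Proof.
move=> cg gL [t0 nt].
have tg t (x : pt) : near1 x (rho (g t)) -> tube g x by exists t.
apply: (@near1_step _ _ (rho (g t0))) => //; first exact: tg.
move: t0 {nt}; apply: (@real_clopen R _ 0).
  by apply: reach_refl; apply: (tg 0); apply: near1_refl.
(* Half a grid unit around t puts any two parameters near t within one unit of each other, so their
   traced points differ by at most one in each coordinate. *)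
move=> t; have N0 : 0 < 2^-1 / N%:R :> R by rewrite divr_gt0 ?invr_gt0 // ltr0n.
have /nbhs_ballP [e /= e0 he] : nbhs t [set s | `|g t - g s| < 2^-1 / N%:R]%classic.
  by have /cvgrPdist_lt := cg t; apply.
exists e => // s s' hs hs' Ps.
have cl u : `|u - t| < e -> N%:R * `|g t - g u| < 2^-1.
  move=> hu; have : `|g t - g u| < 2^-1 / N%:R by apply: he; rewrite /ball /= distrC.
  by rewrite ltr_pdivlMr ?ltr0n // mulrC.
have d : N%:R * `|g s - g s'| < 1.
  have tri : `|g s - g s'| <= `|g t - g s| + `|g t - g s'|.
    rewrite (_ : g s - g s' = (g s - g t) + (g t - g s')); last by rewrite addrA subrK.
    by apply: le_trans (ler_normD _ _) _; rewrite (distrC (g s)).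
  have := cl s hs; have := cl s' hs'; move: tri N1'.
  move: `|g s - g s'| `|g t - g s| `|g t - g s'| => a b c; nra.
have dc u v : N%:R * `|g u - g v| < 1 ->
    (coord (g u).1 <= (coord (g v).1).+1)%N /\ (coord (g u).2 <= (coord (g v).2).+1)%N.
  move=> h; split; apply: coord_near; apply: le_lt_trans h; rewrite ler_pM2l ?ltr0n //.
    exact: (norm1_le (g u - g v)).
  exact: (norm2_le (g u - g v)).
apply: near1_step Ps; first exact: tg.
have [h1 h2] := dc _ _ d; rewrite distrC in d; have [h3 h4] := dc _ _ d.
by rewrite /near1 /= h1 h2 h3 h4.
Qed.

End Grid.

(** * Branch sets from a plane drawing *)

Section Drawing.
Variables (R : realType) (T : finType) (G : sgraph T).
Variables (pos : T -> R * R) (arc : {set T} -> R -> R * R).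
Hypothesis posI : injective pos.
Hypothesis arcP : forall e, e \in edges G ->
  is_arc (arc e) /\ [set arc e 0; arc e 1]%classic = (pos @` [set` e])%classic.
Hypothesis arc_pos : forall e v (t : R), e \in edges G -> 0 < t < 1 -> arc e t <> pos v.
Hypothesis arc_arc : forall e e' (s t : R), e \in edges G -> e' \in edges G -> e != e' ->
        0 < s < 1 -> 0 <= t <= 1 -> arc e s <> arc e' t.

Lemma edges_two_unif : two_unif (edges G).
Proof. exact: (valP G). Qed.

Definition ends e u v := [/\ e = ed u v, arc e 0 = pos u & arc e 1 = pos v].

Lemma arc_inj e s t : e \in edges G -> 0 <= s <= 1 -> 0 <= t <= 1 -> arc e s = arc e t -> s = t.
Proof.
move=> /arcP [[_ inj] _] hs ht E; apply: inj E; by rewrite in_itv.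
Qed.

Lemma ends_exist e : e \in edges G -> exists u v, ends e u v.
Proof.
move=> eE; have [_ E] := arcP eE.
have [u ue Eu] : (pos @` [set` e])%classic (arc e 0) by rewrite -E; left.
have [v ve Ev] : (pos @` [set` e])%classic (arc e 1) by rewrite -E; right.
exists u, v; split=> //; rewrite /= in ue ve.
have uv : u != v.
  apply/eqP => E'; have : 0 = 1 :> R.
    by apply: (arc_inj eE); rewrite ?lexx ?ler01 // -Eu -Ev E'.
  by move/esym/eqP; rewrite oner_eq0.
apply/esym/eqP; rewrite eqEcard finset.subUset !finset.sub1set ue ve /=.
by rewrite (two_unifP _ edges_two_unif _ eE) card_ed uv.
Qed.

Lemma ends_inj e u v u' v' : ends e u v -> ends e u' v' -> u = u' /\ v = v'.
Proof. by case=> [_ E0 E1] [_ E0' E1']; split; apply: posI; rewrite -?E0 -?E1. Qed.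

Lemma ends_neq e u v : e \in edges G -> ends e u v -> u != v.
Proof. by move=> eE [E _ _]; apply: (two_unif_ed edges_two_unif); rewrite -E. Qed.

Definition piece_index : finType := (T + {set T} * 'I_3)%type.

Definition piece (p : piece_index) : R -> R * R :=
  match p with
  | inl v => fun=> pos v
  | inr (e, k) => if e \in edges G then fun t => arc e (((k : nat)%:R + clamp t) / 3) else fun=> 0
  end.

Lemma param01 (k : 'I_3) (t : R) : 0 <= ((k : nat)%:R + clamp t) / 3 <= 1.
Proof.
have := clamp_ge0 t; have := clamp_le1 t.
have : (k : nat)%:R <= 2 :> R by rewrite (ler_nat R _ 2) -ltnS.
have : 0 <= (k : nat)%:R :> R by [].
by move: (k : nat)%:R (clamp t) => x y *; apply/andP; split; lra.
Qed.

Lemma piece_cont p : continuous (piece p).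
Proof.
case: p => [v|[e k]] /=; first by move=> ?; apply: cvg_cst.
case: (boolP (e \in edges G)) => [eE|_]; last by move=> ?; apply: cvg_cst.
have [[ce _] _] := arcP eE.
apply: (continuous_within_comp ce); last exact: param01.
move=> t; apply: cvgMl; apply: cvgD; [exact: cvg_cst|exact: clamp_cont].
Qed.

Lemma clampK (t : R) : clamp (clamp t) = clamp t.
Proof. by rewrite clamp_id // clamp_ge0 clamp_le1. Qed.

Lemma piece_clamp p t : piece p t = piece p (clamp t).
Proof. by case: p => [v|[e k]] //=; case: ifP => // _; rewrite clampK. Qed.

Lemma common_bound : exists L : nat, forall p t, `|piece p t| <= L%:R.
Proof.
have [|L hL] := @fin_all_exists piece_index (fun _ => nat)
  (fun p L => forall t, `|piece p t| <= L%:R).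
  by move=> p; apply: piece_bounded (@piece_cont p) (@piece_clamp p).
exists (\sum_p L p)%N => p t; apply: le_trans (hL p t) _.
by rewrite ler_nat (bigD1 p) //= leq_addr.
Qed.

Definition apart p p' := forall s t, piece p s <> piece p' t.

Lemma common_scale : exists2 N : nat, (0 < N)%N &
  forall p p', apart p p' -> forall s t, 3 < N%:R * `|piece p s - piece p' t|.
Proof.
have [|N hN] := @fin_all_exists (piece_index * piece_index)%type (fun _ => nat)
  (fun x N => apart x.1 x.2 -> forall s t, 3 < N%:R * `|piece x.1 s - piece x.2 t|).
  move=> [p p'] /=; case: (pselect (apart p p')) => [h|h]; last by exists 0%N => /h.
  have [N hN] := piece_separated (@piece_cont p) (@piece_cont p')
    (@piece_clamp p) (@piece_clamp p') h.
  by exists N.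
exists (\sum_x N x).+1 => // p p' h s t; apply: lt_le_trans (hN (p, p') h s t) _ => /=.
apply: ler_wpM2r => //; rewrite ler_nat; apply: leqW.
by rewrite (bigD1 (p, p')) //= leq_addr.
Qed.

Inductive vpiece v : piece_index -> Prop :=
| vpiece_pos : vpiece v (inl v)
| vpiece_src e w : e \in edges G -> ends e v w -> vpiece v (inr (e, inord 0))
| vpiece_tgt e w : e \in edges G -> ends e w v -> vpiece v (inr (e, inord 2)).

Lemma vpiece_point v p t : vpiece v p -> piece p t = pos v \/
  exists e s, [/\ e \in edges G, 0 < s < 1, piece p t = arc e s &
    exists w, (ends e v w /\ s <= 1 / 3) \/ (ends e w v /\ 2 / 3 <= s)].
Proof.
have c0 := clamp_ge0 t; have c1 := clamp_le1 t.
case=> [|e w eE en|e w eE en]; first by left.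
- rewrite /piece eE inordK // add0r.
  have [z|nz] := eqVneq (clamp t) 0; first by left; rewrite z mul0r; case: en.
  have cp : 0 < clamp t by rewrite lt_neqAle eq_sym nz.
  right; exists e, (clamp t / 3); split=> //; first by apply/andP; split; lra.
  by exists w; left; split=> //; lra.
- rewrite /piece eE inordK //.
  have [z|nz] := eqVneq (clamp t) 1.
    by left; rewrite z (_ : (2 + 1) / 3 = 1); [case: en|lra].
  have cp : clamp t < 1 by rewrite lt_neqAle nz.
  right; exists e, ((2 + clamp t) / 3); split=> //; first by apply/andP; split; lra.
  by exists w; right; split=> //; lra.
Qed.

Lemma mid_point e t : e \in edges G -> exists s, [/\ 0 < s < 1, 1 / 3 <= s <= 2 / 3 &
  piece (inr (e, inord 1)) t = arc e s].
Proof.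
move=> eE; rewrite /piece eE inordK //; exists ((1 + clamp t) / 3).
by have := clamp_ge0 t; have := clamp_le1 t; move=> c0 c1; split=> //; apply/andP; split; lra.
Qed.

Lemma open01 (s : R) : 0 < s < 1 -> 0 <= s <= 1.
Proof. by case/andP => /ltW -> /ltW ->. Qed.

Lemma vpiece_apart u v p p' : u != v -> vpiece u p -> vpiece v p' -> apart p p'.
Proof.
move=> uv vu vv s t; have [->|[e [x [eE x01 -> [w hw]]]]] := vpiece_point s vu;
  have [->|[e' [y [e'E y01 -> [w' hw']]]]] := vpiece_point t vv.
- by move/posI => E; rewrite E eqxx in uv.
- by move/esym; apply: arc_pos.
- by apply: arc_pos.
case: (eqVneq e e') => [E|ne]; last by apply: arc_arc => //; apply: open01.
subst e'; move/(arc_inj eE (open01 x01) (open01 y01)) => E; subst y.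
case: hw => -[en hx]; case: hw' => -[en' hy].
- by have [E _] := ends_inj en en'; rewrite E eqxx in uv.
- by lra.
- by lra.
- by have [_ E] := ends_inj en en'; rewrite E eqxx in uv.
Qed.

Lemma mid_vpos_apart e v : e \in edges G -> apart (inr (e, inord 1)) (inl v).
Proof. by move=> eE s t; have [x [x01 _ ->]] := mid_point s eE; apply: arc_pos. Qed.

Lemma mid_other_apart e e' k : e \in edges G -> e' \in edges G -> e != e' ->
  apart (inr (e, inord 1)) (inr (e', k)).
Proof.
move=> eE e'E ne s t; have [x [x01 _ ->]] := mid_point s eE.
by rewrite /piece e'E; apply: arc_arc => //; apply: param01.
Qed.

Section Scaled.
Variables (N L : nat).
Hypothesis N1 : (0 < N)%N.
Hypothesis bounded : forall p t, `|piece p t| <= L%:R.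
Hypothesis scale : forall p p', apart p p' -> forall s t, 3 < N%:R * `|piece p s - piece p' t|.

Let M := (N * (2 * L + 3) + 2)%N.
Let tb p (q : pt) : Prop := tube N L (piece p) q.
Let mid e := tb (inr (e, inord 1)).
Let rh v : pt := rho N L (pos v).

Lemma tb_apart p p' q : apart p p' -> tb p q -> tb p' q -> False.
Proof. by move=> h; apply: (tube_disjoint N1 (bounded p) (bounded p') (scale h)). Qed.

(* Vertex v owns the outer thirds of its arcs at v, together with the middle thirds
   of the arcs that start at v, as far as these avoid the last third. *)
Definition zone v (q : pt) : Prop :=
  (exists2 p, vpiece v p & tb p q) \/
  (exists e w, [/\ e \in edges G, ends e v w, mid e q & ~ tb (inr (e, inord 2)) q]).

Lemma mid_vpiece e u v w p q : e \in edges G -> ends e u w -> ~ tb (inr (e, inord 2)) q ->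
  mid e q -> vpiece v p -> tb p q -> u = v.
Proof.
move=> eE en n2 me vp; case: vp => [|e' w' e'E en'|e' w' e'E en'] tq.
- by case: (tb_apart (mid_vpos_apart eE) me tq).
- case: (eqVneq e e') => [E|ne]; last by case: (tb_apart (mid_other_apart eE e'E ne) me tq).
  by subst e'; have [] := ends_inj en en'.
- case: (eqVneq e e') => [E|ne]; last by case: (tb_apart (mid_other_apart eE e'E ne) me tq).
  by subst e'; case: n2.
Qed.

Lemma zone_disjoint u v q : zone u q -> zone v q -> u = v.
Proof.
case=> [[p vu tu]|[e [w [eE en me n2]]]]; case=> [[p' vv tv]|[e' [w' [e'E en' me' n2']]]].
- by apply/eqP/negPn/negP => uv; apply: (tb_apart (vpiece_apart uv vu vv) tu tv).
- exact/esym/(mid_vpiece e'E en' n2' me' vu tu).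
- exact: (mid_vpiece eE en n2 me vv tv).
case: (eqVneq e e') => [E|ne]; last by case: (tb_apart (mid_other_apart eE e'E ne) me me').
by subst e'; have [] := ends_inj en en'.
Qed.

Lemma zone_box v q : zone v q -> (0 < q.1 < M /\ 0 < q.2 < M)%N.
Proof. by case=> [[p _ /(tube_box N1 (bounded p))]|[e [w [_ _ /(tube_box N1 (bounded _))]]]]. Qed.

Lemma rh_zone v : zone v (rh v).
Proof. by left; exists (inl v); [exact: vpiece_pos|exists 0; apply: near1_refl]. Qed.

(** Only the component of the root is kept, since cutting off the last thirds may disconnect the
    zone. *)
Definition branch v : pred pt := fun q => `[< reach (zone v) (rh v) q >].

Lemma branchP v q : branch v q <-> reach (zone v) (rh v) q.
Proof. by split => /asboolP. Qed.

Lemma tb_start p : forall q, tb p q -> reach (tb p) (rho N L (piece p 0)) q.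
Proof. by move=> q tq; apply: (tube_reach N1 (@piece_cont p) (bounded p) tq). Qed.

Lemma tb_end p : tb p (rho N L (piece p 1)).
Proof. by exists 1; apply: near1_refl. Qed.

Lemma piece_join e (k k' : 'I_3) : e \in edges G -> k' = k.+1 :> nat ->
  piece (inr (e, k')) 0 = piece (inr (e, k)) 1.
Proof.
move=> eE kk; rewrite /piece eE kk; congr (arc e _).
by rewrite !clamp_id ?lexx ?ler01 // addr0 natr1.
Qed.

Lemma branch_tgt e u v q : e \in edges G -> ends e u v -> tb (inr (e, inord 2)) q -> branch v q.
Proof.
move=> eE en tq; apply/branchP.
have vp := vpiece_tgt eE en.
apply: (@reach_sub (tb (inr (e, inord 2)))) => [x tx|]; first by left; exists (inr (e, inord 2)).
apply: reach_trans (tb_start tq); apply: reach_sym.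
rewrite (_ : rh v = rho N L (piece (inr (e, inord 2)) 1)); first exact/tb_start/tb_end.
rewrite /rh /piece eE inordK // clamp_id ?lexx ?ler01 //.
by rewrite (_ : (2 + 1) / 3 = 1); [case: en => _ _ ->|lra].
Qed.

(** Follow the tubes of the arc from the root of u to that of v. The first grid point outside the
    zone of u can only lie in the tube of the last third, which belongs to the branch set of v. *)
Lemma edge_crossing e u v : e \in edges G -> ends e u v ->
  exists p q, [/\ gadj p q, branch u p & branch v q].
Proof.
move=> eE en; pose A q := exists k, tb (inr (e, k)) q.
have full : reach A (rh u) (rh v).
  have sub k : forall q, tb (inr (e, k)) q -> reach A (rho N L (piece (inr (e, k)) 0)) q.
    move=> q /tb_start; apply: reach_sub => x tx; by exists k.
  have j01 := @piece_join e (inord 0) (inord 1) eE.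
  have j12 := @piece_join e (inord 1) (inord 2) eE.
  rewrite !inordK // in j01 j12.
  have s0 : rh u = rho N L (piece (inr (e, inord 0)) 0).
    rewrite /rh /piece eE inordK // clamp_id ?lexx ?ler01 // add0r mul0r.
    by case: en => _ -> _.
  have s1 : rh v = rho N L (piece (inr (e, inord 2)) 1).
    rewrite /rh /piece eE inordK // clamp_id ?lexx ?ler01 //.
    by rewrite (_ : (2 + 1) / 3 = 1); [case: en => _ _ ->|lra].
  rewrite s0 s1; apply: reach_trans (sub _ _ (tb_end _)).
  rewrite j12 //; apply: reach_trans (sub _ _ (tb_end _)).
  by rewrite j01 //; apply: sub; apply: tb_end.
have bru : branch u (rh u) by apply/branchP/reach_refl/rh_zone.
have : branch u (rh v) \/ exists p q, [/\ gadj p q, branch u p & branch v q].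
  elim: full => [_|x y _ [bx|] xy Ay]; [by left| |by right].
  case: (pselect (zone u y)) => [zy|nzy].
    by left; apply/branchP; apply: reach_step xy zy; apply/branchP.
  right; exists x, y; split=> //; apply: (branch_tgt eE en).
  case: Ay => k; case: (pselect (tb (inr (e, inord 2)) y)) => // n2 tk; case: nzy.
  case: k tk => -[|[|[|//]]] lt tk.
  - left; exists (inr (e, inord 0)); first exact: vpiece_src eE en.
    by rewrite (_ : inord 0 = Ordinal lt) //; apply: val_inj; rewrite /= inordK.
  - right; exists e, v; split=> //.
    by rewrite /mid (_ : inord 1 = Ordinal lt) //; apply: val_inj; rewrite /= inordK.
  - case: n2; by rewrite (_ : inord 2 = Ordinal lt) //; apply: val_inj; rewrite /= inordK.
case=> // /branchP bu; have [_ zu] := reach_in bu; have := zone_disjoint zu (rh_zone v).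
by move=> E; have := ends_neq eE en; rewrite E eqxx.
Qed.

Lemma drawing_grid_model : grid_model (edges G) M rh branch.
Proof.
split.
- by move=> v p /branchP bv; have [_ /zone_box] := reach_in bv.
- move=> u v p /branchP bu /branchP bv.
  by have [_ zu] := reach_in bu; have [_ zv] := reach_in bv; apply: zone_disjoint zu zv.
- move=> v p /branchP bv; have [s [ps ls hs]] := reach_path bv; exists s; split=> //.
  by apply/allP => x /hs h; apply/branchP.
- move=> e eE; have [u [v en]] := ends_exist eE.
  have [p [q [pq bu bv]]] := edge_crossing eE en.
  by exists u, v, p, q; split=> //; case: en.
Qed.

End Scaled.
End Drawing.

Lemma planar_two_basis (R : realType) (T : finType) (G : sgraph T) : planar R G ->
  exists (I : finType) (B : I -> {set {set T}}), two_basis (edges G) B.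
Proof.
case=> pos [arc [posI arcP ap aa]].
have [L hL] := common_bound arcP.
have [N N1 hN] := common_scale arcP.
exact: grid_two_basis (edges_two_unif G) (drawing_grid_model posI arcP ap aa N1 hL hN).
Qed.

Local Close Scope ring_scope.

(** * Theta graphs on six vertices *)

Definition mk_sgraph (T : finType) (E : {set {set T}}) (E2 : two_unif E) : sgraph T :=
  exist (fun E : {set {set T}} => [forall e in E, #|e| == 2]) E E2.

Definition hexagon : seq 'I_6 :=
  [:: Ordinal (isT : 0 < 6); Ordinal (isT : 1 < 6); Ordinal (isT : 2 < 6);
      Ordinal (isT : 3 < 6); Ordinal (isT : 4 < 6); Ordinal (isT : 5 < 6)].

Lemma next_hexagon v : val (next hexagon v) = v.+1 %% 6.
Proof. by case: v => [[|[|[|[|[|[|//]]]]]] lt]. Qed.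

Definition chorded_hexagon (y : 'I_6) : {set {set 'I_6}} :=
  ed ord0 y |: [set ed v (next hexagon v) | v : 'I_6].

Lemma chorded_hexagon_sgraph y : y != ord0 -> two_unif (chorded_hexagon y).
Proof.
move=> y0; apply/forall_inP => e; rewrite !inE => /orP [/eqP ->|/imsetP [v _ ->]].
  by rewrite card_ed (eq_sym ord0) y0.
rewrite card_ed eqSS eqb1 -val_eqE next_hexagon.
by case: v => [[|[|[|[|[|[|//]]]]]] lt].
Qed.

Lemma chorded_hexagon_theta y (y0 : y != ord0) : ~~ consecutive hexagon ord0 y ->
  Theta 6 (mk_sgraph (chorded_hexagon_sgraph y0)).
Proof.
move=> nc; split; first exact: card_ord.
split; first by rewrite card_ord.
exists hexagon, ord0, y; split=> //; last by rewrite eq_sym.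
by case=> [[|[|[|[|[|[|//]]]]]] lt].
Qed.

Lemma theta_free_no_theta6 (T : finType) (G : sgraph T) :
  family_free (Theta 6) G -> no_theta6 (edges G).
Proof.
move=> free a b c d e f un ab bc cd de ef fa.
pose t := [:: a; b; c; d; e; f].
pose h (i : 'I_6) := nth a t i.
have hI : injective h.
  by move=> i j /eqP; rewrite nth_uniq // => /eqP /val_inj.
have key y (y0 : y != ord0) : ~~ consecutive hexagon ord0 y -> ed a (h y) \notin edges G.
  move=> nc; apply/negP => ay; apply: (free _ _ (chorded_hexagon_theta y0 nc)).
  exists h; split=> // e0; rewrite /edges /= !inE.
  have him u v : h @: ed u v = ed (h u) (h v) by rewrite imsetU1 imset_set1.
  case/orP => [/eqP ->|/imsetP [v _ ->]]; rewrite him //.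
  by rewrite /h next_hexagon; case: v => [[|[|[|[|[|[|//]]]]]] lt].
split.
  exact: (key (Ordinal (isT : 2 < 6)) isT isT).
exact: (key (Ordinal (isT : 3 < 6)) isT isT).
Qed.

Section Subgraph.
Variables (T : finType) (G : sgraph T) (S : {set T}).

Lemma induced_sgraph : two_unif [set e in edges G | e \subset S].
Proof.
by apply/forall_inP => e; rewrite inE => /andP [/(forall_inP (valP G))].
Qed.

Definition induced : sgraph T := mk_sgraph induced_sgraph.

(** The drawing restricts to the subgraph and yields a fresh face basis there, which is what [no_K5]
    asks for. *)
Lemma planar_induced (R : realType) : planar R G -> planar R induced.
Proof.
case=> pos [arc [h1 h2 h3 h4]]; exists pos, arc.
have sub e : e \in edges induced -> e \in edges G by rewrite inE => /andP [].
by split=> // [e /sub /h2|e v t /sub|e e' s t /sub + /sub] //; [apply: h3|apply: h4].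
Qed.
End Subgraph.

Theorem planar_theta6_bound (R : realType) (T : finType) (G : sgraph T) :
  planar R G -> family_free (Theta 6) G -> 6 <= #|T| -> 7 * #|edges G| + 36 <= 18 * #|T|.
Proof.
move=> pl free n6; have [I [B tb]] := planar_two_basis pl.
apply: (edge_bound (edges_two_unif G) tb (theta_free_no_theta6 free)) n6 => S S5.
have [I' [B' tb']] := planar_two_basis (planar_induced S pl).
apply: (no_K5 (edges_two_unif (induced G S)) tb' S5) => e.
by rewrite inE => /andP [].
Qed.

Lemma ex_planar_bound (R : realType) n : 6 <= n ->
  7 * ex_planar R n (Theta 6) + 36 <= 18 * n.
Proof.
move=> n6; rewrite /ex_planar.
elim/big_ind: _ => [|x y hx hy|G /asboolP [pl free]].
- by lia.
- by rewrite /maxn; case: ifP.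
by have := planar_theta6_bound pl free; rewrite card_ord; apply.
Qed.

(** * Two copies of K5 minus an edge *)

(* The copies are on {0,1,2,3,4} without 04 and on {0,5,6,7,8} without 08. *)
Definition bowtie_edges : seq (nat * nat) :=
  [:: (0, 1); (0, 2); (0, 3); (1, 2); (1, 3); (1, 4); (2, 3); (2, 4); (3, 4);
      (0, 5); (0, 6); (0, 7); (5, 6); (5, 7); (5, 8); (6, 7); (6, 8); (7, 8)].

Definition swap (p : nat * nat) := (p.2, p.1).
Definition darts := bowtie_edges ++ map swap bowtie_edges.
Definition adj (a b : nat) := (a, b) \in darts.

Definition bowtie_set : {set {set 'I_9}} :=
  [set e in [seq ed (inord p.1) (inord p.2) : {set 'I_9} | p <- bowtie_edges]].

Lemma bowtie_edgesP p : p \in bowtie_edges -> (p.1 < p.2 < 9)%N.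
Proof.
have : all (fun p => (p.1 < p.2 < 9)%N) bowtie_edges by [].
by move/allP; apply.
Qed.

Lemma mem_bowtie (a b : 'I_9) : (ed a b \in bowtie_set) = adj a b.
Proof.
rewrite inE; apply/mapP/idP => [[[i j] p E]|].
  have /= /andP [ij j9] := bowtie_edgesP p; have i9 := ltn_trans ij j9.
  move/eqP: E; rewrite ed_eq -!val_eqE /= !inordK // /adj mem_cat.
  case/orP => /andP [/eqP -> /eqP ->]; first by rewrite p.
  by rewrite (map_f swap p) orbT.
rewrite /adj mem_cat => /orP [p|/mapP [[i j] p [Ea Eb]]].
  by exists (val a, val b) => //=; rewrite !inord_val.
exists (i, j) => //=; have /= /andP [ij j9] := bowtie_edgesP p.
by rewrite edC; congr ed; apply: val_inj; rewrite /= ?Ea ?Eb inordK // (ltn_trans ij j9).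
Qed.

Lemma bowtie_two_unif : two_unif bowtie_set.
Proof.
apply/two_unifP => e; rewrite inE => /mapP [[i j] p ->].
have /= /andP [ij j9] := bowtie_edgesP p.
by rewrite card_ed -val_eqE /= !inordK ?(ltn_trans ij j9) // (ltn_eqF ij).
Qed.

Definition bowtie : sgraph 'I_9 := mk_sgraph bowtie_two_unif.

Lemma card_bowtie : #|edges bowtie| = 18.
Proof.
rewrite /edges /= cardsE; apply: (etrans (card_uniqP _)); last by rewrite size_map.
rewrite map_inj_in_uniq // => -[i j] [k l] p q /eqP.
have /= /andP [ij j9] := bowtie_edgesP p; have /= /andP [kl l9] := bowtie_edgesP q.
have i9 := ltn_trans ij j9; have k9 := ltn_trans kl l9.
rewrite ed_eq -!val_eqE /= !inordK // => /orP [/andP [/eqP -> /eqP -> //]|].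
by move=> /andP [/eqP E1 /eqP E2]; move: ij; rewrite E1 E2 ltnNge (ltnW kl).
Qed.

(** A cycle stays within one of the two copies, which have five vertices each. The check runs over
    all walks along neighbour lists. *)
Lemma no_hexagon (a b c d e f : nat) : uniq [:: a; b; c; d; e; f] ->
  adj a b -> adj b c -> adj c d -> adj d e -> adj e f -> adj f a -> False.
Proof.
pose nbrs x := [seq y <- iota 0 9 | adj x y].
have nbrsP x y : adj x y -> y \in nbrs x.
  have bounded : all (fun p => p.2 \in iota 0 9) darts by [].
  by move=> xy; rewrite mem_filter xy (allP bounded _ xy).
have chk : all (fun a => all (fun b => all (fun c => all (fun d => all (fun e => all (fun f =>
    ~~ (adj f a && uniq [:: a; b; c; d; e; f])) (nbrs e)) (nbrs d)) (nbrs c)) (nbrs b)) (nbrs a))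
    (iota 0 9).
  by vm_compute.
move=> un ab bc cd de ef fa; have a9 : a \in iota 0 9.
  by have := nbrsP _ _ fa; rewrite mem_filter => /andP [].
have := allP (allP (allP (allP (allP (allP chk a a9) b (nbrsP _ _ ab)) c (nbrsP _ _ bc))
  d (nbrsP _ _ cd)) e (nbrsP _ _ de)) f (nbrsP _ _ ef).
by rewrite fa un.
Qed.

Lemma bowtie_free : family_free (Theta 6) bowtie.
Proof.
move=> S H [cS [_ [c [x [y [uc allc _ _ EH]]]]]] [h [hI hE]].
have step v : adj (h v) (h (next c v)).
  have him : h @: ed v (next c v) = ed (h v) (h (next c v)) by rewrite imsetU1 imset_set1.
  rewrite -mem_bowtie -him.
  by apply: hE; rewrite EH !inE; apply/orP; right; apply/imsetP; exists v.
have cy : cycle (fun u v => adj (h u) (h v)) c by apply: cycle_from_next.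
have sc : size c = 6 by rewrite -(card_uniqP uc) -cS; apply: eq_card => v; rewrite allc.
case: c uc sc cy {allc EH step} => [|a [|b [|d [|e [|f [|g [|]]]]]]] // uc _.
have vI : injective (fun v => val (h v)) by move=> u v /val_inj /hI.
move: uc; rewrite -(map_inj_uniq vI) => un /= /and5P [ab bdry de ef /and3P [fg ga _]].
exact: no_hexagon un ab bdry de ef fg ga.
Qed.

Local Open Scope ring_scope.

(** Coordinates of a straight-line drawing: 3 lies inside the triangle 0, 1, 2 and 4 inside the
    triangle 1, 2, 3. The second copy is the mirror image in the vertical axis. *)
Definition xs : seq int := [:: 0; 3; 3; 1; 2; - 3%:Z; - 3%:Z; - 1%:Z; - 2%:Z].
Definition ys : seq int := [:: 0; 4; - 2%:Z; 1; 0; 4; - 2%:Z; 1; 0].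

Definition idet (a b c : nat) : int :=
  (xs`_b - xs`_a) * (ys`_c - ys`_a) - (ys`_b - ys`_a) * (xs`_c - xs`_a).

(* The line through q has p on one side, with at most one end of p on it, or the
   line through p has q strictly on one side. *)
Definition separated (p q : nat * nat) : bool :=
  let la := idet q.1 q.2 p.1 in let lb := idet q.1 q.2 p.2 in
  (0 <= la * lb) && ((la != 0) || (lb != 0)) || (0 < idet p.1 p.2 q.1 * idet p.1 p.2 q.2).

Lemma darts_separated p q : p \in darts -> q \in darts -> q != p -> q != swap p -> separated p q.
Proof.
have chk : all (fun p => all (fun q => [|| q == p, q == swap p | separated p q]) darts) darts.
  by vm_compute.
by move=> pd qd n1 n2; move/allP/(_ _ pd)/allP/(_ _ qd): chk; rewrite (negPf n1) (negPf n2).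
Qed.

Lemma darts_generic p v : p \in darts -> (v < 9)%N -> v != p.1 -> v != p.2 -> idet p.1 p.2 v != 0.
Proof.
have chk : all (fun p => all (fun v => [|| v == p.1, v == p.2 | idet p.1 p.2 v != 0])
    (iota 0 9)) darts.
  by vm_compute.
move=> pd v9 n1 n2; have vi : v \in iota 0 9 by rewrite mem_iota.
by move/allP/(_ _ pd)/allP/(_ _ vi): chk; rewrite (negPf n1) (negPf n2).
Qed.

Lemma darts_neq p : p \in darts -> p.1 != p.2.
Proof. by have /allP h : all (fun p => p.1 != p.2) darts by []; move/h. Qed.

Section Drawing.
Variable R : realType.
Implicit Types (A B C D : R * R) (s t : R).

Definition det A B C : R := (B.1 - A.1) * (C.2 - A.2) - (B.2 - A.2) * (C.1 - A.1).

Definition seg A B t : R * R := ((1 - t) * A.1 + t * B.1, (1 - t) * A.2 + t * B.2).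

Lemma det_seg C D A B s : det C D (seg A B s) = (1 - s) * det C D A + s * det C D B.
Proof. by rewrite /det /seg /=; ring. Qed.

Lemma det_on C D t : det C D (seg C D t) = 0.
Proof. by rewrite /det /seg /=; ring. Qed.

Lemma mix_neq0 (a b s : R) : 0 < s < 1 -> 0 <= a * b -> (a != 0) || (b != 0) ->
  (1 - s) * a + s * b != 0.
Proof.
case/andP => s0 s1 ab nz; apply/eqP => E.
(* Multiplied by a and by b, the equation becomes a vanishing sum of nonnegative terms; the strict
   bounds on s then make both squares zero. *)
have E1 : (1 - s) * a ^+ 2 + s * (a * b) = 0 by rewrite -[RHS](mulr0 a) -E; ring.
have E2 : (1 - s) * (a * b) + s * b ^+ 2 = 0 by rewrite -[RHS](mulr0 b) -E; ring.
have h1 : 0 <= a ^+ 2 := sqr_ge0 a.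
have h2 : 0 <= b ^+ 2 := sqr_ge0 b.
have a0 : a ^+ 2 = 0 by move: (a ^+ 2) (a * b) h1 ab E1 => x y *; nra.
have b0 : b ^+ 2 = 0 by move: (b ^+ 2) (a * b) h2 ab E2 => x y *; nra.
by move/eqP: a0; move/eqP: b0; rewrite !sqrf_eq0 => /eqP b0 /eqP a0; rewrite a0 b0 eqxx in nz.
Qed.

Lemma mix_pos_neq0 (a b t : R) : 0 <= t <= 1 -> 0 < a * b -> (1 - t) * a + t * b != 0.
Proof.
case/andP => t0 t1 ab; apply/eqP => E.
have : (1 - t) * a ^+ 2 + t * (a * b) = 0 by rewrite -[RHS](mulr0 a) -E; ring.
have : (1 - t) * (a * b) + t * b ^+ 2 = 0 by rewrite -[RHS](mulr0 b) -E; ring.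
have h1 : 0 <= a ^+ 2 := sqr_ge0 a.
have h2 : 0 <= b ^+ 2 := sqr_ge0 b.
by move: (a ^+ 2) (b ^+ 2) (a * b) h1 h2 ab => x y z *; nra.
Qed.

Definition pt9 (v : nat) : R * R := ((xs`_v)%:~R, (ys`_v)%:~R).

Lemma det_pt9 a b c : det (pt9 a) (pt9 b) (pt9 c) = (idet a b c)%:~R.
Proof. by rewrite /det /idet /= !rmorphB !rmorphM !rmorphB. Qed.

Lemma seg_disjoint p q s t : p \in darts -> q \in darts -> q != p -> q != swap p ->
  0 < s < 1 -> 0 <= t <= 1 -> seg (pt9 p.1) (pt9 p.2) s <> seg (pt9 q.1) (pt9 q.2) t.
Proof.
move=> pd qd n1 n2 s01 t01 E.
case/orP: (darts_separated pd qd n1 n2) => [/andP [h1 h2]|h].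
  have := det_on (pt9 q.1) (pt9 q.2) t; rewrite -E det_seg !det_pt9; apply/eqP/mix_neq0 => //.
    by rewrite -rmorphM ler0z.
  by rewrite !intr_eq0.
have := det_on (pt9 p.1) (pt9 p.2) s; rewrite E det_seg !det_pt9; apply/eqP/mix_pos_neq0 => //.
by rewrite -rmorphM ltr0z.
Qed.

Lemma pt9_inj (v w : nat) : (v < 9)%N -> (w < 9)%N -> pt9 v = pt9 w -> v = w.
Proof.
move=> v9 w9 [/eqP E1 /eqP E2]; move: E1 E2; rewrite !eqr_int => E1 E2.
have chk : all (fun v => all (fun w => (xs`_v == xs`_w) && (ys`_v == ys`_w) ==> (v == w))
    (iota 0 9)) (iota 0 9).
  by vm_compute.
have vi : v \in iota 0 9 by rewrite mem_iota.
have wi : w \in iota 0 9 by rewrite mem_iota.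
by move/allP/(_ _ vi)/allP/(_ _ wi): chk; rewrite E1 E2 => /eqP.
Qed.

Lemma seg_inj A B s t : A <> B -> seg A B s = seg A B t -> s = t.
Proof.
move=> AB [E1 E2]; apply/eqP/negPn/negP => st; apply: AB.
have nz : s - t != 0 by rewrite subr_eq0.
have F1 : (s - t) * (B.1 - A.1) = 0.
  have -> : (s - t) * (B.1 - A.1) = ((1 - s) * A.1 + s * B.1) - ((1 - t) * A.1 + t * B.1) by ring.
  by rewrite E1 subrr.
have F2 : (s - t) * (B.2 - A.2) = 0.
  have -> : (s - t) * (B.2 - A.2) = ((1 - s) * A.2 + s * B.2) - ((1 - t) * A.2 + t * B.2) by ring.
  by rewrite E2 subrr.
move/eqP: F1; move/eqP: F2; rewrite !mulf_eq0 (negPf nz) /= !subr_eq0 => /eqP F2 /eqP F1.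
by rewrite [A]surjective_pairing [B]surjective_pairing F1 F2.
Qed.

Lemma seg0 A B : seg A B 0 = A.
Proof. by rewrite /seg subr0 !mul0r !mul1r !addr0 -surjective_pairing. Qed.

Lemma seg1 A B : seg A B 1 = B.
Proof. by rewrite /seg subrr !mul0r !mul1r !add0r -surjective_pairing. Qed.

Lemma seg_cont A B : continuous (seg A B).
Proof.
have aff (a b : R) : continuous (fun t : R => (1 - t) * a + t * b).
  move=> t; apply: cvgD; apply: cvgMl; last exact: cvg_id.
  by apply: cvgB; [exact: cvg_cst|exact: cvg_id].
by move=> t; exact: (cvg_pair (aff A.1 B.1 t) (aff A.2 B.2 t)).
Qed.

Definition arc9 (e : {set 'I_9}) : R -> R * R :=
  seg (pt9 (nth ord0 (enum e) 0)) (pt9 (nth ord0 (enum e) 1)).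

Lemma arc9P e : e \in bowtie_set -> exists a b : 'I_9,
  [/\ (val a, val b) \in darts, e = ed a b & arc9 e = seg (pt9 a) (pt9 b)].
Proof.
move=> eE; have := two_unifP _ bowtie_two_unif _ eE; rewrite cardE /arc9.
case En: (enum e) => [|a [|b [|]]] //= _; exists a, b.
have Ee : e = ed a b by apply/setP => v; rewrite -mem_enum En !inE.
by split=> //; rewrite -[_ \in darts]/(adj a b) -mem_bowtie -Ee.
Qed.

Lemma pt9_neq (a b : 'I_9) : (val a, val b) \in darts -> pt9 a <> pt9 b.
Proof.
move=> d /(pt9_inj (ltn_ord a) (ltn_ord b)) E; have := darts_neq d; by rewrite /= E eqxx.
Qed.

Lemma bowtie_planar : planar R bowtie.
Proof.
exists (fun v : 'I_9 => pt9 v), arc9; split.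
- by move=> v w /(pt9_inj (ltn_ord v) (ltn_ord w)) /val_inj.
- move=> e /arc9P [a [b [d Ee ->]]]; split.
    split; first exact: continuous_subspaceT (@seg_cont _ _).
    move=> s t _ _; exact: seg_inj (pt9_neq d).
  rewrite seg0 seg1; apply/seteqP; split=> x /=.
    by case=> ->; [exists a|exists b]; rewrite //= Ee in_ed eqxx ?orbT.
  by case=> v; rewrite /= Ee in_ed => /orP [] /eqP -> <-; [left|right].
- move=> e v t /arc9P [a [b [d Ee ->]]] t01 E.
  have ab := pt9_neq d.
  have [va|va] := eqVneq (val v) (val a).
    by move: E; rewrite va -[RHS](seg0 _ (pt9 b)) => /(seg_inj ab) t0; rewrite t0 ltxx in t01.
  have [vb|vb] := eqVneq (val v) (val b).
    by move: E; rewrite vb -[RHS](seg1 (pt9 a)) => /(seg_inj ab) t1; rewrite t1 ltxx andbF in t01.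
  have := darts_generic d (ltn_ord v) va vb; rewrite -(intr_eq0 R) -det_pt9 -E det_on.
  by rewrite eqxx.
- move=> e e' s t /arc9P [a [b [d Ee ->]]] /arc9P [a' [b' [d' Ee' ->]]] ne s01 t01.
  apply: (@seg_disjoint (val a, val b) (val a', val b')) => //.
    apply: contra ne; rewrite xpair_eqE => /andP [/eqP/val_inj aa /eqP/val_inj bb].
    by rewrite Ee Ee' aa bb.
  apply: contra ne; rewrite xpair_eqE => /andP [/eqP/val_inj aa /eqP/val_inj bb].
  by rewrite Ee Ee' aa bb edC.
Qed.

End Drawing.

Theorem theorem2p3 (R : realType) :
  (forall n : nat, (6 <= n)%N ->
     (ex_planar R n (Theta 6))%:R <= 18 * (n%:R - 2) / 7 :> rat) /\
  ex_planar R 9 (Theta 6) = 18%N.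
Proof.
split=> [n n6|].
  have := ex_planar_bound R n6; rewrite -(ler_nat rat) natrD !natrM => h.
  rewrite ler_pdivlMr //; lra.
apply/eqP; rewrite eqn_leq; apply/andP; split.
  by have := ex_planar_bound R (isT : (6 <= 9)%N); lia.
rewrite -card_bowtie /ex_planar.
apply: (@leq_bigmax_cond _ _ (fun G : sgraph 'I_9 => #|edges G|) bowtie).
by apply/asboolP; split; [exact: bowtie_planar|exact: bowtie_free].
Qed.
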